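(* Let $M$ be a compact smooth $7$-manifold with a $G_2$-structure $\varphi$ with octonion covariant derivative $D$, and let $\mathcal{E}$ be the functional on unit octonion sections given by $$\mathcal{E}(V)=\frac12\int_M|DV|^2\,\mathrm{vol}.$$ The critical points $V$ of $\mathcal{E}$ satisfy $$D^*DV-|DV|^2V=0.$$
   Context: Setting. A $G_2$-structure on a smooth $7$-manifold $M$ is identified with a positive $3$-form $\varphi$, i.e. one that at each point lies in the $GL(7,\mathbb{R})$-orbit of $\varphi_0=e^{123}+e^{145}+e^{167}+e^{246}-e^{257}-e^{347}-e^{356}$. It determines a unique Riemannian metric $g$ and volume form $\mathrm{vol}$ (hence an orientation) by $g(u,v)\,\mathrm{vol}=\frac16(u\lrcorner\varphi)\wedge(v\lrcorner\varphi)\wedge\varphi$, where $\lrcorner$ is contraction. Let $*$ be the Hodge star, $\psi=*\varphi$, and $\nabla$ the Levi-Civita connection of $g$. Octonion bundle. $\mathbb{O}M=\Lambda^0\oplus TM$, where $\Lambda^0$ is the trivial real line bundle; an octonion section is $A=(a,\alpha)$ with $a$ a function and $\alpha$ a vector field. $\langle (a,\alpha),(b,\beta)\rangle=ab+g(\alpha,\beta)$; cross product $\langle\alpha\times\beta,\gamma\rangle=\varphi(\alpha,\beta,\gamma)$; octonion product $AB=(ab-\langle\alpha,\beta\rangle,\ a\beta+b\alpha+\alpha\times\beta)$. The unit octonion bundle $S\mathbb{O}M$ is the unit sphere subbundle of $\mathbb{O}M$. Torsion and $D$. The torsion tensor $T_{ab}$ of $\varphi$ is the $2$-tensor with $\nabla_a\varphi_{bcd}=2T_a{}^{e}\psi_{ebcd}$;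 $T_X=(0,X\lrcorner T)$ has vector part $X^aT_a{}^b$. $\nabla_X(a,\alpha)=(\nabla_Xa,\nabla_X\alpha)$ and $D_XA=\nabla_XA-A\,T_X$. $D^*$ is the $L^2$-adjoint of $D$; on an $\mathbb{O}M$-valued $1$-form $B$, $D^*B=-D^iB_i=-(\nabla^iB_i-B_iT^i)$. $|DV|^2=g^{ij}\langle D_iV,D_jV\rangle$. A critical point of $\mathcal{E}:\Gamma(S\mathbb{O}M)\to\mathbb{R}$ is a smooth unit octonion section $V$ such that $\frac{d}{dt}\big|_{t=0}\mathcal{E}(V(t))=0$ for every smooth one-parameter family $V(t)$ of unit octonion sections with $V(0)=V$. *)

(* Defs.v *)
From HB Require Import structures.
From mathcomp Require Import all_boot all_order all_algebra all_fingroup.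
From mathcomp Require Import all_classical all_reals all_analysis.

Set Implicit Arguments.
Unset Strict Implicit.
Unset Printing Implicit Defensive.

Import Order.TTheory GRing.Theory Num.Theory.
Import numFieldNormedType.Exports.

Local Open Scope classical_set_scope.
Local Open Scope ring_scope.

(** * Smooth functions on open sets *)

Section Smooth.
Context {R : realType} {E : normedModType R}.

Fixpoint iterD (s : seq E) (f : E -> R) : E -> R :=
  if s is v :: s' then fun x => 'D_v (iterD s' f) x else f.

(* For [U] open and [E] of finite dimension this is C^oo on [U]; the values of
   [f] outside of [U] are irrelevant. *)
Definition smooth_on (U : set E) (f : E -> R) : Prop :=
  forall (s : seq E) (x : E), U x ->
    {for x, continuous (iterD s f)} /\ forall v, derivable (iterD s f) x v.

End Smooth.

(** * Smooth manifolds *)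

(* The carrier is pointed (so nonempty) because the library only puts Borel
   sigma-algebras, and hence measures, on pointed types. [chart_inv i] is only
   meaningful on the open set [chart i @` chart_dom i]; [chart_at p] is a preferred
   chart around [p], used to evaluate scalars that do not depend on the chart. *)
Record manifold (R : realType) (n : nat) := Manifold {
  carrier :> ptopologicalType;
  chart_index : Type;
  chart_dom : chart_index -> set carrier;
  chart : chart_index -> carrier -> 'rV[R]_n;
  chart_inv : chart_index -> 'rV[R]_n -> carrier;
  chart_at : carrier -> chart_index;
  manifold_hausdorff : hausdorff_space carrier;
  manifold_second_countable : @second_countable carrier;
  dom_open : forall i, open (chart_dom i);
  codom_open : forall i, open (chart i @` chart_dom i);
  chart_atP : forall p, chart_dom (chart_at p) p;
  chartK : forall i p, chart_dom i p -> chart_inv i (chart i p) = p;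
  chart_continuous : forall i p, chart_dom i p -> {for p, continuous (chart i)};
  chart_inv_continuous : forall i x, (chart i @` chart_dom i) x ->
    {for x, continuous (chart_inv i)};
  chart_smooth : forall i j (b : 'I_n),
    smooth_on (chart i @` (chart_dom i `&` chart_dom j))
              (fun x => chart j (chart_inv i x) 0 b)
}.

Arguments chart_index {R n}.
Arguments chart_dom {R n m}.
Arguments chart {R n m}.
Arguments chart_inv {R n m}.
Arguments chart_at {R n m}.

(** * Covariant tensors on R^7, exterior algebra *)

Section Tensors.
Context {R : realType}.

(* Components of a covariant [k]-tensor in a frame [e_0, ..., e_6]. *)
Definition tensor (k : nat) : Type := k.-tuple 'I_7 -> R.

(* Components in the frame [f_a = \sum_b A a b *: e_b] of the tensor with
   components [w] in the frame [e]. *)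
Definition pullback (A : 'M[R]_7) k (w : tensor k) : tensor k := fun s =>
  \sum_(t : k.-tuple 'I_7) w t * \prod_(l < k) A (tnth s l) (tnth t l).

Definition contract (a : 'I_7) k (w : tensor k.+1) : tensor k :=
  fun s => w [tuple of a :: s].

Definition wedge k l (w : tensor k) (z : tensor l) : tensor (k + l) := fun s =>
  ((k`! * l`!)%:R)^-1 * \sum_(sigma : 'S_(k + l))
    (-1) ^+ sigma * w [tuple tnth s (sigma (lshift l x)) | x < k]
                  * z [tuple tnth s (sigma (rshift k x)) | x < l].

(* [eform [:: i1; ...; ik]] is [e^{i1...ik}], with indices starting from 1. *)
Definition eform (s : seq nat) : tensor (size s) := fun t =>
  \det (\matrix_(i < size s, j < size s) ((nth 0%N s i == (tnth t j).+1)%:R : R)).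
Arguments eform s : clear implicits.

Definition phi0 : tensor 3 := fun t =>
  eform [:: 1; 2; 3]%N t + eform [:: 1; 4; 5]%N t + eform [:: 1; 6; 7]%N t
  + eform [:: 2; 4; 6]%N t - eform [:: 2; 5; 7]%N t - eform [:: 3; 4; 7]%N t
  - eform [:: 3; 5; 6]%N t.

Definition positive3 (w : tensor 3) : Prop :=
  exists2 A : 'M[R]_7, A \in unitmx & w = pullback A phi0.

Definition gram (g : tensor 2) : 'M[R]_7 := \matrix_(a, b) g [tuple a; b].

(* Raising all indices of [w] with [g]. *)
Definition raise (g : tensor 2) k (w : tensor k) : tensor k :=
  pullback (invmx (gram g)) w.

(* [( *w)_s = 1/k! w^t vol_{ts}], i.e. [z /\ *w = <z, w> vol]. *)
Definition hodge (g : tensor 2) k l (vol : tensor (k + l)) (w : tensor k) :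
    tensor l := fun s =>
  (k`!%:R)^-1 * \sum_(t : k.-tuple 'I_7) raise g w t * vol [tuple of t ++ s].

(** ** Octonions in a frame *)

Definition oct : Type := (R * 'rV[R]_7)%type.

Definition ip (g : tensor 2) (u v : 'rV[R]_7) : R :=
  \sum_a \sum_b g [tuple a; b] * u 0 a * v 0 b.

Definition oip (g : tensor 2) (A B : oct) : R := A.1 * B.1 + ip g A.2 B.2.

Definition cross (g : tensor 2) (phi : tensor 3) (u v : 'rV[R]_7) : 'rV[R]_7 :=
  \row_c \sum_a \sum_b \sum_d
    invmx (gram g) c d * phi [tuple a; b; d] * u 0 a * v 0 b.

Definition omul (g : tensor 2) (phi : tensor 3) (A B : oct) : oct :=
  (A.1 * B.1 - ip g A.2 B.2, A.1 *: B.2 + B.1 *: A.2 + cross g phi A.2 B.2).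

End Tensors.

Arguments tensor : clear implicits.
Arguments oct : clear implicits.
Arguments eform {R} s t.

(** * Fields on a 7-manifold *)

(* Fields are given by their components in every chart, in the coordinate frame
   of the chart, subject to the usual transformation laws; the components in the
   chart [i] are only meaningful at points of [chart_dom i]. *)

Section Fields.
Context {R : realType} (M : manifold R 7).
Notation I := (chart_index M).

Definition tfield k : Type := I -> M -> tensor R k.
Definition ofield : Type := I -> M -> oct R.
(* [OM]-valued 1-forms *)
Definition oform : Type := I -> M -> 'I_7 -> oct R.

Definition pd (i : I) (a : 'I_7) (f : M -> R) (p : M) : R :=
  'D_(delta_mx 0 a) (f \o chart_inv i) (chart i p).

(* [jac i j p a b] is the derivative at [p] of the [b]-th coordinate of the
   chart [j] along the [a]-th coordinate of the chart [i]. *)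
Definition jac (i j : I) (p : M) : 'M[R]_7 :=
  \matrix_(a, b) pd i a (fun q => chart j q 0 b) p.

Definition smooth_in (i : I) (f : M -> R) : Prop :=
  smooth_on (chart i @` chart_dom i) (f \o chart_inv i).

Definition tensor_field k (F : tfield k) : Prop :=
  (forall i s, smooth_in i (fun p => F i p s)) /\
  (forall i j p, chart_dom i p -> chart_dom j p -> F i p = pullback (jac i j p) (F j p)).

Definition oct_compatible (A : ofield) : Prop :=
  forall i j p, chart_dom i p -> chart_dom j p ->
    A j p = ((A i p).1, (A i p).2 *m jac i j p).

Definition oct_section (A : ofield) : Prop :=
  [/\ oct_compatible A,
      forall i, smooth_in i (fun p => (A i p).1) &
      forall i b, smooth_in i (fun p => (A i p).2 0 b)].

(* One-parameter families of octonion sections, smooth in (t, p) jointly. *)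
Definition oct_family (A : R -> ofield) : Prop :=
  [/\ forall t, oct_compatible (A t),
      forall i, smooth_on ([set: R] `*` (chart i @` chart_dom i))
        (fun tx : R * 'rV[R]_7 => (A tx.1 i (chart_inv i tx.2)).1) &
      forall i b, smooth_on ([set: R] `*` (chart i @` chart_dom i))
        (fun tx : R * 'rV[R]_7 => (A tx.1 i (chart_inv i tx.2)).2 0 b)].

(** ** G2-structures *)

Definition G2_structure (phi : tfield 3) : Prop :=
  tensor_field phi /\ forall i p, chart_dom i p -> positive3 (phi i p).

Definition riemannian_metric (g : tfield 2) : Prop :=
  tensor_field g /\ forall i p, chart_dom i p ->
    (gram (g i p))^T = gram (g i p) /\
    forall u : 'rV[R]_7, u != 0 -> 0 < ip (g i p) u u.

(* [vol] is one of the two unit volume forms of [g] at each point. *)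
Definition volume_form (g : tfield 2) (vol : tfield 7) : Prop :=
  tensor_field vol /\ forall i p, chart_dom i p ->
    (forall s, vol i p s =
       vol i p (ord_tuple 7) * eform [:: 1; 2; 3; 4; 5; 6; 7]%N s) /\
    vol i p (ord_tuple 7) ^+ 2 = \det (gram (g i p)).

(* The metric and the volume form determined by [phi]. *)
Definition G2_metric (phi : tfield 3) (g : tfield 2) (vol : tfield 7) : Prop :=
  [/\ riemannian_metric g, volume_form g vol &
      forall i p, chart_dom i p -> forall (a b : 'I_7) (s : 7.-tuple 'I_7),
        g i p [tuple a; b] * vol i p s =
        6%:R^-1 * wedge (wedge (contract a (phi i p)) (contract b (phi i p)))
                        (phi i p) s].

(** ** Levi-Civita connection and torsion *)

Definition christoffel (g : tfield 2) (i : I) (p : M) (c a b : 'I_7) : R :=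
  2%:R^-1 * \sum_d invmx (gram (g i p)) c d *
    (pd i a (fun q => g i q [tuple b; d]) p
     + pd i b (fun q => g i q [tuple a; d]) p
     - pd i d (fun q => g i q [tuple a; b]) p).

Definition nablaT (g : tfield 2) k (F : tfield k) (i : I) (p : M) (a : 'I_7) :
    tensor R k := fun s =>
  pd i a (fun q => F i q s) p
  - \sum_(l < k) \sum_c christoffel g i p c a (tnth s l) *
      F i p [tuple if m == l then c else tnth s m | m < k].

Definition torsion (phi : tfield 3) (g : tfield 2) (vol : tfield 7)
    (T : tfield 2) : Prop :=
  tensor_field T /\ forall i p, chart_dom i p -> forall a b c d : 'I_7,
    nablaT g phi i p a [tuple b; c; d] =
    2%:R * \sum_f \sum_h T i p [tuple a; h] * invmx (gram (g i p)) h f *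
      hodge (g i p) (k := 3) (l := 4) (vol i p) (phi i p) [tuple f; b; c; d].

(** ** The octonion covariant derivative *)

(* [T_X = (0, X _| T)] for [X] the [a]-th coordinate vector field. *)
Definition torsion_oct (g T : tfield 2) (i : I) (p : M) (a : 'I_7) : oct R :=
  (0, \row_b \sum_c T i p [tuple a; c] * invmx (gram (g i p)) c b).

Definition nablaO (g : tfield 2) (A : ofield) : oform := fun i p a =>
  (pd i a (fun q => (A i q).1) p,
   \row_b (pd i a (fun q => (A i q).2 0 b) p
           + \sum_c christoffel g i p b a c * (A i p).2 0 c)).

Definition octD (phi : tfield 3) (g T : tfield 2) (A : ofield) : oform :=
  fun i p a =>
    nablaO g A i p a - omul (g i p) (phi i p) (A i p) (torsion_oct g T i p a).

(* [(nabla_a B)_b - B_b T_a] for an [OM]-valued 1-form [B]. *)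
Definition octDform (phi : tfield 3) (g T : tfield 2) (B : oform)
    (i : I) (p : M) (a b : 'I_7) : oct R :=
  nablaO g (fun j q => B j q b) i p a
  - \sum_c christoffel g i p c a b *: B i p c
  - omul (g i p) (phi i p) (B i p b) (torsion_oct g T i p a).

Definition octDstar (phi : tfield 3) (g T : tfield 2) (B : oform) : ofield :=
  fun i p =>
    - \sum_a \sum_b invmx (gram (g i p)) a b *: octDform phi g T B i p a b.

Definition oform_normsq (g : tfield 2) (B : oform) (i : I) (p : M) : R :=
  \sum_a \sum_b invmx (gram (g i p)) a b * oip (g i p) (B i p a) (B i p b).

Definition unit_norm (g : tfield 2) (A : ofield) : Prop :=
  forall i p, chart_dom i p -> oip (g i p) (A i p) (A i p) = 1.

(* Sections of the unit octonion bundle, and one-parameter families of these. *)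
Definition unit_section (g : tfield 2) (A : ofield) : Prop :=
  oct_section A /\ unit_norm g A.

Definition unit_family (g : tfield 2) (A : R -> ofield) : Prop :=
  oct_family A /\ forall t, unit_norm g (A t).

(** ** Integration and the energy functional *)

Definition borel : Type := g_sigma_algebraType (@open M).
HB.instance Definition _ := Measurable.on borel.

End Fields.

(* Iterated Lebesgue integral over R^n. *)
Fixpoint rV_integral (R : realType) (n : nat) : ('rV[R]_n -> R) -> R :=
  match n with
  | 0 => fun f => f 0
  | m.+1 => fun f => \int[@lebesgue_measure R]_x
      rV_integral (fun y : 'rV[R]_m => f (row_mx (x%:M : 'rV[R]_1) y))
  end.

Section Energy.
Context {R : realType} (M : manifold R 7).

(* [mu] is the Borel measure of the volume form [vol], for the orientation
   defined by [vol]: in every chart it has density [|vol_{1...7}|]. It is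
   tested on continuous functions with compact support in the domain of a chart
   ([M] is compact in the theorem), which determines it uniquely. *)
Definition volume_measure (vol : tfield M 7)
    (mu : {measure set (borel M) -> \bar R}) : Prop :=
  forall (i : chart_index M) (f : M -> R), continuous f ->
    closure [set p | f p != 0] `<=` chart_dom i ->
    (\int[mu]_p (f p)%:E)%E =
    (rV_integral ((fun x : 'rV[R]_7 =>
       f (chart_inv i x) * `|vol i (chart_inv i x) (ord_tuple 7)|)
         \_ (chart i @` chart_dom i)))%:E.

Definition energy (phi : tfield M 3) (g T : tfield M 2)
    (mu : {measure set (borel M) -> \bar R}) (V : ofield M) : R :=
  2%:R^-1 * \int[mu]_p oform_normsq g (octD phi g T V) (chart_at p) p.

Definition critical_point (phi : tfield M 3) (g T : tfield M 2)
    (mu : {measure set (borel M) -> \bar R}) (V : ofield M) : Prop :=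
  unit_section g V /\
  forall A : R -> ofield M, unit_family g A ->
    (forall i p, chart_dom i p -> A 0 i p = V i p) ->
    is_derive (0 : R) (1 : R) (fun t => energy phi g T mu (A t)) 0.

End Energy.

(* Main.v *)
(* Let [W] be a section orthogonal to [V] with support in a chart. The curves
   [((1 - t^2 |W|^2/4) V + t W) / (1 + t^2 |W|^2/4)] are unit sections with velocity [W] at
   [t = 0], so criticality of [V] says that the integral of [<DV, DW>] vanishes. The derivative
   [D] is compatible with the octonion inner product, because right multiplication by an
   imaginary octonion is skew; hence [<DV, DW> - <D*DV, W>] is the divergence of a compactly
   supported vector field and the integral of [<D*DV, W>] vanishes as well. Differentiating
   [<V, V> = 1] twice gives [<D*DV, V> = |DV|^2], so that [Y = D*DV - |DV|^2 V] is the part of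
   [D*DV] orthogonal to [V]. If [Y] were nonzero at [p], a cutoff near [p] of the projection to
   the orthogonal of [V] of the constant field [Y p] would be a [W] for which
   [<D*DV, W> = <Y, W>] is nonnegative and positive at [p]. *)

From mathcomp Require Import all_boot all_order all_algebra all_fingroup.
From mathcomp Require Import all_classical all_reals all_analysis.
From mathcomp Require Import measurable_realfun ring lra.
Require Import Defs.

Set Implicit Arguments.
Unset Strict Implicit.
Unset Printing Implicit Defensive.

Import Order.TTheory GRing.Theory Num.Theory.
Import numFieldNormedType.Exports.

Local Open Scope classical_set_scope.
Local Open Scope ring_scope.

(** * Differential calculus *)

Section Calculus.
Context {R : realType}.

(** [volume_measure] pins [mu] down only on continuous functions supported in one chart, while the
    energy density is spread over all of [M]. Hence only the difference of two energies, whose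
    integrand vanishes off a coordinate ball [K], is moved to an iterated Lebesgue integral over
    R^7. Separating the two energies requires each density to be integrable; compactness gives this,
    through boundedness of the density and finiteness of [mu]. The density is read in the chart
    [chart_at p], which may jump with [p], so the invariance of |DA|^2 under change of charts, and
    with it the transformation law of the Christoffel symbols, belongs to the argument.
    [volume_measure] contains the absolute value of the density, whereas the divergence identity
    concerns the signed component of [vol]; a constant sign [eps] on a small ball reconciles them.
    On R^7, integration by parts follows the recursion of [rV_integral] and ends in the one-variable
    fundamental theorem of calculus. Since [smooth_on] speaks of directional derivatives, the chain
    rule and the symmetry of mixed derivatives come from the mean value theorem. *)

Lemma is_derive_line (E : normedModType R) (f : E -> R) (x v : E) (h0 : R) :
  derivable f (h0 *: v + x) v ->
  is_derive h0 1 (fun h : R => f (h *: v + x)) ('D_v f (h0 *: v + x)).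
Proof.
move=> df.
have E1 : (fun h : R => h^-1 *: (((fun h : R => f (h *: v + x)) \o shift h0) (h *: (1:R)) - f (h0 *: v + x)))
   = (fun h : R => h^-1 *: ((f \o shift (h0 *: v + x)) (h *: v) - f (h0 *: v + x))).
  apply/funext => h /=; congr (_ *: (f _ - _)).
  by rewrite scalerDl addrA [h *: 1]mulr1.
apply: DeriveDef; first by rewrite /derivable E1.
by rewrite /derive E1.
Qed.

(** Bridge by which one-variable rules, such as composition with [bumpE k], apply to directional
    derivatives on a normed space. *)
Lemma is_derive_lineP (E : normedModType R) (g : E -> R) (x v : E) (d : R) :
  is_derive x v g d <-> is_derive (0 : R) 1 (fun h : R => g (h *: v + x)) d.
Proof.
split=> [[dg <-]|[d0 <-]].
  by have := @is_derive_line E g x v 0; rewrite scale0r add0r => /(_ dg).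
have Q : (fun h : R => h^-1 *: (((fun h : R => g (h *: v + x)) \o shift 0) (h *: (1:R)) - g (0 *: v + x)))
   = (fun h : R => h^-1 *: ((g \o shift x) (h *: v) - g x)).
  by apply/funext => h /=; rewrite scale0r add0r addr0 [h *: 1]mulr1.
by apply: DeriveDef; rewrite /derivable /derive -Q.
Qed.

(** Writing the intermediate parameter as [r * s] with [r] in [0, 1] keeps the point on the segment
    whatever the sign of [s], the case [s = 0] included. *)
Lemma MVT_dir (E : normedModType R) (f : E -> R) (x v : E) (s : R) :
  (forall r : R, 0 <= r <= 1 -> derivable f ((r * s) *: v + x) v) ->
  exists r : R, 0 <= r <= 1 /\
    f (s *: v + x) - f x = s * 'D_v f ((r * s) *: v + x).
Proof.
move=> df.
have D (h : R) : s != 0 -> 0 <= h / s <= 1 ->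
    is_derive h 1 (fun h : R => f (h *: v + x)) ('D_v f (h *: v + x)).
  move=> s0 hs; apply: is_derive_line.
  by rewrite -[h](divfK s0); apply: df.
have [s0|s0|->] := ltgtP s 0; last first.
- by exists 0; rewrite lexx ler01 scale0r add0r subrr mul0r.
- have in01 c : 0 <= c <= s -> 0 <= c / s <= 1.
    move=> /andP[c0 cs].
    by rewrite divr_ge0 ?(ltW s0) // ler_pdivrMr // mul1r.
  have sn0 : s != 0 by rewrite gt_eqF.
  have [] := @MVT R (fun h : R => f (h *: v + x)) (fun h => 'D_v f (h *: v + x)) 0 s s0.
  + move=> y; rewrite in_itv /= => /andP[y0 ys]; apply: D => //.
    by apply: in01; rewrite !ltW.
  + apply: derivable_within_continuous => y; rewrite in_itv /= => ys.
    by have [] := D y sn0 (in01 _ ys).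
  move=> c; rewrite in_itv /= => /andP[c0 cs]; rewrite scale0r add0r subr0 => ->.
  exists (c / s); split; first by apply: in01; rewrite !ltW.
  by rewrite divfK // mulrC.
- have in01 c : s <= c <= 0 -> 0 <= c / s <= 1.
    move=> /andP[sc c0].
    by rewrite -mulrNN -invrN divr_ge0 ?ler_pdivrMr ?oppr_ge0 ?oppr_gt0 ?(ltW s0) // mul1r lerN2.
  have sn0 : s != 0 by rewrite lt_eqF.
  have [] := @MVT R (fun h : R => f (h *: v + x)) (fun h => 'D_v f (h *: v + x)) s 0 s0.
  + move=> y; rewrite in_itv /= => /andP[ys y0]; apply: D => //.
    by apply: in01; rewrite !ltW.
  + apply: derivable_within_continuous => y; rewrite in_itv /= => ys.
    by have [] := D y sn0 (in01 _ ys).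
  move=> c; rewrite in_itv /= => /andP[sc c0]; rewrite scale0r add0r sub0r => fE.
  exists (c / s); split; first by apply: in01; rewrite !ltW.
  by rewrite divfK // -opprB fE mulrN opprK mulrC.
Qed.

Lemma cvg_rowP n (T : Type) (F : set_system T) (FF : Filter F) (c : T -> 'rV[R]_n) (l : 'rV[R]_n) :
  (forall k, c h 0 k @[h --> F] --> l 0 k) -> c h @[h --> F] --> l.
Proof.
move=> cl; apply/cvgrPdist_le => /= e e0; near=> t.
rewrite /Num.Def.normr/= mx_normrE (bigmax_le _ (ltW e0))//= => -[i j] _.
rewrite /= !mxE ord1 /=; clear i; move: j; near: t; apply: filter_forall => j.
exact: ((cvgrPdist_le _ _).1 (cl j)).
Unshelve. all: by end_near. Qed.

Lemma coord_le_norm n (x : 'rV[R]_n) k : `|x 0 k| <= `|x|.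
Proof.
rewrite [leRHS]/Num.Def.normr/= mx_normrE.
by have /= := @le_bigmax _ _ _ 0 (fun i : 'I_1 * 'I_n => `|x i.1 i.2|) (0, k).
Qed.

Lemma norm_row_le n (x : 'rV[R]_n) e : 0 <= e -> (forall k, `|x 0 k| <= e) -> `|x| <= e.
Proof.
move=> e0 xe; rewrite [leLHS]/Num.Def.normr/= mx_normrE.
by rewrite bigmax_le //= => -[i j] _; rewrite ord1.
Qed.

Lemma is_derive1_cvg (f : R -> R) (x d : R) : is_derive x 1 f d ->
  h^-1 * (f (h + x) - f x) @[h --> 0^'] --> d.
Proof.
move=> [df <-]; rewrite /derive.
have -> : (fun h : R => h^-1 * (f (h + x) - f x)) = (fun h : R => h^-1 *: ((f \o shift x) (h *: 1) - f x)).
  by apply/funext => h /=; rewrite [h *: 1]mulr1.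
exact: df.
Qed.

Lemma cvg_is_derive1 (f : R -> R) (x d : R) :
  h^-1 * (f (h + x) - f x) @[h --> 0^'] --> d -> is_derive x 1 f d.
Proof.
have E : (fun h : R => h^-1 * (f (h + x) - f x)) = (fun h : R => h^-1 *: ((f \o shift x) (h *: 1) - f x)).
  by apply/funext => h /=; rewrite [h *: 1]mulr1.
rewrite E => cd; apply: DeriveDef; first by apply/cvg_ex; exists d.
exact/cvg_lim.
Qed.

Lemma is_derive1_continuous (f : R -> R) (x d : R) : is_derive x 1 f d ->
  {for x, continuous f}.
Proof. by move=> [df _]; exact/differentiable_continuous/derivable1_diffP. Qed.

(* The increment of [f] along [c] is telescoped over the coordinates, so that only partial
   derivatives, and no Frechet derivative, of [f] are involved. *)
Lemma chain_rule n (f : 'rV[R]_n -> R) (c : R -> 'rV[R]_n) (d : 'rV[R]_n) :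
  (\forall y \near c 0, forall k : 'I_n, derivable f y (delta_mx 0 k)) ->
  (forall k : 'I_n, {for c 0, continuous ('D_(delta_mx 0 k) f)}) ->
  (forall k, is_derive (0:R) 1 (fun h => c h 0 k) (d 0 k)) ->
  is_derive (0 : R) 1 (f \o c) (\sum_k d 0 k * 'D_(delta_mx 0 k) f (c 0)).
Proof.
move=> df cDf cd; apply: cvg_is_derive1 => /=.
(* [P k h] agrees with [c h] in the first [k] coordinates and with [c 0] in the others, so
   consecutive points differ along a single basis vector. *)
pose P (k : nat) (h : R) : 'rV[R]_n := \row_j (if (j < k)%N then c h 0 j else c 0 0 j).
have PS (k : 'I_n) h : P k.+1 h = (c h 0 k - c 0 0 k) *: delta_mx 0 k + P k h.
  apply/rowP => j; rewrite !mxE eqxx /= ltnS leq_eqVlt.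
  have [->|jk] := eqVneq j k; first by rewrite eqxx ltnn /= mulr1 subrK.
  by rewrite val_eqE (negbTE jk) /= mulr0 add0r.
have c0c : c h @[h --> (0 : R)] --> c 0.
  by apply: cvg_rowP => k; exact: is_derive1_continuous (cd k).
have [e e0 be] : exists2 e : R, 0 < e & forall y, `|c 0 - y| <= e -> forall k : 'I_n, derivable f y (delta_mx 0 k).
  have [e e0 be] := (nbhs_ballP _ _).1 df.
  exists (e / 2); first by rewrite divr_gt0.
  move=> y ye; apply: be; rewrite -ball_normE /=.
  by apply: le_lt_trans ye _; rewrite ltr_pdivrMr // ltr_pMr // ltr1n.
have near1 (h : R) (r : R) (k : 'I_n) : 0 <= r <= 1 ->
    `|c 0 - ((r * (c h 0 k - c 0 0 k)) *: delta_mx 0 k + P k h)| <= `|c 0 - c h|.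
  move=> /andP[r0 r1]; apply: norm_row_le => // j.
  have hj := coord_le_norm (c 0 - c h) j; rewrite !mxE in hj.
  rewrite !mxE eqxx /=; have [->|jk] := eqVneq j k.
    rewrite ltnn /= mulr1 opprD addrCA subrr addr0 normrN normrM ger0_norm //.
    rewrite distrC in hj; have hk := coord_le_norm (c 0 - c h) k; rewrite !mxE distrC in hk.
    by apply: le_trans hk; apply: ler_piMl.
  rewrite mulr0 add0r; case: ifP => // _.
  by rewrite subrr normr0.
(* The mean value point must become a function of [h] before a limit can be taken. The bound on
   [c h] is a premise, so that the default value 0 serves where [c h] is far from [c 0]. *)
have ex (k : 'I_n) (h : R) : exists xi, `|c 0 - c h| <= e ->
    `|c 0 - xi| <= `|c 0 - c h| /\ f (P k.+1 h) - f (P k h) = (c h 0 k - c 0 0 k) * 'D_(delta_mx 0 k) f xi.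
  have [che|] := pselect (`|c 0 - c h| <= e); last by exists 0.
  have [|r [r01]] := @MVT_dir _ f (P k h) (delta_mx 0 k) (c h 0 k - c 0 0 k).
    move=> r r01; apply: be; apply: le_trans che; exact: near1.
  rewrite -PS => fE; exists ((r * (c h 0 k - c 0 0 k)) *: delta_mx 0 k + P k h) => _.
  by split=> //; apply: near1.
pose xi k := projT1 (choice (ex k)).
have xiP k h : `|c 0 - c h| <= e ->
    `|c 0 - xi k h| <= `|c 0 - c h| /\ f (P k.+1 h) - f (P k h) = (c h 0 k - c 0 0 k) * 'D_(delta_mx 0 k) f (xi k h).
  exact: (projT2 (choice (ex k))).
have cnear e' : 0 < e' -> \forall h \near (0:R), `|c 0 - c h| <= e'.
  by move=> e'0; move/cvgrPdist_le : c0c; exact.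
have xic k : xi k h @[h --> (0:R)] --> c 0.
  apply/cvgrPdist_le => /= e' e'0.
  near=> h.
  have ch : `|c 0 - c h| <= e by near: h; exact: cnear.
  have [h1 _] := xiP k h ch; apply: le_trans h1 _.
  by near: h; exact: cnear.
have P0 h : P 0 h = c 0 by apply/rowP => j; rewrite !mxE.
have Pn h : P n h = c h by apply/rowP => j; rewrite !mxE ltn_ord.
have cvg1 : \sum_(k < n) (h^-1 * (c h 0 k - c 0 0 k) * 'D_(delta_mx 0 k) f (xi k h)) @[h --> 0^'] -->
   \sum_k d 0 k * 'D_(delta_mx 0 k) f (c 0).
  apply: (cvg_big add_continuous) => k _; apply: cvgM.
    by have := is_derive1_cvg (cd k); under eq_fun do rewrite addr0.
  have xic' : xi k h @[h --> 0^'] --> c 0.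
    by apply: cvg_trans (xic k); apply: cvg_app; exact: cvg_within.
  have := @cvg_comp _ _ _ (xi k) ('D_(delta_mx 0 k) f) _ _ _ xic' (cDf k). exact.
apply: cvg_trans cvg1; apply: near_eq_cvg.
apply: cvg_within; near=> h.
have ch : `|c 0 - c h| <= e by near: h; exact: cnear.
rewrite addr0 -(Pn h) -[in RHS](P0 h).
have -> : f (P n h) - f (P 0 h) = \sum_(k < n) (f (P k.+1 h) - f (P k h)).
  by rewrite -(big_mkord xpredT (fun k => f (P k.+1 h) - f (P k h))) telescope_sumr.
rewrite mulr_sumr; apply: eq_bigr => k _.
by have [_ ->] := xiP k h ch; rewrite mulrA Pn.
Unshelve. all: by end_near. Qed.

Lemma smooth_on_derivable (E : normedModType R) (U : set E) (f : E -> R) x v :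
  smooth_on U f -> U x -> derivable f x v.
Proof. by move=> sf Ux; have [_] := sf [::] x Ux; apply. Qed.

Global Arguments smooth_on_derivable {E U f x} v _ _.

Lemma smooth_on_continuous (E : normedModType R) (U : set E) (f : E -> R) x :
  smooth_on U f -> U x -> {for x, continuous f}.
Proof. by move=> sf Ux; have [] := sf [::] x Ux. Qed.

Global Arguments smooth_on_continuous {E U f x} _ _.

Lemma iterD_rcons (E : normedModType R) (f : E -> R) s v :
  iterD (rcons s v) f = iterD s ('D_v f).
Proof. by elim: s => //= w s ->. Qed.

Lemma smooth_onD (E : normedModType R) (U : set E) (f : E -> R) v :
  smooth_on U f -> smooth_on U ('D_v f).
Proof. by move=> sf s x Ux; rewrite -iterD_rcons; apply: sf. Qed.

Global Arguments smooth_onD {E U f} v _.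

Lemma is_derive_translate (E : normedModType R) (f : E -> R) (b y a : E) d :
  is_derive (b + y) a f d -> is_derive y a (fun z => f (b + z)) d.
Proof.
have EE : (fun k : R => k^-1 *: (((fun z => f (b + z)) \o shift y) (k *: a) - f (b + y))) =
    (fun k : R => k^-1 *: ((f \o shift (b + y)) (k *: a) - f (b + y))).
  by apply/funext => k /=; rewrite addrCA.
move=> [df <-]; apply: DeriveDef; first by rewrite /derivable EE.
by rewrite /derive EE.
Qed.

(** The second difference of [f] over the parallelogram with sides [h *: v] and [h *: w] is
    symmetric in [v] and [w]. Two mean value steps, taken in either order, equate it to [h ^+ 2]
    times each mixed derivative at a point within |h| (|v| + |w|) of [x]. Dividing by [h ^+ 2] and
    letting [h] tend to 0 concludes, by continuity of both mixed derivatives. *)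
Lemma schwarz (E : normedModType R) (U : set E) (f : E -> R) (x v w : E) :
  open U -> smooth_on U f -> U x -> 'D_v ('D_w f) x = 'D_w ('D_v f) x.
Proof.
move=> oU sf Ux.
have [e e0 be] : exists2 e : R, 0 < e & forall y, `|x - y| <= e -> U y.
  have [e e0 be] := (nbhs_ballP _ _).1 (open_nbhs_nbhs (conj oU Ux)).
  exists (e / 2); first by rewrite divr_gt0.
  move=> y ye; apply: be; rewrite -ball_normE /=.
  by apply: le_lt_trans ye _; rewrite ltr_pdivrMr // ltr_pMr // ltr1n.
have nr (a b : E) (r s h : R) : 0 <= r <= 1 -> 0 <= s <= 1 ->
    `|x - ((r * h) *: a + ((s * h) *: b + x))| <= `|h| * (`|a| + `|b|).
  move=> /andP[r0 r1] /andP[s0 s1].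
  have -> : x - ((r * h) *: a + ((s * h) *: b + x)) = - ((r * h) *: a + (s * h) *: b).
    by rewrite addrA opprD addrCA subrr addr0.
  rewrite normrN; apply: le_trans (ler_normD _ _) _.
  rewrite -!scalerA !normrZ (ger0_norm r0) (ger0_norm s0) mulrDr lerD //.
    by rewrite ler_piMl // mulr_ge0.
  by rewrite ler_piMl // mulr_ge0.
have rearrange (A B C D : R) : A - B - C + D = A - B - (C - D).
  by rewrite opprB addrA addrAC.
have key (a b : E) h : `|h| * (`|a| + `|b|) <= e -> exists xi, `|x - xi| <= `|h| * (`|a| + `|b|) /\
    f (h *: a + (h *: b + x)) - f (h *: a + x) - f (h *: b + x) + f x = h ^+ 2 * 'D_b ('D_a f) xi.
  move=> he.
  pose phi y := f (h *: b + y) - f y.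
  have dphi y : U y -> U (h *: b + y) -> is_derive y a phi ('D_a f (h *: b + y) - 'D_a f y).
    move=> Uy Uhy; apply: is_deriveB; last first.
      by apply: DeriveDef => //; exact: smooth_on_derivable a sf Uy.
    have d : derivable f (h *: b + y) a := smooth_on_derivable a sf Uhy.
    by apply: is_derive_translate; apply: DeriveDef.
  have U1 r : 0 <= r <= 1 -> U ((r * h) *: a + x).
    move=> r01; apply: be; apply: le_trans he.
    have := nr a b r 0 h r01; rewrite lexx ler01 => /(_ isT).
    by rewrite mul0r scale0r add0r.
  have U2 r s : 0 <= r <= 1 -> 0 <= s <= 1 -> U ((s * h) *: b + ((r * h) *: a + x)).
    move=> r01 s01; apply: be; apply: le_trans he.
    by rewrite addrCA; apply: nr.
  have i11 : 0 <= (1:R) <= 1 by rewrite ler01 lexx.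
  have [|r [r01]] := @MVT_dir _ phi x a h.
    by move=> r r01; have [] := dphi _ (U1 r r01); rewrite ?mul1r; have := U2 r 1 r01 i11; rewrite mul1r.
  have [|_ ->] := dphi _ (U1 r r01); first by have := U2 r 1 r01 i11; rewrite mul1r.
  have [|s [s01]] := @MVT_dir _ ('D_a f) ((r * h) *: a + x) b h.
    by move=> s s01; exact: (smooth_on_derivable b (smooth_onD a sf) (U2 r s r01 s01)).
  move=> -> phiE; exists ((s * h) *: b + ((r * h) *: a + x)); split.
    by rewrite addrCA; apply: nr.
  rewrite expr2 -mulrA -phiE /phi [h *: a + (h *: b + x)]addrCA; exact: rearrange.
have ex h : exists q : E * E, `|h| * (`|v| + `|w|) <= e ->
    [/\ `|x - q.1| <= `|h| * (`|v| + `|w|), `|x - q.2| <= `|h| * (`|v| + `|w|) &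
     h ^+ 2 * 'D_v ('D_w f) q.1 = h ^+ 2 * 'D_w ('D_v f) q.2].
  have [he|] := pselect (`|h| * (`|v| + `|w|) <= e); last by exists (x, x).
  have [q2 [h2 E2]] := key v w h he.
  rewrite addrC in he h2; have [q1 [h1 E1]] := key w v h he.
  rewrite [`|v| + _]addrC.
  exists (q1, q2) => _; split; [exact: h1|exact: h2|].
  cbn [fst snd].
  transitivity (f (h *: w + (h *: v + x)) - f (h *: w + x) - f (h *: v + x) + f x); first exact: (esym E1).
  transitivity (f (h *: v + (h *: w + x)) - f (h *: v + x) - f (h *: w + x) + f x); last exact: E2.
  rewrite [h *: w + (h *: v + x)]addrCA.
  by rewrite [X in X + f x]addrAC.
pose q h := projT1 (choice ex) h; have qP := projT2 (choice ex).
have hn e' : 0 < e' -> \forall h \near (0:R), `|h| * (`|v| + `|w|) <= e'.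
  move=> e'0.
  have : `|h| * (`|v| + `|w|) @[h --> (0:R)] --> `|0 : R| * (`|v| + `|w|).
    by apply: cvgM; [apply: cvg_norm; exact: cvg_id|exact: cvg_cst].
  rewrite normr0 mul0r => /cvgrPdist_le /(_ _ e'0); apply: filterS => h.
  by rewrite sub0r normrN ger0_norm // mulr_ge0 // addr_ge0.
have q1c : (q h).1 @[h --> 0^'] --> x.
  apply: cvg_within_filter; apply/cvgrPdist_le => e' e'0; near=> h.
  have [|h1 _ _] := qP h; first by near: h; exact: hn.
  by apply: le_trans h1 _; near: h; exact: hn.
have q2c : (q h).2 @[h --> 0^'] --> x.
  apply: cvg_within_filter; apply/cvgrPdist_le => e' e'0; near=> h.
  have [|_ h1 _] := qP h; first by near: h; exact: hn.
  by apply: le_trans h1 _; near: h; exact: hn.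
have c1 := @cvg_comp _ _ _ _ ('D_v ('D_w f)) _ _ _ q1c (smooth_on_continuous (smooth_onD v (smooth_onD w sf)) Ux).
have c2 := @cvg_comp _ _ _ _ ('D_w ('D_v f)) _ _ _ q2c (smooth_on_continuous (smooth_onD w (smooth_onD v sf)) Ux).
apply: (cvg_unique _ c1); first exact: norm_hausdorff.
apply: cvg_trans c2; apply: near_eq_cvg; near=> h => /=.
have hn0 : h ^+ 2 != 0 by rewrite expf_neq0 //; near: h; exact: nbhs_dnbhs_neq.
have [|_ _ qE] := qP h.
  by near: h; apply: cvg_within; exact: hn.
exact: (mulfI hn0 (esym qE)).
Unshelve. all: by end_near. Qed.
End Calculus.

(** * Smooth functions as an inductively generated class *)

Section SmoothClass.
Context {R : realType}.

(* The derivatives of [exp (-1/s)] are combinations of the [s^-k exp (-1/s)]. *)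
Definition bumpE (k : nat) (s : R) : R := if 0 < s then s ^- k * expR (- s^-1) else 0.

(** The inequality u <= exp u at u = 1 / ((k+2) s), raised to the power k+2, bounds exp (1/s) from
    below by ((k+2) s)^-(k+2). The exponent k+2 leaves a factor s^2 after division by s^k, which
    makes the difference quotient at 0 tend to 0. *)
Lemma bumpE_le k (s : R) : 0 < s -> bumpE k s <= (k.+2%:R ^+ k.+2) * s ^+ 2.
Proof.
move=> s0; rewrite /bumpE s0.
have n0 : 0 < k.+2%:R :> R by rewrite ltr0n.
have e1 : (k.+2%:R * s)^-1 <= expR (k.+2%:R * s)^-1.
  by apply: le_trans (expR_ge1Dx _); rewrite lerDr.
have e2 : (k.+2%:R * s) ^- k.+2 <= expR s^-1.
  rewrite -exprVn (le_trans (lerXn2r k.+2 _ _ e1)) //; rewrite ?nnegrE ?expR_ge0 //.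
    by rewrite invr_ge0 mulr_ge0 // ltW.
  by rewrite -expRM_natl invfM mulrA divff ?gt_eqF // mul1r.
have kn : 0 < (k.+2%:R * s) ^+ k.+2 by rewrite exprn_gt0 // mulr_gt0.
have h : 1 <= (k.+2%:R * s) ^+ k.+2 * expR s^-1.
  by rewrite -ler_pdivrMl // mulr1.
rewrite expRN ler_pdivrMr ?expR_gt0 //.
have -> : k.+2%:R ^+ k.+2 * s ^+ 2 * expR s^-1 =
    (k.+2%:R * s) ^+ k.+2 * expR s^-1 * s ^- k.
  rewrite exprMn [s ^+ k.+2](exprD s 2 k).
  have sk0 : s ^+ k != 0 by rewrite expf_neq0 // gt_eqF.
  by move: sk0; set a := s ^+ k; set b := _ ^+ k.+2; set E := expR _ => a0; field.
by rewrite -[leLHS]mul1r ler_wpM2r // invr_ge0 exprn_ge0 // ltW.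
Qed.

(** The family [bumpE] is stable under differentiation up to linear combinations, which is what the
    constructor [sm_bump] relies on. Only the point 0 needs an estimate: by [bumpE_le] the quotient
    there is at most a constant times [h]. *)
Lemma is_derive_bumpE k (s : R) :
  is_derive s 1 (bumpE k) (- k%:R * bumpE k.+1 s + bumpE k.+2 s).
Proof.
have [s0|s0|->] := ltgtP s 0.
- have -> : - k%:R * bumpE k.+1 s + bumpE k.+2 s = 0.
    by rewrite /bumpE ltNge (ltW s0) /= mulr0 addr0.
  apply: (@near_eq_is_derive _ _ _ (cst 0)).
  near=> t; rewrite /bumpE /=; case: ifP => // t0.
  have : t < 0 by near: t; exact: lt_nbhsl.
  by rewrite ltNge (ltW t0).
- apply: (@near_eq_is_derive _ _ _ (fun t : R => (t ^+ k)^-1 * expR (- t^-1))).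
    near=> t; rewrite /bumpE.
    have -> // : 0 < t by near: t; exact: lt_nbhsr.
  have sn0 : s != 0 by rewrite gt_eqF.
  have skn0 : s ^+ k != 0 by rewrite expf_neq0.
  have dV := @is_deriveV _ (fun t : R => t) s 1 1 sn0 (is_derive_id s 1).
  have dX : is_derive s 1 (fun t : R => t ^+ k) (k%:R * s ^+ k.-1).
    by have := @is_deriveX _ _ (fun t : R => t) k s 1 1 (is_derive_id s 1); rewrite exprfctE [_%:A]mulr1.
  have dXV := @is_deriveV _ (fun t : R => t ^+ k) s _ 1 skn0 dX.
  have dE := @is_derive1_comp _ expR (fun t : R => - t^-1) s _ _ (is_derive_expR _) (is_deriveN dV).
  have := @is_deriveM _ _ (fun t : R => (t ^+ k)^-1) (expR \o (fun t => - t^-1)) s 1 _ _ dXV dE.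
  move=> dM; apply: (is_derive_eq dM).
  rewrite /bumpE s0 /= /GRing.scale /=.
  case: k skn0 dX dXV dM => [|k] skn0 dX dXV dM.
    by field.
  rewrite /= !exprS; field; rewrite sn0 /=.
  by move: skn0; rewrite exprS mulf_eq0 negb_or => /andP[_ ->].
- have -> : - k%:R * bumpE k.+1 0 + bumpE k.+2 0 = 0 :> R.
    by rewrite /bumpE ltxx mulr0 addr0.
  apply: cvg_is_derive1.
  have -> : bumpE k 0 = 0 by rewrite /bumpE ltxx.
  pose C : R := k.+2%:R ^+ k.+2.
  have C0 : 0 < C by rewrite exprn_gt0 // ltr0n.
  apply/cvgrPdist_le => e e0; near=> h.
  rewrite sub0r normrN addr0 subr0 /bumpE; case: ifPn => h0; last by rewrite mulr0 normr0 ltW.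
  have := bumpE_le k h0; rewrite /bumpE h0 => hb.
  rewrite normrM (ger0_norm (_ : 0 <= h^-1)) ?invr_ge0 ?(ltW h0) //.
  rewrite ger0_norm ?mulr_ge0 ?expR_ge0 ?invr_ge0 ?exprn_ge0 ?(ltW h0) //.
  rewrite mulrC ler_pdivrMr // (le_trans hb) // expr2 mulrA ler_wpM2r ?(ltW h0) //.
  rewrite -ler_pdivlMl // mulrC.
  have : `|h| < e / C by near: h; apply: dnbhs0_lt; rewrite divr_gt0.
  by move=> /ltW; rewrite ger0_norm // ltW.
Unshelve. all: by end_near. Qed.

(* A class of functions which is closed under differentiation by construction, so that
   smoothness is obtained by one induction on the way a function is built. *)
Inductive sm (E : normedModType R) (U : set E) : (E -> R) -> Prop :=
| sm_base f : smooth_on U f -> sm U f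
| sm_eq f g : sm U f -> (forall x, U x -> f x = g x) -> sm U g
| sm_lin f (df : E -> R) : continuous f -> (forall x v, is_derive x v f (df v)) -> sm U f
| sm_add f g : sm U f -> sm U g -> sm U (fun x => f x + g x)
| sm_mul f g : sm U f -> sm U g -> sm U (fun x => f x * g x)
| sm_inv f : sm U f -> (forall x, U x -> f x != 0) -> sm U (fun x => (f x)^-1)
| sm_bump k f : sm U f -> sm U (fun x => bumpE k (f x))
| sm_comp n (f : 'rV[R]_n -> R) V (tau : E -> 'rV[R]_n) :
    open V -> smooth_on V f -> (forall k, sm U (fun x => tau x 0 k)) ->
    (forall x, U x -> V (tau x)) -> sm U (fun x => f (tau x)).

Section SmTheory.
Context {E : normedModType R} (U : set E).
Hypothesis oU : open U.

Lemma sm_cst (c : R) : sm U (fun _ => c).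
Proof.
by apply: (@sm_lin _ _ _ (fun _ => 0)); exact: cst_continuous.
Qed.

Lemma nearU x : U x -> \near x, U x.
Proof. by move=> Ux; exact: open_nbhs_nbhs. Qed.

(** Continuity, derivability and membership of the derivatives in the class are proved in one
    induction, because the product, inverse and composition cases use the first two for the third.
    The third conclusion is what [sm_smooth_on] iterates. *)
Lemma sm_derive f : sm U f ->
  (forall x, U x -> {for x, continuous f}) /\
  (forall x v, U x -> derivable f x v) /\ (forall v, sm U ('D_v f)).
Proof.
elim=> {f}.
- move=> f sf; split; first by move=> x Ux; exact: (smooth_on_continuous sf Ux).
  split=> [x v Ux|v]; first exact: (smooth_on_derivable v sf Ux).
  exact/sm_base/smooth_onD.
- move=> f g sf [cf [df Df]] fg.
  have nfg x : U x -> \near x, f x = g x.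
    by move=> Ux; apply: filterS (nearU Ux) => y; exact: fg.
  split=> [x Ux|].
    rewrite /prop_for /continuous_at -fg //.
    by apply: cvg_trans (cf x Ux); apply: near_eq_cvg; apply: filterS (nfg x Ux) => y ->.
  split=> [x v Ux|v]; first exact: near_eq_derivable (nfg x Ux) (df x v Ux).
  apply: (sm_eq (Df v)) => x Ux; exact: near_eq_derive (nfg x Ux).
- move=> f df cf dfE; split=> [x _|]; first exact: cf.
  split=> [x v _|v]; first by have [] := dfE x v.
  by apply: (sm_eq (sm_cst (df v))) => x _; have [_ ->] := dfE x v.
- move=> f g sf [cf [df Df]] sg [cg [dg Dg]].
  split=> [x Ux|]; first by apply: cvgD; [exact: cf|exact: cg].
  split=> [x v Ux|v]; first by apply: derivableD; [exact: df|exact: dg].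
  apply: (sm_eq (sm_add (Df v) (Dg v))) => x Ux.
  exact: esym (deriveD (df x v Ux) (dg x v Ux)).
- move=> f g sf [cf [df Df]] sg [cg [dg Dg]].
  split=> [x Ux|]; first by apply: cvgM; [exact: cf|exact: cg].
  split=> [x v Ux|v]; first by apply: derivableM; [exact: df|exact: dg].
  apply: (sm_eq (sm_add (sm_mul sf (Dg v)) (sm_mul sg (Df v)))) => x Ux.
  exact: esym (deriveM (df x v Ux) (dg x v Ux)).
- move=> f sf [cf [df Df]] f0.
  split=> [x Ux|]; first by apply: cvgV; [exact: f0|exact: cf].
  split=> [x v Ux|v]; first by apply: derivableV; [exact: f0|exact: df].
  have i := sm_inv sf f0.
  apply: (sm_eq (sm_mul (sm_mul (sm_cst (-1)) (sm_mul i i)) (Df v))) => x Ux.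
  by rewrite (deriveV (f0 x Ux) (df x v Ux)) mulN1r -invfM -expr2.
- move=> k f sf [cf [df Df]].
  have dB x v : U x -> is_derive x v (fun x => bumpE k (f x)) ((- k%:R * bumpE k.+1 (f x) + bumpE k.+2 (f x)) * 'D_v f x).
    move=> Ux; apply/is_derive_lineP.
    apply: (@is_derive1_comp _ (bumpE k) (fun h : R => f (h *: v + x))).
      by rewrite scale0r add0r; exact: is_derive_bumpE.
    by apply/(is_derive_lineP f); exact: (DeriveDef (df x v Ux) erefl).
  split=> [x Ux|].
    apply: (@cvg_comp _ _ _ f (bumpE k) _ _ _ (cf x Ux)).
    exact: is_derive1_continuous (is_derive_bumpE _ _).
  split=> [x v Ux|v]; first by have [] := dB x v Ux.
  apply: (sm_eq (sm_mul (sm_add (sm_mul (sm_cst (- k%:R)) (sm_bump k.+1 sf)) (sm_bump k.+2 sf)) (Df v))) => x Ux.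
  by have [_ ->] := dB x v Ux.
- move=> n f V tau oV sf stau ih UV.
  have dB x v : U x -> is_derive x v (fun x => f (tau x)) (\sum_k 'D_v (fun x => tau x 0 k) x * 'D_(delta_mx 0 k) f (tau x)).
    move=> Ux; apply/is_derive_lineP.
    have := @chain_rule R n f (fun h : R => tau (h *: v + x)) (\row_k 'D_v (fun x => tau x 0 k) x).
    rewrite scale0r add0r.
    under [X in _ -> _ -> _ -> is_derive _ _ _ X]eq_bigr do rewrite mxE.
    apply.
    + have : \forall y \near tau x, V y by apply: open_nbhs_nbhs; split => //; exact: UV.
      by apply: filterS => y Vy k; exact: (smooth_on_derivable _ sf Vy).
    + move=> k; exact: (smooth_on_continuous (smooth_onD _ sf) (UV x Ux)).
    + move=> k; rewrite mxE; apply/(is_derive_lineP (fun x => tau x 0 k)).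
      by have [_ [d _]] := ih k; exact: (DeriveDef (d x v Ux) erefl).
  split=> [x Ux|].
    have ctau : tau y @[y --> x] --> tau x.
      by apply: cvg_rowP => k; have [c _] := ih k; exact: c.
    exact: (@cvg_comp _ _ _ tau f _ _ _ ctau (smooth_on_continuous sf (UV x Ux))).
  split=> [x v Ux|v]; first by have [] := dB x v Ux.
  apply: (@sm_eq _ _ (fun x => \sum_k 'D_v (fun x => tau x 0 k) x * 'D_(delta_mx 0 k) f (tau x))); last first.
    by move=> x Ux; have [_ ->] := dB x v Ux.
  have : forall s : seq 'I_n, sm U (fun x => \sum_(k <- s) 'D_v (fun x => tau x 0 k) x * 'D_(delta_mx 0 k) f (tau x)).
    elim=> [|k s ihs].
      by apply: (sm_eq (sm_cst 0)) => x _; rewrite big_nil.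
    have [_ [_ Dk]] := ih k.
    have c := sm_comp oV (smooth_onD (delta_mx 0 k) sf) stau UV.
    by apply: (sm_eq (sm_add (sm_mul (Dk v) c) ihs)) => x _; rewrite big_cons.
  exact.
Qed.

Lemma sm_smooth_on f : sm U f -> smooth_on U f.
Proof.
move=> sf s x Ux.
have sms : sm U (iterD s f) by elim: s => //= v s ih; have [_ [_ ]] := sm_derive ih.
have [c [d _]] := sm_derive sms.
by split; [exact: c|move=> v; exact: d].
Qed.

End SmTheory.
End SmoothClass.

Section SmoothOps.
Context {R : realType} {E : normedModType R} (U : set E).

Lemma smooth_onS (V : set E) (f : E -> R) : V `<=` U -> smooth_on U f -> smooth_on V f.
Proof. by move=> VU sf s x /VU; exact: sf. Qed.

Lemma sm_sum (I : Type) (r : seq I) (P : pred I) (F : I -> E -> R) :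
  (forall i, sm U (F i)) -> sm U (fun x => \sum_(i <- r | P i) F i x).
Proof.
move=> sF; elim: r => [|i r ih].
  by apply: (sm_eq (sm_cst U 0)) => x _; rewrite big_nil.
case Pi : (P i); last by apply: (sm_eq ih) => x _; rewrite big_cons Pi.
by apply: (sm_eq (sm_add (sF i) ih)) => x _; rewrite big_cons Pi.
Qed.

Lemma sm_prod (I : Type) (r : seq I) (P : pred I) (F : I -> E -> R) :
  (forall i, sm U (F i)) -> sm U (fun x => \prod_(i <- r | P i) F i x).
Proof.
move=> sF; elim: r => [|i r ih].
  by apply: (sm_eq (sm_cst U 1)) => x _; rewrite big_nil.
case Pi : (P i); last by apply: (sm_eq ih) => x _; rewrite big_cons Pi.
by apply: (sm_eq (sm_mul (sF i) ih)) => x _; rewrite big_cons Pi.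
Qed.

Lemma sm_opp (f : E -> R) : sm U f -> sm U (fun x => - f x).
Proof.
move=> sf; apply: (sm_eq (sm_mul (sm_cst U (-1)) sf)) => x _.
by rewrite mulN1r.
Qed.

Lemma sm_sub (f g : E -> R) : sm U f -> sm U g -> sm U (fun x => f x - g x).
Proof. by move=> sf sg; apply: sm_add => //; exact: sm_opp. Qed.

Lemma sm_exp (f : E -> R) n : sm U f -> sm U (fun x => f x ^+ n).
Proof.
move=> sf; elim: n => [|n ih]; first by apply: (sm_eq (sm_cst U 1)).
by apply: (sm_eq (sm_mul sf ih)) => x _; rewrite exprS.
Qed.

Lemma sm_det n (A : E -> 'M[R]_n) : (forall i j, sm U (fun x => A x i j)) ->
  sm U (fun x => \det (A x)).
Proof.
move=> sA; apply: sm_sum => s; apply: sm_mul; first exact: sm_cst.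
by apply: sm_prod => i; exact: sA.
Qed.

(** Cramer's formula writes each entry as a cofactor divided by the determinant. *)
Lemma sm_invmx n (A : E -> 'M[R]_n) : (forall i j, sm U (fun x => A x i j)) ->
  (forall x, U x -> A x \in unitmx) ->
  forall i j, sm U (fun x => invmx (A x) i j).
Proof.
move=> sA uA i j.
have dA x : U x -> \det (A x) != 0 by move=> /uA; rewrite unitmxE unitfE.
have sc : sm U (fun x => cofactor (A x) j i).
  apply: sm_mul; first exact: sm_cst.
  apply: sm_det => k l.
  by apply: (sm_eq (sA (lift j k) (lift i l))) => x _; rewrite !mxE.
apply: (sm_eq (sm_mul (sm_inv (sm_det sA) dA) sc)) => x Ux.
by rewrite /invmx uA // !mxE.
Qed.

Lemma smooth_on_local (f : E -> R) :
  (forall x, U x -> exists2 N : set E, N x & smooth_on N f) -> smooth_on U f.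
Proof. by move=> loc s x Ux; have [N Nx sf] := loc x Ux; exact: sf. Qed.

Lemma smooth_on_eq (f g : E -> R) : open U -> smooth_on U f ->
  (forall x, U x -> f x = g x) -> smooth_on U g.
Proof.
by move=> oU sf fg; apply: sm_smooth_on => //; apply: sm_eq fg; exact: sm_base.
Qed.

End SmoothOps.

(** The open sets [U] and the complement of [B] cover the space, and on the second one the extension
    is identically 0. *)
Lemma smooth_on_zero_ext (R : realType) (E : normedModType R) (U B : set E) (h : E -> R) :
  open U -> closed B -> B `<=` U -> (forall x, U x -> ~ B x -> h x = 0) ->
  smooth_on U h -> smooth_on setT (fun x => if `[< U x >] then h x else 0).
Proof.
move=> oU cB BU h0 sh; apply: smooth_on_local => x _.
have [Ux|nUx] := pselect (U x).
  exists U; first exact: Ux.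
  by apply: (smooth_on_eq oU sh) => y Uy; rewrite asboolT.
exists (~` B); first by move=> /BU.
have oB : open (~` B) by rewrite openC.
apply: (sm_smooth_on oB); apply: (sm_eq (sm_cst _ 0)) => y nBy.
by case: asboolP => // Uy; rewrite h0.
Qed.

(** * Functions of time and point, and their slices *)

Section Product.
Context {R : realType}.

Lemma is_derive_linear (E : normedModType R) (f : E -> R) :
  (forall h x v, f (h *: v + x) = h * f v + f x) ->
  forall x v, is_derive x v f (f v).
Proof.
move=> lf x v.
have c : (h^-1 *: ((f \o shift x) (h *: v) - f x)) @[h --> (0:R)^'] --> f v.
  have c1 : (cst (f v) : R -> R) @ (0:R)^' --> f v by exact: cvg_cst.
  apply: cvg_trans c1; apply: near_eq_cvg; near=> h.
  have h0 : h != 0 by near: h; exact: nbhs_dnbhs_neq.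
  by rewrite /= lf addrK [RHS]mulrA mulVf // mul1r.
by apply: DeriveDef; [apply/cvg_ex; exists (f v)|exact: cvg_lim].
Unshelve. all: by end_near. Qed.

Lemma sm_coord n (U : set 'rV[R]_n) k : sm U (fun x => x 0 k).
Proof.
apply: (@sm_lin _ _ _ _ (fun v : 'rV[R]_n => v 0 k)); first exact: coord_continuous.
by apply: is_derive_linear => h x v; rewrite !mxE.
Qed.

Lemma sm_fst (V : normedModType R) (U : set (R * V)) : sm U (fun x => x.1).
Proof.
apply: (@sm_lin _ _ _ _ (fun v : R * V => v.1)); first by move=> x; exact: cvg_fst.
exact: is_derive_linear.
Qed.

Lemma sm_snd n (U : set (R * 'rV[R]_n)) k : sm U (fun x => x.2 0 k).
Proof.
apply: (@sm_lin _ _ _ _ (fun v : R * 'rV[R]_n => v.2 0 k)).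
  by move=> x; apply: (@cvg_comp _ _ _ snd (fun y : 'rV[R]_n => y 0 k) _ (nbhs x.2));
    [exact: cvg_snd|exact: coord_continuous].
by apply: is_derive_linear => h x v; rewrite !mxE.
Qed.

Lemma sm_comp_snd n (V : set 'rV[R]_n) (U : set (R * 'rV[R]_n)) f :
  open V -> smooth_on V f -> U `<=` [set x | V x.2] -> sm U (fun x => f x.2).
Proof.
by move=> oV sf UV; apply: (sm_comp (V := V)) => // k; exact: sm_snd.
Qed.

Lemma derive_sndE (V : normedModType R) (F : R * V -> R) t x v :
  'D_v (fun y => F (t, y)) x = 'D_((0 : R), v) F (t, x).
Proof.
have Q : (fun h : R => h^-1 *: (((fun y => F (t, y)) \o shift x) (h *: v) - F (t, x))) =
    (fun h : R => h^-1 *: ((F \o shift (t, x)) (h *: ((0 : R), v)) - F (t, x))).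
  apply/funext => h /=; congr (_ *: (F _ - _)); congr pair.
  by rewrite /= scaler0 add0r.
by rewrite /derive Q.
Qed.

Lemma derivable_sndE (V : normedModType R) (F : R * V -> R) t x v :
  derivable (fun y => F (t, y)) x v = derivable F (t, x) ((0 : R), v).
Proof.
have Q : (fun h : R => h^-1 *: (((fun y => F (t, y)) \o shift x) (h *: v) - F (t, x))) =
    (fun h : R => h^-1 *: ((F \o shift (t, x)) (h *: ((0 : R), v)) - F (t, x))).
  apply/funext => h /=; congr (_ *: (F _ - _)); congr pair.
  by rewrite /= scaler0 add0r.
by rewrite /derivable Q.
Qed.

Lemma is_derive_fst (V : normedModType R) (U : set (R * V)) (F : R * V -> R) t x :
  smooth_on U F -> U (t, x) ->
  is_derive t 1 (fun s => F (s, x)) ('D_((1 : R), (0 : V)) F (t, x)).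
Proof.
move=> sF Utx.
have Q : (fun h : R => h^-1 *: (((fun s => F (s, x)) \o shift t) (h *: (1 : R)) - F (t, x))) =
    (fun h : R => h^-1 *: ((F \o shift (t, x)) (h *: ((1 : R), (0 : V))) - F (t, x))).
  apply/funext => h /=; congr (_ *: (F _ - _)); congr pair.
  by rewrite /= scaler0 add0r.
apply: DeriveDef; last by rewrite /derive Q.
have := smooth_on_derivable ((1 : R), (0 : V)) sF Utx.
by rewrite /derivable Q.
Qed.

Lemma smooth_on_slice (V : normedModType R) (U : set V) (F : R * V -> R) t :
  smooth_on (setT `*` U) F -> smooth_on U (fun x => F (t, x)).
Proof.
move=> sF s x Ux.
have iE : iterD s (fun x => F (t, x)) = (fun x => iterD [seq ((0 : R), v) | v <- s] F (t, x)).
  by elim: s => //= v s ->; apply/funext => y; rewrite derive_sndE.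
have [c d] := sF [seq ((0 : R), v) | v <- s] (t, x) (conj I Ux).
rewrite iE; split.
  have c1 : (t, y) @[y --> x] --> (t, x) by apply: (cvg_pair (cvg_cst t) cvg_id).
  exact: (@cvg_comp _ _ _ (fun y => (t, y)) (iterD [seq ((0 : R), v) | v <- s] F) _ _ _ c1 c).
by move=> v; rewrite (derivable_sndE (iterD _ F)); exact: d.
Qed.

Lemma open_setTX n (U : set 'rV[R]_n) : open U -> open ([set: R] `*` U).
Proof.
move=> oU.
have -> : [set: R] `*` U = snd @^-1` U by apply/seteqP; split => [x []|x] //.
by apply: open_comp => // x _; exact: cvg_snd.
Qed.

End Product.

(** * Integrals over R^n of functions with compact support *)

Section UniformNear.
Context {R : realType}.

(** A tube argument: compactness of [K] turns continuity at the points of {p0} x K into a uniform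
    estimate near [p0]. It gives both the continuity of inner integrals and the differentiation
    under the integral sign. *)
Lemma unif_near (P Y : topologicalType) (K : set Y) (F : P * Y -> R) (p0 : P) :
  compact K -> (forall y, K y -> {for (p0, y), continuous F}) ->
  forall e, 0 < e -> \forall p \near p0, forall y, K y -> `|F (p, y) - F (p0, y)| <= e.
Proof.
move=> /compact_near_coveringP cK cF e e0.
apply: (cK P (nbhs p0) (fun p y => `|F (p, y) - F (p0, y)| <= e)) => y Ky.
have e20 : 0 < e / 2 by rewrite divr_gt0.
have h := (cvgrPdist_le _ _).1 (cF y Ky) _ e20.
have [/= [A B] [/= nA nB] AB] := h.
exists (B, A) => /=; first by split.
move=> -[y' p] /= [By Ap].
have h1 := AB (p, y') (conj Ap By).
have h2 := AB (p0, y') (conj (nbhs_singleton nA) By).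
rewrite /= in h1 h2.
rewrite [e]splitr -(subrKA (F (p0, y))) (le_trans (ler_normD _ _)) // lerD //.
by rewrite distrC.
Qed.

Lemma compact_cball n (r : R) : compact [set y : 'rV[R]_n | `|y| <= r].
Proof.
apply: bounded_closed_compact.
  by exists r; split; [exact: num_real|move=> M rM x /= xr; rewrite (le_trans xr) // ltW].
have -> : [set y : 'rV[R]_n | `|y| <= r] = (fun y : 'rV[R]_n => `|y|) @^-1` [set x | x <= r] by [].
by apply: closed_comp; [move=> x _; exact: norm_continuous|exact: closed_le].
Qed.

End UniformNear.

Lemma cvg_pair_cst (P Y : topologicalType) (x : P) (y : Y) :
  (x, z) @[z --> y] --> (x, y).
Proof. by apply: (cvg_pair (cvg_cst x) cvg_id). Qed.

Section RowMx.
Context {R : realType}.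
(** The scalar is placed in front of the row: this is the argument that [rV_integral] forms when it
    splits off its first variable. *)
Definition rcons_row m (x : R) (y : 'rV[R]_m) : 'rV[R]_m.+1 := row_mx (x%:M : 'rV[R]_1) y.

Lemma rcons_row0 m x (y : 'rV[R]_m) : rcons_row x y 0 0 = x.
Proof.
rewrite /rcons_row; have -> : (0 : 'I_m.+1) = lshift m (0 : 'I_1) by apply/val_inj.
by apply: (eq_trans (row_mxEl _ _ _ _)); rewrite mxE eqxx.
Qed.

Lemma rcons_rowS m x (y : 'rV[R]_m) k : rcons_row x y 0 (lift 0 k) = y 0 k.
Proof.
rewrite /rcons_row; have -> : (lift 0 k : 'I_m.+1) = rshift 1 k by apply/val_inj.
exact: row_mxEr.
Qed.

Lemma rcons_row_eta m (x : 'rV[R]_m.+1) : x = rcons_row (x 0 0) (\row_k x 0 (lift 0 k)).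
Proof.
apply/rowP => k; case: (unliftP 0 k) => [j ->|->]; last by rewrite rcons_row0.
by rewrite rcons_rowS mxE.
Qed.

Lemma rcons_row_continuous m : continuous (fun p : R * 'rV[R]_m => rcons_row p.1 p.2).
Proof.
move=> p; apply: cvg_rowP => k; case: (unliftP 0 k) => [j ->|->].
  under eq_fun do rewrite rcons_rowS; rewrite rcons_rowS.
  apply: (@cvg_comp _ _ _ snd (fun y : 'rV[R]_m => y 0 j) _ (nbhs p.2)); first exact: cvg_snd.
  exact: coord_continuous.
by under eq_fun do rewrite rcons_row0; rewrite rcons_row0; exact: cvg_fst.
Qed.

Lemma rcons_row_norm1 m x (y : 'rV[R]_m) : `|x| <= `|rcons_row x y|.
Proof. by have := coord_le_norm (rcons_row x y) 0; rewrite rcons_row0. Qed.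

Lemma rcons_row_norm2 m x (y : 'rV[R]_m) : `|y| <= `|rcons_row x y|.
Proof.
apply: norm_row_le => // k.
by have := coord_le_norm (rcons_row x y) (lift 0 k); rewrite rcons_rowS.
Qed.
End RowMx.

Section CompactSupport.
Context {R : realType}.
Notation mu := (@lebesgue_measure R).

(** The norm is the maximum norm, so a radius [r] passes unchanged to slices and the support lies in
    a cube of volume (2 r)^n. *)
Definition Cc n (r : R) (f : 'rV[R]_n -> R) :=
  continuous f /\ forall x, r < `|x| -> f x = 0.

Definition Cc1 (r : R) (f : R -> R) := continuous f /\ forall x, r < `|x| -> f x = 0.

Lemma Cc1_restrict r f : Cc1 r f -> f \_ `[- r, r] = f.
Proof.
move=> [_ f0]; apply/funext => x; rewrite patchE; case: ifPn => // /negP nx.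
rewrite f0 // ltNge; apply/negP; rewrite ler_norml => xr; apply: nx.
by rewrite inE /= in_itv.
Qed.

Lemma Cc1_integrable r f : Cc1 r f -> mu.-integrable setT (EFin \o f).
Proof.
move=> cf; rewrite -(Cc1_restrict cf) -restrict_EFin -(integrable_mkcond _ _).
  apply: continuous_compact_integrable; first exact: segment_compact.
  by apply: continuous_subspaceT; case: cf.
exact: measurable_itv.
Qed.

Lemma Cc1_int r f : Cc1 r f -> \int[mu]_x f x = \int[mu]_(x in `[- r, r]) f x.
Proof.
move=> cf; rewrite [RHS]Rintegral_mkcond.
apply: eq_Rintegral => x _.
exact: (esym (congr1 (fun g => g x) (Cc1_restrict cf))).
Qed.

Lemma Cc1_bound r f e : 0 <= r -> Cc1 r f -> (forall x, `|f x| <= e) ->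
  `|\int[mu]_x f x| <= e * (2 * r).
Proof.
move=> r0 cf fe; rewrite (Cc1_int cf).
have ci (g : R -> R) : continuous g -> mu.-integrable `[- r, r] (EFin \o g).
  move=> cg; apply: continuous_compact_integrable; first exact: segment_compact.
  exact: continuous_subspaceT.
have cf' : continuous f by case: cf.
apply: le_trans (le_normr_Rintegral _ (ci _ cf')) _; first exact: measurable_itv.
apply: le_trans (@le_Rintegral _ _ _ mu `[- r, r] (fun x => `|f x|) (fun _ => e) _ _ _ _) _.
- exact: measurable_itv.
- by apply: ci => x; apply: cvg_norm; exact: cf'.
- by apply: ci => x; exact: cvg_cst.
- by move=> x _; exact: fe.
have mE : lebesgue_measure `[- r, r]%classic = (2 * r)%:E.
  rewrite lebesgue_measure_itv /= lte_fin; case: ifPn => [_|].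
    by rewrite -EFinB opprK mulr_natl mulr2n.
  rewrite -leNgt => rr; have -> : r = 0 by lra.
  by rewrite mulr0.
rewrite Rintegral_cst; last exact: measurable_itv.
by rewrite [X in fine X](_ : _ = (2 * r)%:E).
Qed.

Lemma rV_integral0 n : rV_integral (fun _ : 'rV[R]_n => 0) = 0.
Proof.
elim: n => //= n ih; under eq_Rintegral do rewrite ih.
by rewrite /Rintegral integral0.
Qed.

Lemma Cc_slice n r (f : 'rV[R]_n.+1 -> R) x : Cc r f -> Cc r (fun y => f (rcons_row x y)).
Proof.
move=> [cf f0]; split=> [y|y ry]; last by apply: f0; apply: lt_le_trans ry (rcons_row_norm2 _ _).
have c1 := @cvg_pair_cst R 'rV[R]_n x y.
have c2 := @cvg_comp _ _ _ _ (fun p => rcons_row p.1 p.2) _ _ _ c1 (@rcons_row_continuous R n (x, y)).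
exact: (@cvg_comp _ _ _ _ f _ _ _ c2 (cf _)).
Qed.

Lemma CcB n r (f g : 'rV[R]_n -> R) : Cc r f -> Cc r g -> Cc r (fun x => f x - g x).
Proof.
move=> [cf f0] [cg g0]; split=> [x|x rx]; last by rewrite f0 // g0 // subrr.
exact: (cvgB (cf x) (cg x)).
Qed.

Lemma CcZ n r c (f : 'rV[R]_n -> R) : Cc r f -> Cc r (fun x => c * f x).
Proof.
move=> [cf f0]; split=> [x|x rx]; last by rewrite f0 // mulr0.
exact: (cvgM (cvg_cst c) (cf x)).
Qed.

(* The two properties are proved by a joint induction on the dimension: they make the
   inner integral continuous, hence integrable, in the first variable. *)
Definition integralB_bound n := forall r (f g : 'rV[R]_n -> R), 0 <= r -> Cc r f -> Cc r g ->
   rV_integral (fun x => f x - g x) = rV_integral f - rV_integral g /\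
   (forall e, (forall x, `|f x| <= e) -> `|rV_integral f| <= e * (2 * r) ^+ n).

(** Two nearby slices differ uniformly by little on the compact ball, by [unif_near]; the
    n-dimensional bound then makes their integrals close. *)
Lemma partial_Cc1 n r (f : 'rV[R]_n.+1 -> R) : integralB_bound n -> 0 <= r -> Cc r f ->
  Cc1 r (fun x => rV_integral (fun y => f (rcons_row x y))).
Proof.
move=> gn r0 cf; split; last first.
  move=> x rx; rewrite -[RHS](rV_integral0 n); congr rV_integral; apply/funext => y.
  by have [_ f0] := cf; apply: f0; apply: lt_le_trans rx (rcons_row_norm1 _ _).
move=> x0; apply/cvgrPdist_le => e e0.
(* The added 1 keeps the divisor positive when [r = 0]. *)
have P0 : 0 < (2 * r) ^+ n + 1.
  by rewrite ltr_wpDl // exprn_ge0 // mulr_ge0.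
have e'0 : 0 < e / ((2 * r) ^+ n + 1) by rewrite divr_gt0.
have cF y : [set y : 'rV[R]_n | `|y| <= r] y ->
    {for (x0, y), continuous (fun p : R * 'rV[R]_n => f (rcons_row p.1 p.2))}.
  move=> _; have [c _] := cf.
  exact: (@cvg_comp _ _ _ (fun p => rcons_row p.1 p.2) f _ _ _ (@rcons_row_continuous R n (x0, y)) (c _)).
have := @unif_near R _ _ _ (fun p : R * 'rV[R]_n => f (rcons_row p.1 p.2)) x0 (@compact_cball R n r) cF _ e'0.
apply: filterS => x hx.
have cx := Cc_slice x cf; have cx0 := Cc_slice x0 cf.
have [<- _] := gn r _ _ r0 cx0 cx.
have [_ bd] := gn r _ _ r0 (CcB cx0 cx) cx0.
apply: le_trans (bd (e / ((2 * r) ^+ n + 1)) _) _ => [y|].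
  have [yr|yr] := leP `|y| r; first by rewrite distrC; exact: hx.
  have [_ c0] := CcB cx0 cx.
  by rewrite c0 // normr0 ltW.
rewrite mulrAC ler_pdivrMr // ler_wpM2l ?(ltW e0) //.
by rewrite lerDl.
Qed.

Lemma rV_integralB_bound n : integralB_bound n.
Proof.
elim: n => [|n ih] r f g r0 cf cg; first by split=> // e fe; rewrite /= expr0 mulr1.
have ci (h : 'rV[R]_n.+1 -> R) : Cc r h -> mu.-integrable setT (EFin \o (fun x : R => rV_integral (fun y => h (rcons_row x y)))).
  by move=> ch; exact: (Cc1_integrable (partial_Cc1 ih r0 ch)).
split=> [|e fe].
  transitivity (\int[mu]_x (rV_integral (fun y => f (rcons_row x y)) - rV_integral (fun y => g (rcons_row x y)))).
    apply: eq_Rintegral => x _.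
    by have [] := ih r _ _ r0 (Cc_slice x cf) (Cc_slice x cg).
  by apply: RintegralB; [exact: measurableT|exact: ci|exact: ci].
have := @Cc1_bound r _ (e * (2 * r) ^+ n) r0 (partial_Cc1 ih r0 cf).
move=> bd; rewrite exprSr mulrA; apply: bd => x.
have [_ ] := ih r _ _ r0 (Cc_slice x cf) (Cc_slice x cf).
by apply.
Qed.

Lemma rV_integralB n r (f g : 'rV[R]_n -> R) : 0 <= r -> Cc r f -> Cc r g ->
  rV_integral (fun x => f x - g x) = rV_integral f - rV_integral g.
Proof. by move=> r0 cf cg; have [] := rV_integralB_bound r0 cf cg. Qed.

Lemma rV_integral_bound n r (f : 'rV[R]_n -> R) e : 0 <= r -> Cc r f ->
  (forall x, `|f x| <= e) -> `|rV_integral f| <= e * (2 * r) ^+ n.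
Proof. by move=> r0 cf; have [_] := rV_integralB_bound r0 cf cf; apply. Qed.

Lemma rV_integralZ n r (f : 'rV[R]_n -> R) c : 0 <= r -> Cc r f ->
  rV_integral (fun x => c * f x) = c * rV_integral f.
Proof.
move=> r0; elim: n f => [|n ih] f cf //.
transitivity (\int[mu]_x (c * rV_integral (fun y => f (rcons_row x y)))).
  by apply: eq_Rintegral => x _; rewrite -ih //; exact: Cc_slice.
apply: RintegralZl; first exact: measurableT.
exact: (Cc1_integrable (partial_Cc1 (@rV_integralB_bound n) r0 cf)).
Qed.

End CompactSupport.

Section IntegralDerive.
Context {R : realType}.
Notation mu := (@lebesgue_measure R).

Lemma CcD n r (f g : 'rV[R]_n -> R) : Cc r f -> Cc r g -> Cc r (fun x => f x + g x).
Proof.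
move=> [cf f0] [cg g0]; split=> [x|x rx]; last by rewrite f0 // g0 // addr0.
exact: (cvgD (cf x) (cg x)).
Qed.

Lemma rV_integralD n r (f g : 'rV[R]_n -> R) : 0 <= r -> Cc r f -> Cc r g ->
  rV_integral (fun x => f x + g x) = rV_integral f + rV_integral g.
Proof.
move=> r0 cf cg; transitivity (rV_integral (fun x => f x - (-1) * g x)).
  by congr rV_integral; apply/funext => x; rewrite mulN1r opprK.
by rewrite (rV_integralB r0) ?(rV_integralZ _ r0) ?mulN1r ?opprK //; exact: CcZ.
Qed.

Lemma rV_integral_sum0 n r (I : Type) (s : seq I) (f : I -> 'rV[R]_n -> R) : 0 <= r ->
  (forall i, Cc r (f i)) -> (forall i, rV_integral (f i) = 0) ->
  Cc r (fun x => \sum_(i <- s) f i x) /\ rV_integral (fun x => \sum_(i <- s) f i x) = 0.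
Proof.
move=> r0 cf If; elim: s => [|i s [ih1 ih2]].
  under eq_fun do rewrite big_nil; rewrite rV_integral0; split=> //.
  by split=> [|//]; exact: cst_continuous.
under eq_fun do rewrite big_cons.
split; first exact: CcD.
by rewrite (rV_integralD r0) // If ih2 addr0.
Qed.

(** The mean value theorem in [t] replaces the difference quotient by a value of [F'] at an
    intermediate time. By [unif_near] that value is uniformly close to [F' (t0, x)] on the ball,
    outside which everything vanishes, and [rV_integral_bound] controls the integral of the
    error. *)
Lemma derive_rV_integral n r (F F' : R * 'rV[R]_n -> R) (t0 : R) : 0 <= r ->
  (forall t, Cc r (fun x => F (t, x))) ->
  (forall (t : R) x, is_derive t 1 (fun s => F (s, x)) (F' (t, x))) ->
  (forall x, {for (t0, x), continuous F'}) ->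
  is_derive t0 1 (fun t => rV_integral (fun x => F (t, x))) (rV_integral (fun x => F' (t0, x))).
Proof.
move=> r0 cF dF cF'.
have F'0 (t : R) x : r < `|x| -> F' (t, x) = 0.
  move=> rx; have [_ <-] := dF t x.
  have -> : (fun s => F (s, x)) = cst 0.
    by apply/funext => s; have [_ ->] := cF s.
  by rewrite derive_cst.
have CF' : Cc r (fun x => F' (t0, x)).
  split=> [x|x]; last exact: F'0.
  exact: (@cvg_comp _ _ _ (fun y => (t0, y)) F' _ _ _ (@cvg_pair_cst R 'rV[R]_n t0 x) (cF' x)).
apply: cvg_is_derive1; apply/cvgrPdist_le => e e0.
have P0 : 0 < (2 * r) ^+ n + 1.
  by rewrite ltr_wpDl // exprn_ge0 // mulr_ge0.
have e'0 : 0 < e / ((2 * r) ^+ n + 1) by rewrite divr_gt0.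
have := @unif_near R _ _ _ F' t0 (@compact_cball R n r) (fun y _ => cF' y) _ e'0.
move=> /nbhs_ballP [d /= d0 hd].
near=> h.
have hn0 : h != 0 by near: h; exact: nbhs_dnbhs_neq.
have hd' : `|h| < d by near: h; exact: dnbhs0_lt.
rewrite -(rV_integralB r0) // -(rV_integralZ _ r0); last exact: CcB.
have CD := CcZ h^-1 (CcB (cF (h + t0)) (cF t0)).
rewrite -(rV_integralB r0) //.
apply: le_trans (rV_integral_bound (e := e / ((2 * r) ^+ n + 1)) r0 (CcB CF' CD) _) _ => [x|].
  have [xr|xr] := leP `|x| r; last first.
    by have [_ ->] := CcB CF' CD; rewrite ?normr0 ?ltW.
  have [|s [s01]] := @MVT_dir R _ (fun s => F (s, x)) t0 1 h.
    by move=> s _; have [] := dF ((s * h) *: 1 + t0) x.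
  rewrite [h *: 1]mulr1 => ->; rewrite mulKf //.
  have [_ ->] := dF ((s * h) *: 1 + t0) x; rewrite distrC; apply: hd => //.
  rewrite -ball_normE /= [(s * h) *: 1]mulr1 opprD addrCA subrr addr0 normrN normrM.
  case/andP: s01 => s0 s1; rewrite ger0_norm //; apply: le_lt_trans hd'.
  by rewrite ler_piMl.
rewrite mulrAC ler_pdivrMr // ler_wpM2l ?(ltW e0) //.
by rewrite lerDl.
Unshelve. all: by end_near. Qed.

Lemma rcons_row_line m (h x : R) (y : 'rV[R]_m) :
  rcons_row (h + x) y = h *: delta_mx 0 0 + rcons_row x y.
Proof.
apply/rowP => k; rewrite [RHS]mxE; case: (unliftP 0 k) => [j ->|->].
  by rewrite !rcons_rowS !mxE eqxx /= mulr0 add0r.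
by rewrite !rcons_row0 !mxE eqxx /= mulr1.
Qed.

Lemma rcons_row_lineS m (h x : R) (y : 'rV[R]_m) j :
  rcons_row x (h *: delta_mx 0 j + y) = h *: delta_mx 0 (lift 0 j) + rcons_row x y.
Proof.
apply/rowP => k; rewrite [RHS]mxE; case: (unliftP 0 k) => [l ->|->].
  by rewrite !rcons_rowS !mxE !eqxx /= (inj_eq (@lift_inj _ _)).
by rewrite !rcons_row0 !mxE eqxx /= mulr0 add0r.
Qed.

Lemma CcDeriv n r (f : 'rV[R]_n -> R) v : Cc r f -> continuous ('D_v f) -> Cc r ('D_v f).
Proof.
move=> [cf f0] cDf; split=> // x rx.
rewrite -(derive_cst (0 : R) x v); apply: near_eq_derive.
have : \forall y \near x, r < `|y|.
  exact: (@cvgr_gt R _ _ _ (fun y : 'rV[R]_n => `|y|) `|x| (@norm_continuous _ _ x) r rx).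
by apply: filterS => y /f0.
Qed.

Lemma Cc1_int_deriv r (G G' : R -> R) : 0 <= r -> (forall x, r < `|x| -> G x = 0) ->
  (forall x : R, is_derive x 1 G (G' x)) -> Cc1 r G' -> \int[mu]_x G' x = 0.
Proof.
move=> r0 G0 dG cG'.
(* Radius [r + 1] instead of [r]: the interval is nondegenerate even for [r = 0], and [G], known to
   vanish only where [r < |x|], vanishes at both endpoints. *)
have r1 : - (r + 1) < r + 1 by lra.
have cG'1 : Cc1 (r + 1) G' by have [c c0] := cG'; split=> // x rx; apply: c0; lra.
rewrite (Cc1_int cG'1) /Rintegral (@continuous_FTC2 _ _ G _ _ r1).
- by rewrite !G0 ?sube0 // ?normrN ger0_norm ?ltrDl //; lra.
- by apply: continuous_subspaceT; case: cG'.
- split=> [x _||]; first by have [] := dG x.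
    by apply: cvg_at_right_filter; exact: is_derive1_continuous (dG _).
  by apply: cvg_at_left_filter; exact: is_derive1_continuous (dG _).
- by move=> x _; rewrite derive1E; have [_ ->] := dG x.
Qed.

(** Induction along the recursion of [rV_integral], without exchanging integrals. A derivative in a
    later variable is already killed by the inner integral; a derivative in the first variable is
    pulled out of the inner integral and killed by the outer one. *)
Lemma rV_integral_deriv n r (f : 'rV[R]_n -> R) (b : 'I_n) : 0 <= r -> Cc r f ->
  (forall x, derivable f x (delta_mx 0 b)) -> continuous ('D_(delta_mx 0 b) f) ->
  rV_integral ('D_(delta_mx 0 b) f) = 0.
Proof.
move=> r0; elim: n f b => [f [//]|n ih] f b cf df cDf.
have CD := CcDeriv cf cDf.
have cont v t x : continuous ('D_v f) -> {for (t, x), continuous (fun p : R * 'rV[R]_n => 'D_v f (rcons_row p.1 p.2))}.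
  move=> c; exact: (@cvg_comp _ _ _ (fun p => rcons_row p.1 p.2) ('D_v f) _ _ _ (@rcons_row_continuous R n (t, x)) (c _)).
case: (unliftP 0 b) => [j bE|bE]; subst b.
- have dE x y : 'D_(delta_mx 0 (lift 0 j)) f (rcons_row x y) = 'D_(delta_mx 0 j) (fun y => f (rcons_row x y)) y.
    have Q : (fun h : R => h^-1 *: (((fun y => f (rcons_row x y)) \o shift y) (h *: delta_mx 0 j) - f (rcons_row x y))) =
       (fun h : R => h^-1 *: ((f \o shift (rcons_row x y)) (h *: delta_mx 0 (lift 0 j)) - f (rcons_row x y))).
      by apply/funext => h /=; rewrite rcons_row_lineS.
    by rewrite /derive Q.
  have dD x y : derivable (fun y => f (rcons_row x y)) y (delta_mx 0 j).
    have := df (rcons_row x y).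
    have Q : (fun h : R => h^-1 *: (((fun y => f (rcons_row x y)) \o shift y) (h *: delta_mx 0 j) - f (rcons_row x y))) =
       (fun h : R => h^-1 *: ((f \o shift (rcons_row x y)) (h *: delta_mx 0 (lift 0 j)) - f (rcons_row x y))).
      by apply/funext => h /=; rewrite rcons_row_lineS.
    by rewrite /derivable Q.
  rewrite -[RHS](rV_integral0 n.+1) /=; apply: eq_Rintegral => x _.
  rewrite rV_integral0 -[LHS]/(rV_integral (fun y => 'D_(delta_mx 0 (lift 0 j)) f (rcons_row x y))).
  have -> : (fun y => 'D_(delta_mx 0 (lift 0 j)) f (rcons_row x y)) = 'D_(delta_mx 0 j) (fun y => f (rcons_row x y)).
    by apply/funext => y; exact: dE.
  apply: ih; [exact: Cc_slice|exact: dD|].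
  have -> : 'D_(delta_mx 0 j) (fun y => f (rcons_row x y)) = (fun y => 'D_(delta_mx 0 (lift 0 j)) f (rcons_row x y)).
    by apply/funext => y; rewrite dE.
  by have [] := Cc_slice x CD.
- have dF (t : R) x : is_derive t 1 (fun s => f (rcons_row s x)) ('D_(delta_mx 0 0) f (rcons_row t x)).
    have := @is_derive_line R _ f (rcons_row 0 x) (delta_mx 0 0) t (df _).
    rewrite -rcons_row_line addr0.
    have -> // : (fun h : R => f (h *: delta_mx 0 0 + rcons_row 0 x)) = (fun s => f (rcons_row s x)).
    by apply/funext => s; rewrite -rcons_row_line addr0.
  pose G x := rV_integral (fun y : 'rV[R]_n => f (rcons_row x y)).
  pose G' x := rV_integral (fun y : 'rV[R]_n => 'D_(delta_mx 0 0) f (rcons_row x y)).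
  have dG (t : R) : is_derive t 1 G (G' t).
    exact: (@derive_rV_integral n r (fun p => f (rcons_row p.1 p.2)) (fun p => 'D_(delta_mx 0 0) f (rcons_row p.1 p.2)) t r0 (fun s => Cc_slice s cf) dF (fun x => cont _ t x cDf)).
  apply: (@Cc1_int_deriv r G G' r0 _ dG (partial_Cc1 (@rV_integralB_bound _ n) r0 CD)).
  by have [_] := partial_Cc1 (@rV_integralB_bound _ n) r0 cf.
Qed.

Lemma Cc1_int_gt0 r (g : R -> R) c : Cc1 r g -> (forall x, 0 <= g x) -> 0 < g c ->
  0 < \int[mu]_x g x.
Proof.
move=> cg g0 gc.
have [cg' _] := cg.
have g20 : 0 < g c / 2 by rewrite divr_gt0.
have : \forall x \near c, g c / 2 < g x.
  apply: (@cvgr_gt R _ _ _ g (g c) (cg' c)).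
  by rewrite ltr_pdivrMr // ltr_pMr // ltr1n.
move=> /nbhs_ballP [d /= d0 hd].
pose D := `[c - d / 2, c + d / 2]%classic.
have mD : measurable D by exact: measurable_itv.
have d20 : 0 < d / 2 by rewrite divr_gt0.
have gD x : D x -> g c / 2 <= g x.
  rewrite /D /= in_itv /= => xD; apply/ltW/hd; rewrite -ball_normE /=.
  rewrite distrC; apply: (@le_lt_trans _ _ (d / 2)); last by lra.
  by rewrite ler_norml; lra.
have ci (h : R -> R) : continuous h -> mu.-integrable D (EFin \o h).
  move=> ch; apply: continuous_compact_integrable; first exact: segment_compact.
  exact: continuous_subspaceT.
have iD : \int[mu]_(x in D) (g c / 2) <= \int[mu]_(x in D) g x.
  by apply: le_Rintegral => //; [apply: ci; exact: cst_continuous|exact: ci].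
have mE : lebesgue_measure D = d%:E.
  rewrite /D lebesgue_measure_itv /= lte_fin ifT; last by lra.
  by rewrite -EFinB; congr EFin; lra.
have iD2 : \int[mu]_(x in D) g x <= \int[mu]_x g x.
  rewrite [leLHS]Rintegral_mkcond; apply: le_Rintegral => //.
  - by rewrite -restrict_EFin -(integrable_mkcond _ _); [exact: (ci g cg')|exact: mD].
  - exact: (Cc1_integrable cg).
  - by move=> x _; rewrite patchE; case: ifP.
apply: lt_le_trans iD2; apply: lt_le_trans iD.
rewrite Rintegral_cst // [X in fine X](_ : _ = d%:E) //=.
by rewrite mulr_gt0.
Qed.

Lemma rV_integral_ge0 n (f : 'rV[R]_n -> R) : (forall x, 0 <= f x) -> 0 <= rV_integral f.
Proof.
by elim: n f => //= n ih f f0; apply: Rintegral_ge0 => x _; exact: ih.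
Qed.

Lemma rV_integral_gt0 n r (f : 'rV[R]_n -> R) c : 0 <= r -> Cc r f ->
  (forall x, 0 <= f x) -> 0 < f c -> 0 < rV_integral f.
Proof.
move=> r0; elim: n f c => [|n ih] f c cf f0 fc.
  by rewrite /= (_ : 0 = c) //; apply/rowP => -[].
apply: (@Cc1_int_gt0 r _ (c 0 0) (partial_Cc1 (@rV_integralB_bound _ n) r0 cf)).
  by move=> x; apply: rV_integral_ge0.
apply: (ih _ (\row_k c 0 (lift 0 k)) (Cc_slice _ cf)) => //.
by rewrite -rcons_row_eta.
Qed.
End IntegralDerive.

(** * Composition with linear maps and with pairs *)

Section LinearChange.
Context {R : realType}.

Lemma smooth_on_linear (E E' : normedModType R) (L : E -> E') (V : set E') (f : E' -> R) :
  (forall (h : R) x y, L (h *: x + y) = h *: L x + L y) -> continuous L ->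
  smooth_on V f -> smooth_on (L @^-1` V) (f \o L).
Proof.
move=> lL cL sf s x Vx.
have Q (g : E' -> R) y v : (fun h : R => h^-1 *: (((g \o L) \o shift y) (h *: v) - (g \o L) y)) =
    (fun h : R => h^-1 *: ((g \o shift (L y)) (h *: L v) - g (L y))).
  by apply/funext => h /=; rewrite lL.
have iE : iterD s (f \o L) = iterD [seq L v | v <- s] f \o L.
  by elim: s => //= v s ->; apply/funext => y /=; rewrite /derive Q.
have [c d] := sf [seq L v | v <- s] (L x) Vx.
rewrite iE; split.
  exact: (@cvg_comp _ _ _ L (iterD [seq L v | v <- s] f) _ _ _ (cL x) c).
by move=> v; rewrite /derivable Q; exact: d.
Qed.

(** [sm_comp] composes with functions of a row vector only; the linear map [L] identifies rows of
    length n+1 with pairs of a time and a row of length n. *)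
Lemma sm_comp_pair (E : normedModType R) (U : set E) n (V : set (R * 'rV[R]_n))
    (f : R * 'rV[R]_n -> R) (t : E -> R) (tau : E -> 'rV[R]_n) :
  open V -> smooth_on V f -> sm U t -> (forall k, sm U (fun x => tau x 0 k)) ->
  (forall x, U x -> V (t x, tau x)) -> sm U (fun x => f (t x, tau x)).
Proof.
move=> oV sf st stau UV.
pose L (z : 'rV[R]_n.+1) : R * 'rV[R]_n := (z 0 0, \row_k z 0 (lift 0 k)).
have LK s y : L (rcons_row s y) = (s, y).
  rewrite /L rcons_row0; congr pair; apply/rowP => k.
  by rewrite mxE rcons_rowS.
have lL (h : R) x y : L (h *: x + y) = h *: L x + L y.
  rewrite /L; congr pair; first by rewrite !mxE.
  by apply/rowP => k; rewrite !mxE.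
have cL : continuous L.
  move=> z.
  have c1 : (fun z : 'rV[R]_n.+1 => z 0 0) y @[y --> z] --> z 0 0 by exact: coord_continuous.
  pose tl (z : 'rV[R]_n.+1) : 'rV[R]_n := \row_k z 0 (lift 0 k).
  have tlk k : (fun y => tl y 0 k) = (fun y => y 0 (lift 0 k)).
    by apply/funext => y; rewrite mxE.
  have c3 k : (fun y => tl y 0 k) y @[y --> z] --> tl z 0 k.
    by rewrite tlk [tl z 0 k](congr1 (fun f => f z) (tlk k)); exact: coord_continuous.
  have c2 := @cvg_rowP R n _ (nbhs z) _ tl (tl z) c3.
  exact: (cvg_pair c1 (c2 _)).
have sL := smooth_on_linear lL cL sf.
have oL : open (L @^-1` V) by apply: open_comp => // z _; exact: cL.
apply: (sm_eq (f := fun x => (f \o L) (rcons_row (t x) (tau x)))).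
  apply: (sm_comp oL sL) => [k|x Ux]; last by rewrite /= LK; exact: UV.
  case: (unliftP 0 k) => [j ->|->].
    by apply: (sm_eq (stau j)) => x _; rewrite rcons_rowS.
  by apply: (sm_eq st) => x _; rewrite rcons_row0.
by move=> x _; rewrite /= LK.
Qed.
End LinearChange.

(** * Smooth functions on the manifold *)

Section Manifold.
Context {R : realType} (M : manifold R 7).
Notation I := (chart_index M).

(** Cutting [N] down to the chart domain lets one set [N] be tested in all charts at once, whether
    or not it lies in any of them. *)
Definition cim (i : I) (N : set M) : set 'rV[R]_7 := chart i @` (chart_dom i `&` N).

Lemma cim_dom i (N : set M) x : cim i N x ->
  [/\ chart_dom i (chart_inv i x), N (chart_inv i x) & chart i (chart_inv i x) = x].
Proof. by move=> [p [dp Np] <-]; rewrite chartK. Qed.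

Lemma cim_chart i (N : set M) p : chart_dom i p -> N p -> cim i N (chart i p).
Proof. by move=> dp Np; exists p. Qed.

Lemma cim_open i (N : set M) : open N -> open (cim i N).
Proof.
move=> oN; rewrite openE => x Nx; have [dx Nix xE] := cim_dom Nx.
have Ux : (chart i @` chart_dom i) x by exists (chart_inv i x).
have n1 : \forall y \near x, (chart i @` chart_dom i) y.
  by apply: open_nbhs_nbhs; split => //; exact: codom_open.
have n2 : \forall y \near x, N (chart_inv i y).
  by apply: (chart_inv_continuous Ux); apply: open_nbhs_nbhs.
apply: filterS2 n1 n2 => y [p dp <-] Np; exists p => //; split=> //.
by rewrite chartK in Np.
Qed.

Global Arguments cim_open i {N} _.

(* Joint smoothness on [R * N]. *)
Definition smF (N : set M) (F : R -> M -> R) : Prop :=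
  forall i, smooth_on ([set: R] `*` cim i N)
    (fun tx : R * 'rV[R]_7 => F tx.1 (chart_inv i tx.2)).

Lemma open_cimX i (N : set M) : open N -> open ([set: R] `*` cim i N).
Proof. by move=> oN; apply: open_setTX; exact: cim_open. Qed.

Global Arguments open_cimX i {N} _.

Lemma smFS (N N' : set M) F : N' `<=` N -> smF N F -> smF N' F.
Proof.
move=> NN sF i; apply: smooth_onS (sF i) => -[t x] [_ /= [p [dp Np] <-]]; split=> //.
by exists p => //; split=> //; exact: NN.
Qed.

(** Smoothness in a single chart passes to every other chart by composing with the transition maps,
    time being left untouched. *)
Lemma smF_of_chart j (N : set M) F : open N -> N `<=` chart_dom j ->
  smooth_on ([set: R] `*` cim j N) (fun tx : R * 'rV[R]_7 => F tx.1 (chart_inv j tx.2)) ->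
  smF N F.
Proof.
move=> oN Nj sF i; apply: sm_smooth_on; first exact: open_cimX.
have := @sm_comp_pair R _ ([set: R] `*` cim i N) 7 _ _ (fun tx : R * 'rV[R]_7 => tx.1)
  (fun tx => chart j (chart_inv i tx.2)) (open_cimX j oN) sF (sm_fst _) _ _.
move=> h; apply: (sm_eq (h _ _)).
- move=> k; apply: (sm_comp_snd (V := cim i (chart_dom j)) (f := fun x => chart j (chart_inv i x) 0 k) (cim_open i (@dom_open _ _ M j))).
    exact: chart_smooth.
  by move=> -[t x] [_ /= [p [dp Np] <-]]; exists p => //; split=> //; exact: Nj.
- move=> -[t x] [_ /= [p [dp Np] <-]]; split=> //=; rewrite chartK //.
  by exists p => //; split=> //; exact: Nj.
move=> -[t x] [_ /= [p [dp Np] <-]]; rewrite /= chartK // chartK //; exact: Nj.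
Qed.

Lemma smF_local (N : set M) F :
  (forall p, N p -> exists2 N', N' p & smF N' F) -> smF N F.
Proof.
move=> loc i; apply: smooth_on_local => -[t x] [_ /= [p [dp Np] <-]].
have [N' N'p sF] := loc p Np.
exists ([set: R] `*` cim i N'); last exact: sF.
by split=> //=; exists p.
Qed.

Section Closure.
Variable N : set M.
Hypothesis oN : open N.

Lemma smF_sm F : smF N F <-> forall i, sm ([set: R] `*` cim i N) (fun tx : R * 'rV[R]_7 => F tx.1 (chart_inv i tx.2)).
Proof.
split=> sF i; first exact/sm_base/sF.
by apply: sm_smooth_on; [exact: open_cimX|exact: sF].
Qed.

Lemma smF_eq F G : smF N F -> (forall t p, N p -> F t p = G t p) -> smF N G.
Proof.
move=> /smF_sm sF FG; apply/smF_sm => i; apply: (sm_eq (sF i)) => -[t x] [_ /= /cim_dom[_ Nx _]].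
exact: FG.
Qed.

Lemma smF_cst c : smF N (fun _ _ => c).
Proof. by apply/smF_sm => i; exact: sm_cst. Qed.

Lemma smF_time : smF N (fun t _ => t).
Proof. by apply/smF_sm => i; exact: sm_fst. Qed.

Lemma smF_add F G : smF N F -> smF N G -> smF N (fun t p => F t p + G t p).
Proof. by move=> /smF_sm sF /smF_sm sG; apply/smF_sm => i; exact: (sm_add (sF i) (sG i)). Qed.

Lemma smF_mul F G : smF N F -> smF N G -> smF N (fun t p => F t p * G t p).
Proof. by move=> /smF_sm sF /smF_sm sG; apply/smF_sm => i; exact: (sm_mul (sF i) (sG i)). Qed.

Lemma smF_opp F : smF N F -> smF N (fun t p => - F t p).
Proof. by move=> /smF_sm sF; apply/smF_sm => i; exact: (sm_opp (sF i)). Qed.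

Lemma smF_sub F G : smF N F -> smF N G -> smF N (fun t p => F t p - G t p).
Proof. by move=> sF sG; exact: (smF_add sF (smF_opp sG)). Qed.

Lemma smF_exp F n : smF N F -> smF N (fun t p => F t p ^+ n).
Proof. by move=> /smF_sm sF; apply/smF_sm => i; exact: (sm_exp n (sF i)). Qed.

Lemma smF_inv F : smF N F -> (forall t p, N p -> F t p != 0) -> smF N (fun t p => (F t p)^-1).
Proof.
move=> /smF_sm sF F0; apply/smF_sm => i; apply: (sm_inv (sF i)).
by move=> -[t x] [_ /= /cim_dom[_ Nx _]]; exact: F0.
Qed.

Lemma smF_bump k F : smF N F -> smF N (fun t p => bumpE k (F t p)).
Proof. by move=> /smF_sm sF; apply/smF_sm => i; exact: (sm_bump k (sF i)). Qed.

Lemma smF_sum (J : Type) (r : seq J) (P : pred J) (F : J -> R -> M -> R) :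
  (forall j, smF N (F j)) -> smF N (fun t p => \sum_(j <- r | P j) F j t p).
Proof.
move=> sF; apply/smF_sm => i.
apply: (@sm_sum R _ _ _ r P (fun j (tx : R * 'rV[R]_7) => F j tx.1 (chart_inv i tx.2))) => j.
by move/smF_sm: (sF j); exact.
Qed.

Lemma smF_prod (J : Type) (r : seq J) (P : pred J) (F : J -> R -> M -> R) :
  (forall j, smF N (F j)) -> smF N (fun t p => \prod_(j <- r | P j) F j t p).
Proof.
move=> sF; apply/smF_sm => i.
apply: (@sm_prod R _ _ _ r P (fun j (tx : R * 'rV[R]_7) => F j tx.1 (chart_inv i tx.2))) => j.
by move/smF_sm: (sF j); exact.
Qed.

Lemma smF_invmx n (A : R -> M -> 'M[R]_n) : (forall a b, smF N (fun t p => A t p a b)) ->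
  (forall t p, N p -> A t p \in unitmx) ->
  forall a b, smF N (fun t p => invmx (A t p) a b).
Proof.
move=> sA uA a b; apply/smF_sm => i.
apply: (@sm_invmx R _ _ _ (fun tx : R * 'rV[R]_7 => A tx.1 (chart_inv i tx.2))).
  by move=> k l; move/smF_sm: (sA k l); exact.
by move=> -[t x] [_ /= /cim_dom[_ Nx _]]; exact: uA.
Qed.

Lemma smF_slice F t : smF N F -> smF N (fun _ => F t).
Proof.
move=> sF; apply/smF_sm => i.
apply: (sm_comp_snd (V := cim i N) (f := fun x => F t (chart_inv i x)) (cim_open i oN)); last by move=> x [].
exact: (@smooth_on_slice _ _ _ (fun tx : R * 'rV[R]_7 => F tx.1 (chart_inv i tx.2)) t (sF i)).
Qed.

Lemma pdE i a F t p : N p -> chart_dom i p ->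
  pd i a (F t) p = 'D_((0 : R), (delta_mx 0 a : 'rV[R]_7)) (fun tx : R * 'rV[R]_7 => F tx.1 (chart_inv i tx.2)) (t, chart i p).
Proof. by move=> Np dp; rewrite -derive_sndE. Qed.

Lemma smF_pd i a F : N `<=` chart_dom i -> smF N F -> smF N (fun t => pd i a (F t)).
Proof.
move=> Ni sF; apply: (smF_of_chart oN Ni).
apply: (smooth_on_eq (open_cimX i oN) (smooth_onD ((0 : R), (delta_mx 0 a : 'rV[R]_7)) (sF i))).
move=> -[t x] [_ /= /cim_dom[dx Nx xE]].
by rewrite pdE // xE.
Qed.

Lemma smF_is_derive F t p : smF N F -> N p ->
  is_derive t (1 : R) (fun s => F s p) ('D_(1 : R) (fun s => F s p) t).
Proof.
move=> sF Np; pose i := chart_at p; have dp : chart_dom i p by exact: chart_atP.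
have := @is_derive_fst _ _ _ (fun tx : R * 'rV[R]_7 => F tx.1 (chart_inv i tx.2)) t (chart i p) (sF i) (conj Logic.I (cim_chart dp Np)).
by rewrite /= chartK // => -[d _]; apply: DeriveDef.
Qed.

(** [schwarz] on R x R^7 for the directions (1, 0) and (0, e_a). *)
Lemma pd_dt i a F t p : smF N F -> N p -> chart_dom i p ->
  'D_(1 : R) (fun s => pd i a (F s) p) t = pd i a (fun q => 'D_(1 : R) (fun s => F s q) t) p.
Proof.
move=> sF Np dp.
pose Fi := fun tx : R * 'rV[R]_7 => F tx.1 (chart_inv i tx.2).
have sFi := sF i; rewrite -/Fi in sFi.
have cp := cim_chart dp Np.
have oC := open_cimX i oN.
have cp' : ([set: R] `*` cim i N) (t, chart i p) by split.
have -> : (fun s => pd i a (F s) p) = (fun s => 'D_((0 : R), (delta_mx 0 a : 'rV[R]_7)) Fi (s, chart i p)).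
  by apply/funext => s; rewrite pdE.
have [_ ->] := is_derive_fst (smooth_onD ((0 : R), (delta_mx 0 a : 'rV[R]_7)) sFi) cp'.
rewrite (schwarz _ _ oC sFi cp').
rewrite /pd -(derive_sndE ('D_((1 : R), (0 : 'rV[R]_7)) Fi)).
apply: near_eq_derive.
have n1 : \forall y \near chart i p, cim i N y by apply: open_nbhs_nbhs; split; [exact: cim_open|].
apply: filterS n1 => y cy.
by have [_ <-] := @is_derive_fst _ _ _ Fi t y sFi (conj Logic.I cy).
Qed.
End Closure.
End Manifold.

Section Pd.
Context {R : realType} (M : manifold R 7).
Notation I := (chart_index M).

(** A time-independent instance of [smF], so that one set of closure rules serves both fields and
    families of fields. *)
Definition smM (N : set M) (f : M -> R) : Prop := smF N (fun _ => f).

Lemma smM_smooth (N : set M) f i : open N -> smM N f -> smooth_on (cim i N) (f \o chart_inv i).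
Proof.
move=> oN sf.
exact: (@smooth_on_slice _ _ _ (fun tx : R * 'rV[R]_7 => f (chart_inv i tx.2)) 0 (sf i)).
Qed.

Global Arguments smM_smooth {N f} i _ _.

Lemma smooth_smM (N : set M) f i : open N -> N `<=` chart_dom i ->
  smooth_on (cim i N) (f \o chart_inv i) -> smM N f.
Proof.
move=> oN Ni sf; apply: (smF_of_chart oN Ni).
apply: sm_smooth_on; first exact: (open_cimX i oN).
apply: (sm_comp_snd (V := cim i N) (f := f \o chart_inv i)); [exact: cim_open|exact: sf|by move=> x []].
Qed.

Lemma smM_chart j b : smM (chart_dom j) (fun q => chart j q 0 b).
Proof.
apply: (smooth_smM (@dom_open _ _ M j) (@subset_refl _ _)).
apply: sm_smooth_on; first exact/cim_open/dom_open.
by apply: (sm_eq (sm_coord _ b)) => x /cim_dom [_ _ xE]; rewrite /= xE.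
Qed.

Global Arguments smM_chart j b : clear implicits.

Lemma smooth_in_smM j f : smooth_in j f -> smM (chart_dom j) f.
Proof.
move=> sf; apply: (smooth_smM (@dom_open _ _ M j) (@subset_refl _ _)).
by rewrite /cim setIid.
Qed.

Section At.
Variables (N : set M) (i : I) (p : M).
Hypotheses (oN : open N) (Np : N p) (dp : chart_dom i p).

Let cp : cim i N (chart i p) := cim_chart dp Np.

Lemma smM_derivable f v : smM N f -> derivable (f \o chart_inv i) (chart i p) v.
Proof. by move=> sf; exact: (smooth_on_derivable v (smM_smooth i oN sf) cp). Qed.

Arguments smM_derivable {f} v _.

Lemma near_cim : \forall y \near chart i p, cim i N y.
Proof. by apply: open_nbhs_nbhs; split; [exact: cim_open|exact: cp]. Qed.

Lemma pd_eq a f g : (forall q, N q -> f q = g q) -> pd i a f p = pd i a g p.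
Proof.
move=> fg; rewrite /pd; apply: near_eq_derive.
by apply: filterS near_cim => y /cim_dom [_ Ny _]; exact: fg.
Qed.

Lemma pdD a f g : smM N f -> smM N g ->
  pd i a (fun q => f q + g q) p = pd i a f p + pd i a g p.
Proof. by move=> sf sg; exact: (deriveD (smM_derivable _ sf) (smM_derivable _ sg)). Qed.

Lemma pdM a f g : smM N f -> smM N g ->
  pd i a (fun q => f q * g q) p = f p * pd i a g p + g p * pd i a f p.
Proof.
move=> sf sg; have := deriveM (smM_derivable (delta_mx 0 a) sf) (smM_derivable (delta_mx 0 a) sg).
by rewrite /= chartK.
Qed.

Lemma pd_cst a c : pd i a (fun _ => c) p = 0.
Proof. exact: derive_cst. Qed.

Lemma pdZ a c f : smM N f -> pd i a (fun q => c * f q) p = c * pd i a f p.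
Proof.
move=> sf; rewrite (pdM a (f := fun _ => c) (smF_cst oN c) sf) pd_cst mulr0.
exact: addr0.
Qed.

Lemma pd_sum (J : Type) (r : seq J) (P : pred J) a (f : J -> M -> R) :
  (forall j, smM N (f j)) ->
  pd i a (fun q => \sum_(j <- r | P j) f j q) p = \sum_(j <- r | P j) pd i a (f j) p.
Proof.
move=> sf; elim: r => [|j r ih].
  rewrite big_nil -[RHS](pd_cst a 0); apply: pd_eq => q _; exact: big_nil.
rewrite big_cons -ih; case Pj : (P j); last by apply: pd_eq => q _; rewrite big_cons Pj.
rewrite -pdD //; first by apply: pd_eq => q _; rewrite big_cons Pj.
exact: (smF_sum oN r P (F := fun j _ => f j) sf).
Qed.

Lemma smM_continuous f : smM N f -> {for p, continuous f}.
Proof.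
move=> sf; have cf := smooth_on_continuous (smM_smooth i oN sf) cp.
have c1 := @cvg_comp _ _ _ (chart i) (f \o chart_inv i) _ _ _ (chart_continuous dp) cf.
rewrite /prop_for /continuous_at /= in c1 *; rewrite chartK // in c1.
apply: cvg_trans c1; apply: near_eq_cvg.
have : \forall q \near p, chart_dom i q by apply: open_nbhs_nbhs; split; [exact: dom_open|].
by apply: filterS => q dq /=; rewrite chartK.
Qed.

Lemma pd_is_derive_line a f : smM N f ->
  is_derive (0 : R) 1 (fun h : R => f (chart_inv i (h *: delta_mx 0 a + chart i p))) (pd i a f p).
Proof.
move=> sf; apply/(is_derive_lineP (f \o chart_inv i)).
exact: (DeriveDef (smM_derivable (delta_mx 0 a) sf) erefl).
Qed.

End At.

Lemma pd_comm (N : set M) i p a b f : open N -> N p -> chart_dom i p ->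
  smM N f -> pd i a (pd i b f) p = pd i b (pd i a f) p.
Proof.
move=> oN Np dp sf; have cp := cim_chart dp Np.
have n1 := near_cim oN Np dp.
have h c : {near chart i p, pd i c f \o chart_inv i =1 'D_(delta_mx 0 c) (f \o chart_inv i)}.
  by apply: filterS n1 => y /cim_dom [_ _ yE]; rewrite /= /pd yE.
rewrite [LHS]/pd (near_eq_derive _ (h b)) [RHS]/pd (near_eq_derive _ (h a)).
exact: (schwarz _ _ (cim_open i oN) (smM_smooth i oN sf) cp).
Qed.

(** [chain_rule] for the coordinate line of chart [i] seen in chart [j], whose velocity at [p] is
    row [a] of [jac i j p]. The composite agrees with [f] along the line only while the line stays
    in the domain of [j], hence the eventual equality near 0. *)
Lemma pd_chain (N : set M) i j p a f : open N -> N p -> chart_dom i p -> chart_dom j p ->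
  smM N f -> pd i a f p = \sum_b jac i j p a b * pd j b f p.
Proof.
move=> oN Np di dj sf.
have oj := @dom_open _ _ M j.
have := @chain_rule R 7 (f \o chart_inv j) (fun h : R => chart j (chart_inv i (h *: delta_mx 0 a + chart i p))) (\row_b jac i j p a b).
rewrite scale0r add0r chartK // => /(_ _ _ _)/wrap[].
- apply: filterS (near_cim oN Np dj) => y cy k.
  exact: (smooth_on_derivable _ (smM_smooth j oN sf) cy).
- move=> k; exact: (smooth_on_continuous (smooth_onD _ (smM_smooth j oN sf)) (cim_chart dj Np)).
- move=> k; rewrite !mxE.
  exact: (pd_is_derive_line oj dj di a (smM_chart j k)).
move=> d1.
have d2 := pd_is_derive_line oN Np di a sf.
have n1 : \forall h \near (0 : R), cim i (chart_dom j) (h *: delta_mx 0 a + chart i p).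
  have c : h *: delta_mx 0 a + chart i p @[h --> (0 : R)] --> (chart i p : 'rV[R]_7).
    have := @cvgD _ _ _ (nbhs (0 : R)) _ (fun h : R => h *: (delta_mx 0 a : 'rV[R]_7)) (fun _ => chart i p) (0 *: delta_mx 0 a) (chart i p).
    rewrite scale0r add0r; apply; last exact: cvg_cst.
    by rewrite -[X in _ --> X](scale0r (delta_mx 0 a)); apply: cvgZr_tmp; exact: cvg_id.
  by apply: c; apply: open_nbhs_nbhs; split; [exact: cim_open|exact: cim_chart].
have d3 : is_derive (0 : R) 1 ((f \o chart_inv j) \o (fun h : R => chart j (chart_inv i (h *: delta_mx 0 a + chart i p)))) (pd i a f p).
  apply: near_eq_is_derive d2; apply: filterS n1 => h /cim_dom [_ dj' _] /=.
  by rewrite chartK.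
have [_ <-] := d3; have [_ ->] := d1.
by apply: eq_bigr => b _; rewrite mxE.
Qed.

Lemma jac_cocycle (i j k : I) p : chart_dom i p -> chart_dom j p -> chart_dom k p ->
  jac i j p *m jac j k p = jac i k p.
Proof.
move=> di dj dk; apply/matrixP => a b; rewrite !mxE.
have ok := @dom_open _ _ M k.
rewrite (pd_chain a ok dk di dj (smM_chart k b)); apply: eq_bigr => c _.
by rewrite !mxE.
Qed.

Lemma smM_jac (i j : I) a b : smM (chart_dom i `&` chart_dom j) (fun q => jac i j q a b).
Proof.
have oij : open (chart_dom i `&` chart_dom j) by apply: openI; exact: dom_open.
have h := @smF_pd _ _ _ oij i a _ (@subIsetl _ _ _) (smFS (@subIsetr _ (chart_dom i) _) (smM_chart j b)).
by apply: (smF_eq oij h) => t p _; rewrite mxE.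
Qed.

Global Arguments smM_jac i j a b : clear implicits.

End Pd.

(** * Tensor and octonion algebra *)

Section Tuples.
Context {R : realType}.

Lemma sum_tuple0 (I : finType) (F : 0.-tuple I -> R) : \sum_t F t = F [tuple].
Proof.
rewrite (eq_bigr (fun _ => F [tuple])) => [|t _]; last by rewrite tuple0.
by rewrite sumr_const card_tuple expn0.
Qed.

Lemma sum_tupleS (I : finType) k (F : k.+1.-tuple I -> R) :
  \sum_t F t = \sum_a \sum_(t : k.-tuple I) F [tuple of a :: t].
Proof.
rewrite pair_bigA /= (reindex (fun p : I * k.-tuple I => [tuple of p.1 :: p.2])) //=.
exists (fun t => (thead t, [tuple of behead t])) => [[a t] _|t _] /=.
  by congr pair; apply/val_inj.
by rewrite -tuple_eta.
Qed.

Lemma sum_tuple2 (I : finType) (F : 2.-tuple I -> R) :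
  \sum_t F t = \sum_a \sum_b F [tuple a; b].
Proof.
rewrite sum_tupleS; apply: eq_bigr => a _; rewrite sum_tupleS; apply: eq_bigr => b _.
by rewrite sum_tuple0; congr F; apply/val_inj.
Qed.

Lemma sum_tuple3 (I : finType) (F : 3.-tuple I -> R) :
  \sum_t F t = \sum_a \sum_b \sum_c F [tuple a; b; c].
Proof.
rewrite sum_tupleS; apply: eq_bigr => a _; rewrite sum_tuple2; apply: eq_bigr => b _.
by apply: eq_bigr => c _; congr F; apply/val_inj.
Qed.
End Tuples.

Section Algebra.
Context {R : realType}.
Implicit Types (g : tensor R 2) (w : tensor R 3) (u v x : 'rV[R]_7) (J : 'M[R]_7).

Lemma pullback2 J g a b :
  pullback J g [tuple a; b] = \sum_c \sum_d J a c * g [tuple c; d] * J b d.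
Proof.
rewrite /pullback sum_tuple2; apply: eq_bigr => c _; apply: eq_bigr => d _.
by rewrite !big_ord_recl big_ord0 /= !(tnth_nth a) /= mulr1 mulrA [g _ * _]mulrC.
Qed.

Lemma gram_pullback J g : gram (pullback J g) = J *m gram g *m J^T.
Proof.
apply/matrixP => a b; rewrite !mxE pullback2 exchange_big /=; apply: eq_bigr => d _.
by rewrite !mxE big_distrl /=; apply: eq_bigr => c _; rewrite !mxE.
Qed.

Lemma pullback3 J w a b c :
  pullback J w [tuple a; b; c] =
  \sum_i \sum_j \sum_k w [tuple i; j; k] * (J a i * J b j * J c k).
Proof.
rewrite /pullback sum_tuple3; apply: eq_bigr => i _; apply: eq_bigr => j _; apply: eq_bigr => k _.
by rewrite !big_ord_recl big_ord0 /= !(tnth_nth a) /= mulr1 !mulrA.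
Qed.

(** Exchanging the outer arguments exchanges columns 0 and 2 of the determinant. *)
Lemma eform_swap (x y z : nat) (a b c : 'I_7) :
  eform [:: x; y; z] [tuple a; b; c] = - eform [:: x; y; z] [tuple c; b; a] :> R.
Proof.
rewrite /eform.
set M1 := matrix_of_fun _ _; set M2 := matrix_of_fun _ _.
have -> : M1 = xcol (0 : 'I_3) (2 : 'I_3) M2.
  apply/matrixP => i j; rewrite !mxE; congr ((_ == _)%:R); congr S; congr nat_of_ord.
  case: j => -[|[|[|//]]] lj.
  - rewrite [Ordinal lj](_ : _ = (0 : 'I_3)); last exact/val_inj.
    by rewrite tpermL.
  - rewrite tpermD; [|by rewrite -val_eqE|by rewrite -val_eqE].
    by rewrite !(tnth_nth a).
  - rewrite [Ordinal lj](_ : _ = (2 : 'I_3)); last exact/val_inj.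
    by rewrite tpermR.
by rewrite xcolE det_mulmx /tperm_mx det_perm odd_tperm /= expr1 mulrN1.
Qed.

Lemma phi0_swap (a b c : 'I_7) : phi0 [tuple a; b; c] = - phi0 [tuple c; b; a] :> R.
Proof.
rewrite /phi0 (eform_swap 1 2 3) (eform_swap 1 4 5) (eform_swap 1 6 7) (eform_swap 2 4 6)
  (eform_swap 2 5 7) (eform_swap 3 4 7) (eform_swap 3 5 6).
by rewrite !opprD !opprK.
Qed.

(** Antisymmetry in the outer slots is the form suited to right multiplication: the torsion vector
    sits in the middle slot, between the two octonions being paired. *)
Lemma positive3_swap w (a b c : 'I_7) : positive3 w -> w [tuple a; b; c] = - w [tuple c; b; a].
Proof.
move=> [J _ ->]; rewrite !pullback3.
transitivity (\sum_i \sum_j \sum_k - (phi0 [tuple k; j; i] * (J c k * J b j * J a i))).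
  apply: eq_bigr => i _; apply: eq_bigr => j _; apply: eq_bigr => k _.
  by rewrite phi0_swap; ring.
rewrite exchange_big /=.
under eq_bigr do rewrite exchange_big /=.
rewrite exchange_big /= -sumrN; apply: eq_bigr => i _.
by rewrite -sumrN; apply: eq_bigr => j _; rewrite -sumrN.
Qed.

(** The cross product before its index is raised, that is the covector phi(u, v, .); the metric then
    enters through one matrix factor only. *)
Definition phi3 w u v : 'rV[R]_7 := \row_d \sum_a \sum_b w [tuple a; b; d] * u 0 a * v 0 b.

Lemma ipE g u v : ip g u v = (u *m gram g *m v^T) 0 0.
Proof.
rewrite /ip exchange_big mxE /=; apply: eq_bigr => b _.
rewrite !mxE big_distrl /=; apply: eq_bigr => a _.
by rewrite !mxE [g _ * _]mulrC.
Qed.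

Lemma crossE g w u v : cross g w u v = phi3 w u v *m (invmx (gram g))^T.
Proof.
apply/rowP => c; rewrite !mxE.
transitivity (\sum_a \sum_d \sum_b invmx (gram g) c d * w [tuple a; b; d] * u 0 a * v 0 b).
  by apply: eq_bigr => a _; rewrite exchange_big.
rewrite exchange_big /=; apply: eq_bigr => d _; rewrite !mxE big_distrl /=.
apply: eq_bigr => a _; rewrite big_distrl /=; apply: eq_bigr => b _.
by ring.
Qed.

Section Metric.
Variable g : tensor R 2.
Hypothesis gsym : (gram g)^T = gram g.
Hypothesis gpos : forall u, u != 0 -> 0 < ip g u u.

Lemma gram_unit : gram g \in unitmx.
Proof.
rewrite unitmxE unitfE; apply/negP => /det0P[u u0 uG].
by have := gpos u0; rewrite ipE uG mul0mx mxE ltxx.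
Qed.

Lemma ipC u v : ip g u v = ip g v u.
Proof. by rewrite !ipE -[in LHS]gsym -[in LHS](trmxK u) -!trmx_mul mxE mulmxA. Qed.

Lemma invgram_sym : (invmx (gram g))^T = invmx (gram g).
Proof. by rewrite trmx_inv gsym. Qed.

Lemma ip_cross w u v x : ip g (cross g w u v) x = (phi3 w u v *m x^T) 0 0.
Proof. by rewrite ipE crossE invgram_sym mulmxKV // gram_unit. Qed.

End Metric.

Lemma ipDl g u v x : ip g (u + v) x = ip g u x + ip g v x.
Proof. by rewrite !ipE !mulmxDl mxE. Qed.
Lemma ipDr g u v x : ip g x (u + v) = ip g x u + ip g x v.
Proof. by rewrite !ipE linearD mulmxDr mxE. Qed.
Lemma ipZl g c u x : ip g (c *: u) x = c * ip g u x.
Proof. by rewrite !ipE -!scalemxAl mxE. Qed.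
Lemma ipZr g c u x : ip g x (c *: u) = c * ip g x u.
Proof. by rewrite !ipE linearZ /= -scalemxAr mxE. Qed.
Lemma phi3_swap w u v x : (forall a b c, w [tuple a; b; c] = - w [tuple c; b; a]) ->
  (phi3 w u v *m x^T) 0 0 = - (phi3 w x v *m u^T) 0 0.
Proof.
move=> wS; rewrite !mxE -sumrN.
transitivity (\sum_c \sum_a \sum_b w [tuple a; b; c] * u 0 a * v 0 b * x 0 c).
  apply: eq_bigr => c _; rewrite !mxE big_distrl /=; apply: eq_bigr => a _.
  by rewrite big_distrl.
rewrite exchange_big /=; apply: eq_bigr => a _; rewrite !mxE big_distrl /= -sumrN.
apply: eq_bigr => c _; rewrite big_distrl /= -sumrN; apply: eq_bigr => b _.
by rewrite wS !mulNr; congr (- _); ring.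
Qed.

(** The products of a scalar part with a vector part cancel between the two summands, and the triple
    products cancel by antisymmetry of the 3-form in its outer slots. *)
Lemma oip_torsion g w (A B : oct R) x : (gram g)^T = gram g ->
  (forall u, u != 0 -> 0 < ip g u u) ->
  (forall a b c, w [tuple a; b; c] = - w [tuple c; b; a]) ->
  oip g (omul g w A (0, x)) B + oip g A (omul g w B (0, x)) = 0.
Proof.
move=> gs gp wS; rewrite /oip /omul /= !mulr0 !sub0r !scale0r !addr0.
rewrite !(ipDl, ipDr, ipZl, ipZr) (ipC gs A.2 (cross _ _ _ _)) !(ip_cross gs gp).
rewrite (phi3_swap A.2 x B.2 wS) (ipC gs B.2 x); ring.
Qed.

End Algebra.

Section OctAlgebra.
Context {R : realType}.
Implicit Types (g : tensor R 2) (w : tensor R 3) (u v x : 'rV[R]_7) (J : 'M[R]_7) (A B C : oct R).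

Lemma oipDl g A B C : oip g (A + B) C = oip g A C + oip g B C.
Proof. by rewrite /oip ipDl /= mulrDl addrACA. Qed.
Lemma oipDr g A B C : oip g C (A + B) = oip g C A + oip g C B.
Proof. by rewrite /oip ipDr /= mulrDr addrACA. Qed.
Lemma oipZl g c A C : oip g (c *: A) C = c * oip g A C.
Proof. by rewrite /oip ipZl /= mulrDr mulrA. Qed.
Lemma oipZr g c A C : oip g C (c *: A) = c * oip g C A.
Proof. by rewrite /oip ipZr /= mulrDr mulrCA. Qed.
Lemma oipNl g A C : oip g (- A) C = - oip g A C.
Proof. by rewrite -scaleN1r oipZl mulN1r. Qed.
Lemma oipNr g A C : oip g C (- A) = - oip g C A.
Proof. by rewrite -scaleN1r oipZr mulN1r. Qed.
Lemma oip0l g A : oip g 0 A = 0.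
Proof. by rewrite -[0](scale0r 0) oipZl mul0r. Qed.
Lemma oip_suml g (K : Type) (r : seq K) (P : pred K) (F : K -> oct R) C :
  oip g (\sum_(k <- r | P k) F k) C = \sum_(k <- r | P k) oip g (F k) C.
Proof.
elim: r => [|k r ih]; first by rewrite !big_nil oip0l.
by rewrite !big_cons; case: (P k); rewrite // oipDl ih.
Qed.
Lemma oipC g A B : (gram g)^T = gram g -> oip g A B = oip g B A.
Proof. by move=> gs; rewrite /oip mulrC (ipC gs). Qed.

(** The change of frame in [oct_compatible] as an operation on octonions: the scalar part is
    invariant, the vector part is multiplied by the Jacobian. *)
Definition octmap J A : oct R := (A.1, A.2 *m J).

Lemma octmapD J A B : octmap J (A + B) = octmap J A + octmap J B.
Proof. by congr pair; rewrite /= mulmxDl. Qed.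
Lemma octmapN J A : octmap J (- A) = - octmap J A.
Proof. by congr pair; rewrite /= mulNmx. Qed.
Lemma octmapZ J c A : octmap J (c *: A) = c *: octmap J A.
Proof. by congr pair; rewrite /= scalemxAl. Qed.

Lemma ip_pullback J g u v : ip (pullback J g) u v = ip g (u *m J) (v *m J).
Proof. by rewrite !ipE gram_pullback trmx_mul !mulmxA. Qed.

Lemma oip_pullback J g A B : oip (pullback J g) A B = oip g (octmap J A) (octmap J B).
Proof. by rewrite /oip ip_pullback. Qed.

(** Fixing the last index turns the 3-form into a family of bilinear forms, so that pullbacks reduce
    to matrix products. *)
Definition phi3mx w (d : 'I_7) : 'M[R]_7 := \matrix_(a, b) w [tuple a; b; d].

Lemma phi3E w u v d : phi3 w u v 0 d = (u *m phi3mx w d *m v^T) 0 0.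
Proof.
rewrite !mxE exchange_big /=; apply: eq_bigr => b _; rewrite !mxE big_distrl /=.
by apply: eq_bigr => a _; rewrite !mxE [w _ * _]mulrC.
Qed.

Lemma phi3mx_pullback J w d :
  phi3mx (pullback J w) d = \sum_k J d k *: (J *m phi3mx w k *m J^T).
Proof.
apply/matrixP => a b; rewrite summxE !mxE pullback3.
transitivity (\sum_k \sum_j \sum_i w [tuple i; j; k] * (J a i * J b j * J d k)).
  rewrite exchange_big /= [RHS]exchange_big /=; apply: eq_bigr => j _.
  by rewrite exchange_big.
apply: eq_bigr => k _; rewrite !mxE big_distrr /=; apply: eq_bigr => j _.
rewrite !mxE big_distrl big_distrr /=; apply: eq_bigr => i _; rewrite !mxE; ring.
Qed.

Lemma phi3_pullback J w u v :
  phi3 (pullback J w) u v = phi3 w (u *m J) (v *m J) *m J^T.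
Proof.
apply/rowP => d; rewrite phi3E phi3mx_pullback mulmx_sumr mulmx_suml summxE mxE.
apply: eq_bigr => k _; rewrite -scalemxAr -scalemxAl mxE phi3E [J^T _ _]mxE mulrC.
by rewrite trmx_mul !mulmxA.
Qed.

(** The covector [phi3] acquires the factor [J^T], which cancels the inverse transpose coming from
    the inverse Gram matrix. What remains is one inverse of [J], absorbed by the right
    multiplication by [J]. *)
Lemma cross_pullback J g w u v : J \in unitmx -> gram g \in unitmx ->
  cross (pullback J g) (pullback J w) u v *m J = cross g w (u *m J) (v *m J).
Proof.
move=> uJ ug; rewrite !crossE phi3_pullback gram_pullback.
have uJT : J^T \in unitmx by rewrite unitmx_tr.
have E : J *m gram g *m J^T *m (invmx J^T *m (invmx (gram g) *m invmx J)) = 1%:M.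
  by rewrite !mulmxA mulmxK // mulmxK // mulmxV.
have uG : J *m gram g *m J^T \in unitmx by rewrite !unitmx_mul uJ ug uJT.
have -> : invmx (J *m gram g *m J^T) = invmx J^T *m (invmx (gram g) *m invmx J).
  by rewrite -[LHS]mulmx1 -E [LHS]mulmxA (mulVmx uG) mul1mx.
rewrite -!mulmxA; congr (_ *m _).
by rewrite !trmx_mul !trmx_inv trmxK -!mulmxA mulVmx // mulmx1 mulmxA mulmxV // mul1mx.
Qed.

Lemma omul_pullback J g w A B : J \in unitmx -> gram g \in unitmx ->
  octmap J (omul (pullback J g) (pullback J w) A B) = omul g w (octmap J A) (octmap J B).
Proof.
move=> uJ ug; rewrite /octmap /omul /= ip_pullback; congr pair.
by rewrite !mulmxDl !scalemxAl cross_pullback.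
Qed.

(* Christoffel symbols of the first kind: [lowchr dG a] has [(c, e)] entry [Gamma_{e,ac}]. *)
Definition lowchr (dG : 'I_7 -> 'M[R]_7) (a : 'I_7) : 'M[R]_7 :=
  \matrix_(c, e) (2%:R^-1 * (dG a c e + dG c a e - dG e a c)).

(** The last two terms of [lowchr] are antisymmetric in its matrix indices, so symmetrization leaves
    the derivative of the metric. *)
Lemma lowchr_compat dG a : (forall b, (dG b)^T = dG b) ->
  lowchr dG a + (lowchr dG a)^T = dG a.
Proof.
move=> dS; have S b c e : dG b c e = dG b e c by rewrite -{1}(dS b) mxE.
apply/matrixP => c e; rewrite !mxE (S a e c).
have -> : 2%:R^-1 * (dG a c e + dG c a e - dG e a c) + 2%:R^-1 * (dG a c e + dG e a c - dG c a e) = dG a c e.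
  by field.
by [].
Qed.

(** The transformation law of the symbols of the first kind, with its second-derivative term. Each
    [dG] splits into a tensorial part [K] and two copies of the second-derivative part [H]. Since
    [H] is symmetric in its first two indices, by symmetry of second derivatives, the six copies of
    [H] in the Christoffel combination reduce to twice [H a c d]. *)
Lemma lowchr_transf (dG dG' dJ : 'I_7 -> 'M[R]_7) (G' J : 'M[R]_7) a :
  G'^T = G' -> (forall a c e, dJ a c e = dJ c a e) ->
  (forall a, dG a = dJ a *m G' *m J^T + J *m (\sum_h J a h *: dG' h) *m J^T + J *m G' *m (dJ a)^T) ->
  lowchr dG a = dJ a *m G' *m J^T + J *m (\sum_h J a h *: lowchr dG' h) *m J^T.
Proof.
move=> GS dJS dGE.
pose H a c d := (dJ a *m G' *m J^T) c d.
have HS b c d : H b c d = H c b d.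
  rewrite /H !mxE; apply: eq_bigr => f _; congr (_ * _).
  by rewrite !mxE; apply: eq_bigr => e _; rewrite dJS.
pose K a c d := \sum_h \sum_f \sum_e J a h * (J c e * dG' h e f * J d f).
have KE b c d : (J *m (\sum_h J b h *: dG' h) *m J^T) c d = K b c d.
  rewrite mulmx_sumr mulmx_suml summxE; apply: eq_bigr => h _.
  rewrite -scalemxAr -scalemxAl mxE mxE big_distrr /=; apply: eq_bigr => f _.
  rewrite !mxE big_distrl big_distrr /=; apply: eq_bigr => e _; ring.
have dGH b c d : dG b c d = H b c d + K b c d + H b d c.
  have tr : J *m G' *m (dJ b)^T = (dJ b *m G' *m J^T)^T.
    by rewrite !trmx_mul trmxK GS mulmxA.
  rewrite dGE mxE mxE; congr (_ + _ + _); first exact: KE.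
  by rewrite tr mxE.
apply/matrixP => c d; rewrite !mxE !dGH.
transitivity (H a c d + 2%:R^-1 * (K a c d + K c a d - K d a c)).
  rewrite (HS d a c) (HS d c a) (HS c a d).
  by field.
congr (_ + _); first by rewrite /H mxE.
transitivity (\sum_h \sum_f \sum_e J a h * (J c e * lowchr dG' h e f * J d f)); last first.
  have -> : \sum_j (J *m (\sum_h J a h *: lowchr dG' h)) c j * J^T j d = (J *m (\sum_h J a h *: lowchr dG' h) *m J^T) c d by rewrite [RHS]mxE.
  rewrite mulmx_sumr mulmx_suml summxE; apply: eq_bigr => h _.
  rewrite -scalemxAr -scalemxAl mxE mxE big_distrr /=; apply: eq_bigr => f _.
  rewrite !mxE big_distrl big_distrr /=; apply: eq_bigr => e _; rewrite !mxE; ring.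
have K2 : K c a d = \sum_h \sum_f \sum_e J a h * (J c e * dG' e h f * J d f).
  rewrite /K exchange_big /= [RHS]exchange_big /=; apply: eq_bigr => f _.
  rewrite exchange_big /=; apply: eq_bigr => h _; apply: eq_bigr => e _; ring.
have K3 : K d a c = \sum_h \sum_f \sum_e J a h * (J c e * dG' f h e * J d f).
  rewrite /K; under eq_bigr do rewrite exchange_big /=.
  rewrite exchange_big /=; apply: eq_bigr => h _.
  apply: eq_bigr => f _; apply: eq_bigr => e _; ring.
rewrite K2 K3 /K -big_split -sumrB mulr_sumr /=; apply: eq_bigr => h _.
rewrite -big_split -sumrB mulr_sumr /=; apply: eq_bigr => f _.
rewrite -big_split -sumrB mulr_sumr /=; apply: eq_bigr => e _.
rewrite mxE; ring.
Qed.

End OctAlgebra.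

(** * Metric compatibility of the octonion derivative *)

Section Geometry.
Context {R : realType} (M : manifold R 7).
Notation I := (chart_index M).

Definition smO (N : set M) (B : R -> M -> oct R) : Prop :=
  smF N (fun t q => (B t q).1) /\ forall b, smF N (fun t q => (B t q).2 0 b).

Lemma smOS (N N' : set M) B : N' `<=` N -> smO N B -> smO N' B.
Proof. by move=> NN [s1 s2]; split=> [|b]; [exact: smFS NN s1|exact: smFS NN (s2 b)]. Qed.

Lemma smO_eq (N : set M) B C : open N -> smO N B -> (forall t q, N q -> B t q = C t q) -> smO N C.
Proof.
move=> oN [s1 s2] BC; split=> [|b].
  by apply: (smF_eq oN s1) => t q Nq; rewrite BC.
by apply: (smF_eq oN (s2 b)) => t q Nq; rewrite BC.
Qed.

Lemma smO_slice (N : set M) B t : open N -> smO N B -> smO N (fun _ => B t).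
Proof.
move=> oN [s1 s2]; split=> [|b]; first exact: (@smF_slice R M N oN (fun t q => (B t q).1) t s1).
exact: (@smF_slice R M N oN (fun t q => (B t q).2 0 b) t (s2 b)).
Qed.

Lemma smO_add (N : set M) B C : open N -> smO N B -> smO N C -> smO N (fun t q => B t q + C t q).
Proof.
move=> oN [s1 s2] [r1 r2]; split=> [|b]; first exact: (smF_add oN s1 r1).
by apply: (smF_eq oN (smF_add oN (s2 b) (r2 b))) => t q _; rewrite mxE.
Qed.

Lemma smO_scale (N : set M) f B : open N -> smF N f -> smO N B -> smO N (fun t q => f t q *: B t q).
Proof.
move=> oN sf [s1 s2]; split=> [|b]; first exact: (smF_mul oN sf s1).
by apply: (smF_eq oN (smF_mul oN sf (s2 b))) => t q _; rewrite mxE.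
Qed.

Lemma smO_opp (N : set M) B : open N -> smO N B -> smO N (fun t q => - B t q).
Proof.
move=> oN sB; apply: (smO_eq oN (smO_scale oN (smF_cst oN (-1)) sB)) => t q _.
exact: scaleN1r.
Qed.

Lemma smO_sub (N : set M) B C : open N -> smO N B -> smO N C -> smO N (fun t q => B t q - C t q).
Proof. by move=> oN sB sC; exact: (smO_add oN sB (smO_opp oN sC)). Qed.

Lemma smO_sum (N : set M) (J : Type) (r : seq J) (F : J -> R -> M -> oct R) : open N ->
  (forall j, smO N (F j)) -> smO N (fun t q => \sum_(j <- r) F j t q).
Proof.
move=> oN sF; elim: r => [|j r ih].
  apply: (smO_eq (B := fun _ _ => 0) oN) => [|t q _]; last by rewrite big_nil.
  split=> [|b]; first exact: (smF_cst oN 0).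
  by apply: (smF_eq oN (smF_cst oN 0)) => t q _; rewrite mxE.
by apply: (smO_eq oN (smO_add oN (sF j) ih)) => t q _; rewrite big_cons.
Qed.

(** [geom_swap] is the skewness that [oip_torsion] consumes. The three [tensor_field] components
    supply smoothness in each chart as well as the transformation laws behind the change of
    charts. *)
Record geometry (phi : tfield M 3) (g T : tfield M 2) : Prop := Geometry {
  geom_metric : tensor_field g;
  geom_sym : forall i p, chart_dom i p -> (gram (g i p))^T = gram (g i p);
  geom_pos : forall i p, chart_dom i p -> forall u, u != 0 -> 0 < ip (g i p) u u;
  geom_phi : tensor_field phi;
  geom_swap : forall i p, chart_dom i p ->
    forall a b c, phi i p [tuple a; b; c] = - phi i p [tuple c; b; a];
  geom_torsion : tensor_field T
}.

Variables (phi : tfield M 3) (g T : tfield M 2).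
Hypothesis gm : geometry phi g T.

Let tg : tensor_field g := geom_metric gm.
Let tphi : tensor_field phi := geom_phi gm.
Let tT : tensor_field T := geom_torsion gm.

Lemma geom_unit i p : chart_dom i p -> gram (g i p) \in unitmx.
Proof. by move=> dp; exact: (gram_unit (geom_pos gm dp)). Qed.

Lemma smM_tensor k (F : tfield M k) i s : tensor_field F -> smM (chart_dom i) (fun q => F i q s).
Proof. by move=> [sF _]; exact/smooth_in_smM/sF. Qed.

Global Arguments smM_tensor {k F} i s _.

Section InChart.
Variables (N : set M) (i : I).
Hypotheses (oN : open N) (Ni : N `<=` chart_dom i).

Lemma smN k (F : tfield M k) s : tensor_field F -> smF N (fun _ q => F i q s).
Proof. by move=> tF; exact: (smFS Ni (smM_tensor i s tF)). Qed.

Global Arguments smN {k F} s _.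

Lemma sm_invgram a b : smF N (fun _ q => invmx (gram (g i q)) a b).
Proof.
apply: (@smF_invmx _ _ _ oN 7 (fun _ q => gram (g i q))).
  by move=> c d; apply: (smF_eq oN (smN [tuple c; d] tg)) => t q _; rewrite mxE.
by move=> _ q /Ni; exact: geom_unit.
Qed.

Arguments sm_invgram a b : clear implicits.

Lemma sm_pd (F : R -> M -> R) a : smF N F -> smF N (fun t q => pd i a (F t) q).
Proof. by move=> sF; exact: (@smF_pd R M N oN i a F Ni sF). Qed.

Lemma sm_chr c a b : smF N (fun _ q => christoffel g i q c a b).
Proof.
apply: (smF_mul oN (smF_cst oN _)); apply: (smF_sum oN) => d.
apply: (smF_mul oN (sm_invgram c d)).
have s1 e := @sm_pd (fun _ q => g i q e) _ (smN e tg).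
exact: (smF_sub oN (smF_add oN (s1 _ _) (s1 _ _)) (s1 _ _)).
Qed.

Arguments sm_chr c a b : clear implicits.

Lemma sm_ip (u v : R -> M -> 'rV[R]_7) : (forall b, smF N (fun t q => u t q 0 b)) ->
  (forall b, smF N (fun t q => v t q 0 b)) -> smF N (fun t q => ip (g i q) (u t q) (v t q)).
Proof.
move=> su sv; apply: (smF_sum oN) => a; apply: (smF_sum oN) => b.
by apply: (smF_mul oN _ (sv b)); apply: (smF_mul oN _ (su a)); exact: smN.
Qed.

Lemma sm_oip (A B : R -> M -> oct R) : smO N A -> smO N B ->
  smF N (fun t q => oip (g i q) (A t q) (B t q)).
Proof.
move=> [a1 a2] [b1 b2]; apply: (smF_add oN (smF_mul oN a1 b1)).
exact: (sm_ip a2 b2).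
Qed.

Lemma sm_omul (A B : R -> M -> oct R) : smO N A -> smO N B ->
  smO N (fun t q => omul (g i q) (phi i q) (A t q) (B t q)).
Proof.
move=> [a1 a2] [b1 b2]; split=> [|c].
  exact: (smF_sub oN (smF_mul oN a1 b1) (sm_ip a2 b2)).
have sc : smF N (fun t q => cross (g i q) (phi i q) (A t q).2 (B t q).2 0 c).
  apply: (smF_eq (F := fun t q => \sum_a \sum_b \sum_d invmx (gram (g i q)) c d *
     phi i q [tuple a; b; d] * (A t q).2 0 a * (B t q).2 0 b) oN) => [|t q _]; last by rewrite mxE.
  apply: (smF_sum oN) => a; apply: (smF_sum oN) => b; apply: (smF_sum oN) => d.
  apply: (smF_mul oN _ (b2 b)); apply: (smF_mul oN _ (a2 a)).
  by apply: (smF_mul oN (sm_invgram c d)); exact: smN.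
apply: (smF_eq oN (smF_add oN (smF_add oN (smF_mul oN a1 (b2 c)) (smF_mul oN b1 (a2 c))) sc)) => t q _.
by rewrite !mxE.
Qed.

Lemma sm_nablaO (A : R -> ofield M) a : smO N (fun t q => A t i q) ->
  smO N (fun t q => nablaO g (A t) i q a).
Proof.
move=> [a1 a2]; split=> [|b]; first exact: (@sm_pd (fun t q => (A t i q).1) a a1).
apply: (smF_eq (F := fun t q => pd i a (fun q => (A t i q).2 0 b) q
           + \sum_c christoffel g i q b a c * (A t i q).2 0 c) oN) => [|t q _]; last by rewrite mxE.
apply: (smF_add oN (@sm_pd (fun t q => (A t i q).2 0 b) a (a2 b))); apply: (smF_sum oN) => c.
exact: (smF_mul oN (sm_chr b a c) (a2 c)).
Qed.

Lemma sm_torsion a : smO N (fun _ q => torsion_oct g T i q a).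
Proof.
split=> [|b]; first exact: (smF_cst oN 0).
apply: (smF_eq (F := fun _ q => \sum_c T i q [tuple a; c] * invmx (gram (g i q)) c b) oN) => [|t q _]; last by rewrite mxE.
apply: (smF_sum oN) => c; apply: (smF_mul oN _ (sm_invgram c b)); exact: smN.
Qed.

Lemma sm_octD (A : R -> ofield M) a : smO N (fun t q => A t i q) ->
  smO N (fun t q => octD phi g T (A t) i q a).
Proof.
move=> sA; apply: (smO_sub oN (sm_nablaO a sA)).
exact: (sm_omul sA (sm_torsion a)).
Qed.

Lemma sm_normsq (A : R -> ofield M) : smO N (fun t q => A t i q) ->
  smF N (fun t q => oform_normsq g (octD phi g T (A t)) i q).
Proof.
move=> sA; apply: (smF_sum oN) => a; apply: (smF_sum oN) => b.
exact: (smF_mul oN (sm_invgram a b) (sm_oip (sm_octD a sA) (sm_octD b sA))).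
Qed.

Lemma sm_octDform (A : R -> ofield M) a b : smO N (fun t q => A t i q) ->
  smO N (fun t q => octDform phi g T (octD phi g T (A t)) i q a b).
Proof.
move=> sA; have sD b' := sm_octD b' sA.
apply: (smO_sub oN); last exact: (sm_omul (sD b) (sm_torsion a)).
apply: (smO_sub oN).
  exact: (@sm_nablaO (fun t j q => octD phi g T (A t) j q b) a (sD b)).
apply: (smO_sum (F := fun c t q => christoffel g i q c a b *: octD phi g T (A t) i q c) _ oN) => c.
exact: (smO_scale oN (sm_chr c a b) (sD c)).
Qed.

Lemma sm_octDstar (A : R -> ofield M) : smO N (fun t q => A t i q) ->
  smO N (fun t q => octDstar phi g T (octD phi g T (A t)) i q).
Proof.
move=> sA; apply: (smO_opp oN).
apply: (smO_sum (F := fun a t q => \sum_b invmx (gram (g i q)) a b *: octDform phi g T (octD phi g T (A t)) i q a b) _ oN) => a.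
apply: (smO_sum (F := fun b t q => invmx (gram (g i q)) a b *: octDform phi g T (octD phi g T (A t)) i q a b) _ oN) => b.
exact: (smO_scale oN (sm_invgram a b) (sm_octDform a b sA)).
Qed.

End InChart.
End Geometry.

Section Identities.
Context {R : realType} (M : manifold R 7).
Notation I := (chart_index M).
Variables (phi : tfield M 3) (g T : tfield M 2).
Hypothesis gm : geometry phi g T.

Let tg : tensor_field g := geom_metric gm.

Definition dgram (i : I) (p : M) (a : 'I_7) : 'M[R]_7 :=
  \matrix_(c, d) pd i a (fun q => g i q [tuple c; d]) p.

Lemma dgramE i p a c d : dgram i p a c d = pd i a (fun q => g i q [tuple c; d]) p.
Proof. by rewrite mxE. Qed.

(** The indices are laid out so that the connection acts on row vectors by right multiplication, as
    in [nablaO2E]. *)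
Definition chrmx (i : I) (p : M) (a : 'I_7) : 'M[R]_7 :=
  \matrix_(c, b) christoffel g i p b a c.

Definition drow (i : I) (p : M) (a : 'I_7) (u : M -> 'rV[R]_7) : 'rV[R]_7 :=
  \row_b pd i a (fun q => u q 0 b) p.

Lemma nablaO2E A i p a :
  (nablaO g A i p a).2 = drow i p a (fun q => (A i q).2) + (A i p).2 *m chrmx i p a.
Proof.
apply/rowP => b; rewrite !mxE; congr (_ + _); apply: eq_bigr => c _.
by rewrite !mxE mulrC.
Qed.

Section At.
Variables (N : set M) (i : I) (p : M).
Hypotheses (oN : open N) (Ni : N `<=` chart_dom i) (Np : N p).

Let dp : chart_dom i p := Ni Np.

Lemma sm_g s : smM N (fun q => g i q s).
Proof. exact: (smN Ni s tg). Qed.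

Lemma dgram_sym a : (dgram i p a)^T = dgram i p a.
Proof.
apply/matrixP => c d; rewrite !mxE; apply: (pd_eq oN Np dp) => q Nq.
have /matrixP /(_ d c) := geom_sym gm (Ni Nq).
by rewrite !mxE.
Qed.

Lemma chrmxE a : chrmx i p a = lowchr (dgram i p) a *m invmx (gram (g i p)).
Proof.
rewrite -[invmx _](invgram_sym (geom_sym gm dp)); apply/matrixP => c b; rewrite mxE [RHS]mxE /christoffel mulr_sumr.
apply: eq_bigr => d _; rewrite [lowchr _ _ _ _]mxE !dgramE [_^T _ _]mxE [RHS]mulrC.
exact: mulrCA.
Qed.

Lemma chrmx_lower a : chrmx i p a *m gram (g i p) = lowchr (dgram i p) a.
Proof. by rewrite chrmxE mulmxKV // (geom_unit gm dp). Qed.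

(** The vanishing of the covariant derivative of [g], as a matrix identity: [lowchr_compat] with the
    indices raised back through [chrmx_lower]. *)
Lemma dgram_compat a :
  dgram i p a = chrmx i p a *m gram (g i p) + gram (g i p) *m (chrmx i p a)^T.
Proof.
rewrite -[RHS](_ : lowchr (dgram i p) a + (lowchr (dgram i p) a)^T = _).
  by rewrite lowchr_compat // => b; exact: dgram_sym.
by rewrite -chrmx_lower trmx_mul (geom_sym gm dp).
Qed.

Lemma chr_sym a b c : christoffel g i p c a b = christoffel g i p c b a.
Proof.
congr (_ * _); apply: eq_bigr => d _; congr (_ * _).
rewrite [X in X - _]addrC; congr (_ - _).
apply: (pd_eq oN Np dp) => q Nq.
have /matrixP /(_ a b) := geom_sym gm (Ni Nq).
by rewrite !mxE.
Qed.

Lemma pd_ip a (u v : M -> 'rV[R]_7) : (forall b, smM N (fun q => u q 0 b)) ->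
  (forall b, smM N (fun q => v q 0 b)) ->
  pd i a (fun q => ip (g i q) (u q) (v q)) p =
  ip (g i p) (drow i p a u + u p *m chrmx i p a) (v p) +
  ip (g i p) (u p) (drow i p a v + v p *m chrmx i p a).
Proof.
move=> su sv.
transitivity (ip (g i p) (drow i p a u) (v p) + ip (g i p) (u p) (drow i p a v) +
   (u p *m dgram i p a *m (v p)^T) 0 0); last first.
  rewrite ipDl ipDr dgram_compat mulmxDr mulmxDl [in LHS]mxE.
  have -> : (u p *m (chrmx i p a *m gram (g i p)) *m (v p)^T) 0 0 = ip (g i p) (u p *m chrmx i p a) (v p).
    by rewrite ipE !mulmxA.
  have -> : (u p *m (gram (g i p) *m (chrmx i p a)^T) *m (v p)^T) 0 0 = ip (g i p) (u p) (v p *m chrmx i p a).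
    by rewrite ipE trmx_mul !mulmxA.
  ring.
have -> : (u p *m dgram i p a *m (v p)^T) 0 0 = \sum_c \sum_d pd i a (fun q => g i q [tuple c; d]) p * u p 0 c * v p 0 d.
  rewrite mxE exchange_big /=; apply: eq_bigr => d _; rewrite !mxE big_distrl /=.
  by apply: eq_bigr => c _; rewrite !mxE [u p 0 c * _]mulrC.
have sgu c d : smM N (fun q => g i q [tuple c; d] * u q 0 c) := smF_mul oN (sm_g _) (su c).
have sguv c d : smM N (fun q => g i q [tuple c; d] * u q 0 c * v q 0 d) := smF_mul oN (sgu c d) (sv d).
rewrite (pd_sum oN Np dp _ _ a (f := fun c q => \sum_d g i q [tuple c; d] * u q 0 c * v q 0 d)); last first.
  move=> c; exact: (smF_sum oN _ _ (F := fun d _ q => g i q [tuple c; d] * u q 0 c * v q 0 d) (sguv c)).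
rewrite -!big_split /=; apply: eq_bigr => c _.
rewrite (pd_sum oN Np dp _ _ a (f := fun d q => g i q [tuple c; d] * u q 0 c * v q 0 d) (sguv c)).
rewrite -!big_split /=; apply: eq_bigr => d _.
rewrite (pdM oN Np dp a (sgu c d) (sv d)) (pdM oN Np dp a (sm_g _) (su c)).
rewrite !mxE; ring.
Qed.

(** The two torsion terms cancel by [oip_torsion], leaving the Leibniz rule for the Levi-Civita
    part. The statement lives in a single chart because it is also applied to the components of DV
    with a fixed form index, which do not transform as an octonion section. *)
Lemma pd_oip a (A B : ofield M) : smO N (fun _ q => A i q) -> smO N (fun _ q => B i q) ->
  pd i a (fun q => oip (g i q) (A i q) (B i q)) p =
  oip (g i p) (octD phi g T A i p a) (B i p) + oip (g i p) (A i p) (octD phi g T B i p a).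
Proof.
move=> sA sB; have [a1 a2] := sA; have [b1 b2] := sB.
have ot := oip_torsion (A i p) (B i p) (torsion_oct g T i p a).2 (geom_sym gm dp) (geom_pos gm dp) (geom_swap gm dp).
rewrite /octD !(oipDl, oipDr, oipNl, oipNr).
rewrite [RHS](_ : _ = oip (g i p) (nablaO g A i p a) (B i p) + oip (g i p) (A i p) (nablaO g B i p a)); last first.
  by move: ot; set x := oip _ (omul _ _ _ _) _; set y := oip _ _ (omul _ _ _ _) => xy; have -> : x = - y by [apply/eqP; rewrite -addr_eq0 xy]; ring.
rewrite /oip !nablaO2E /=.
rewrite (pdD oN Np dp a (smF_mul oN a1 b1) (sm_ip gm oN Ni a2 b2)).
rewrite (pdM oN Np dp a a1 b1) (pd_ip a a2 b2).
by ring.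
Qed.

(** Obtained by differentiating the product of the inverse Gram matrix with the Gram matrix, which
    is constant, and substituting [dgram_compat]. *)
Lemma pd_invgram a b c :
  pd i a (fun q => invmx (gram (g i q)) b c) p =
  - (invmx (gram (g i p)) *m chrmx i p a) b c - ((chrmx i p a)^T *m invmx (gram (g i p))) b c.
Proof.
pose Gi q := invmx (gram (g i q)).
pose dGi : 'M[R]_7 := \matrix_(b, c) pd i a (fun q => Gi q b c) p.
have sGi b' c' : smM N (fun q => Gi q b' c') := sm_invgram gm oN Ni b' c'.
have dGiE : dGi *m gram (g i p) + Gi p *m dgram i p a = 0.
  apply/matrixP => b' c'; rewrite mxE [RHS]mxE.
  have e1 : pd i a (fun q => \sum_d Gi q b' d * g i q [tuple d; c']) p = 0.
    rewrite -[RHS](pd_cst i p a ((1%:M : 'M[R]_7) b' c')); apply: (pd_eq oN Np dp) => q Nq.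
    rewrite -(mulVmx (geom_unit gm (Ni Nq))) mxE; apply: eq_bigr => d _.
    by rewrite [gram _ _ _]mxE.
  rewrite -e1 (pd_sum oN Np dp _ _ a (f := fun d q => Gi q b' d * g i q [tuple d; c'])); last first.
    by move=> d; exact: (smF_mul oN (sGi b' d) (sm_g _)).
  rewrite !mxE -big_split /=; apply: eq_bigr => d _.
  rewrite (pdM oN Np dp a (sGi b' d) (sm_g _)) !mxE; ring.
have uG := geom_unit gm dp.
have dE : dGi = - (Gi p *m chrmx i p a) - (chrmx i p a)^T *m Gi p.
  have : dGi *m gram (g i p) *m Gi p = - (Gi p *m dgram i p a) *m Gi p.
    by congr (_ *m _); apply/eqP; rewrite -addr_eq0 dGiE.
  rewrite mulmxK // => ->; rewrite dgram_compat mulmxDr mulNmx mulmxDl.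
  by rewrite !mulmxA mulmxK // [Gi p *m gram _]mulVmx // mul1mx opprD.
have := congr1 (fun X : 'M[R]_7 => X b c) dE; rewrite mxE => ->.
by rewrite !mxE.
Qed.

End At.
End Identities.

(** * The divergence identity for the pairing of DV with a section *)

Section Divergence.
Context {R : realType} (M : manifold R 7).
Notation I := (chart_index M).

Lemma pd_prod (N : set M) i p a (K : eqType) (r : seq K) (f : K -> M -> R) :
  open N -> N p -> chart_dom i p -> (forall k, smM N (f k)) -> uniq r ->
  pd i a (fun q => \prod_(k <- r) f k q) p =
  \sum_(k <- r) pd i a (f k) p * \prod_(l <- r | l != k) f l p.
Proof.
move=> oN Np dp sf; elim: r => [_|x r ih /= /andP[xr ur]].
  rewrite big_nil -[RHS](pd_cst i p a 1); apply: (pd_eq oN Np dp) => q _; exact: big_nil.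
rewrite (pd_eq oN Np dp a (g := fun q => f x q * \prod_(k <- r) f k q)); last by move=> q _; rewrite big_cons.
rewrite (pdM oN Np dp a (sf x) (smF_prod oN _ _ (F := fun k _ q => f k q) sf)) ih //.
rewrite big_cons big_cons eqxx /= addrC mulrC; congr (_ + _).
  congr (_ * _); rewrite big_seq [RHS]big_seq_cond; apply: eq_bigl => k.
  by case kr : (k \in r) => //=; symmetry; apply: contraNneq xr => <-.
rewrite mulr_sumr; apply: eq_big_seq => k kr.
rewrite big_cons ifT 1?mulrCA //; apply: contraNneq xr => ->.
exact: kr.
Qed.

Lemma pd_det (N : set M) i p a n (A : M -> 'M[R]_n) :
  open N -> N p -> chart_dom i p -> (forall k l, smM N (fun q => A q k l)) ->
  pd i a (fun q => \det (A q)) p =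
  \tr ((\matrix_(k, l) pd i a (fun q => A q k l) p) *m \adj (A p)).
Proof.
move=> oN Np dp sA.
set dA := matrix_of_fun _ _.
pose B k : 'M[R]_n := \matrix_(l, m) if l == k then dA k m else A p l m.
transitivity (\sum_k \det (B k)); last first.
  apply: eq_bigr => k _; rewrite (expand_det_row _ k) mxE; apply: eq_bigr => m _.
  rewrite !mxE eqxx; congr (_ * (_ * \det _)).
  by apply/matrixP => x y; rewrite !mxE eq_sym (negbTE (neq_lift _ _)).
have sP (s : 'S_n) : smM N (fun q => \prod_k A q k (s k)).
  exact: (smF_prod oN _ _ (F := fun k _ q => A q k (s k)) (fun k => sA k (s k))).
rewrite (pd_sum oN Np dp _ _ a (f := fun (s : 'S_n) q => (-1) ^+ s * \prod_k A q k (s k))); last first.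
  by move=> s; exact: (smF_mul oN (smF_cst oN _) (sP s)).
rewrite exchange_big /=; apply: eq_bigr => s _.
rewrite (pdZ oN Np dp a _ (sP s)) -mulr_sumr; congr (_ * _).
rewrite (pd_prod a oN Np dp (fun k => sA k (s k)) (index_enum_uniq _)).
apply: eq_bigr => k _; rewrite [RHS](bigD1 k) //= mxE eqxx mxE; congr (_ * _).
by apply: eq_bigr => l lk; rewrite mxE (negbTE lk).
Qed.

Variables (phi : tfield M 3) (g T : tfield M 2) (vol : tfield M 7).
Hypothesis gm : geometry phi g T.
Hypothesis gv : volume_form g vol.

(** The signed density. It is smooth and satisfies a differential identity, while the volume measure
    has its absolute value as density. *)
Definition dens (i : I) (q : M) : R := vol i q (ord_tuple 7).

Section At.
Variables (N : set M) (i : I) (p : M).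
Hypotheses (oN : open N) (Ni : N `<=` chart_dom i) (Np : N p).

Let dp : chart_dom i p := Ni Np.

Lemma sm_dens : smM N (dens i).
Proof. by have [tv _] := gv; exact: (smN Ni (ord_tuple 7) tv). Qed.

Lemma dens_neq0 : dens i p != 0.
Proof.
have [_ /(_ i p dp) [_ vE]] := gv.
rewrite -sqrf_eq0 [X in X == _]vE -unitfE -unitmxE; exact: (geom_unit gm dp).
Qed.

(** The square of the density is the Gram determinant, whatever the orientation of the chart.
    Jacobi's formula and [dgram_compat] give the derivative of that square as twice the determinant
    times the trace, and a nonzero factor [2 dens] is cancelled. *)
Lemma pd_dens a : pd i a (dens i) p = dens i p * \tr (chrmx g i p a).
Proof.
have dE q : N q -> dens i q * dens i q = \det (gram (g i q)).
  by move=> /Ni dq; have [_ /(_ i q dq) [_ <-]] := gv; rewrite expr2.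
have uG := geom_unit gm dp.
have e1 := pd_eq oN Np dp a dE.
rewrite (pdM oN Np dp a sm_dens sm_dens) in e1.
have sG k l : smM N (fun q => gram (g i q) k l).
  by apply: (smF_eq oN (smN Ni [tuple k; l] (geom_metric gm))) => t q _; rewrite mxE.
rewrite (pd_det a oN Np dp sG) in e1.
have dGE : (\matrix_(k, l) pd i a (fun q => gram (g i q) k l) p) = dgram g i p a.
  by apply/matrixP => k l; rewrite !mxE; apply: (pd_eq oN Np dp) => q _; rewrite mxE.
have adjE : \adj (gram (g i p)) = \det (gram (g i p)) *: invmx (gram (g i p)).
  by rewrite /invmx uG scalerA divff ?scale1r // -unitfE -unitmxE.
rewrite dGE (dgram_compat gm oN Ni Np) adjE -scalemxAr mxtraceZ -dE // in e1.
have trE : \tr ((chrmx g i p a *m gram (g i p) + gram (g i p) *m (chrmx g i p a)^T) *m invmx (gram (g i p))) =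
    2%:R * \tr (chrmx g i p a).
  rewrite mulmxDl mulmxK // mxtraceD mxtrace_mulC mulmxA mulVmx // mul1mx mxtrace_tr.
  by rewrite mulr_natl mulr2n.
rewrite trE in e1.
apply: (mulfI dens_neq0); apply: (mulfI (_ : 2%:R != 0)); first by rewrite pnatr_eq0.
by rewrite mulr_natl mulr2n e1; ring.
Qed.

(** Leibniz expansion for the vector field X^a = g^{ab} <D_b V, W>. The derivative of the density
    contributes the trace of the connection, which cancels one of the two Christoffel terms of the
    inverse metric; the other one is the Christoffel term inside [octDform]. *)
Lemma divergence (V W : ofield M) : smO N (fun _ q => V i q) -> smO N (fun _ q => W i q) ->
  \sum_a pd i a (fun q => dens i q * \sum_b invmx (gram (g i q)) a b *
      oip (g i q) (octD phi g T V i q b) (W i q)) p =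
  dens i p * (\sum_a \sum_b invmx (gram (g i p)) a b *
      oip (g i p) (octD phi g T V i p a) (octD phi g T W i p b)
    - oip (g i p) (octDstar phi g T (octD phi g T V) i p) (W i p)).
Proof.
move=> sV sW.
pose Gi q := invmx (gram (g i q)); pose C a := chrmx g i p a.
pose h b q := oip (g i q) (octD phi g T V i q b) (W i q).
have sD b : smO N (fun _ q => octD phi g T V i q b) := sm_octD gm oN Ni b sV.
have sh b : smM N (h b) := sm_oip gm oN Ni (sD b) sW.
have sGi a b : smM N (fun q => Gi q a b) := sm_invgram gm oN Ni a b.
pose E a b := oip (g i p) (octD phi g T (fun j q => octD phi g T V j q b) i p a) (W i p).
pose F a b := oip (g i p) (octD phi g T V i p b) (octD phi g T W i p a).
have dh a b : pd i a (h b) p = E a b + F a b.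
  exact: (pd_oip gm oN Ni Np a (A := fun j q => octD phi g T V j q b) (sD b) sW).
have dGi a b : pd i a (fun q => Gi q a b) p = - (Gi p *m C a) a b - ((C a)^T *m Gi p) a b.
  exact: (pd_invgram gm oN Ni Np).
have starE : oip (g i p) (octDstar phi g T (octD phi g T V) i p) (W i p) =
    - \sum_a \sum_b Gi p a b * (E a b - \sum_c C a b c * h c p).
  rewrite oipNl oip_suml; congr (- _); apply: eq_bigr => a _; rewrite oip_suml.
  apply: eq_bigr => b _; rewrite oipZl; congr (_ * _).
  (* The covariant derivative and the torsion product regroup into [octD] of the component with form
     index [b] held fixed, leaving the Christoffel term for that index apart. *)
  rewrite /octDform !(oipDl, oipNl) oip_suml addrAC -oipNl -oipDl; congr (_ - _).
  apply: eq_bigr => c _; rewrite oipZl mxE; congr (_ * _).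
have termE a : pd i a (fun q => dens i q * \sum_b Gi q a b * h b q) p =
    dens i p * (\sum_b (\tr (C a) * Gi p a b * h b p
       - (Gi p *m C a) a b * h b p - ((C a)^T *m Gi p) a b * h b p
       + Gi p a b * (E a b + F a b))).
  have sS b : smM N (fun q => Gi q a b * h b q) := smF_mul oN (sGi a b) (sh b).
  rewrite (pdM oN Np dp a sm_dens (smF_sum oN _ _ (F := fun b _ q => Gi q a b * h b q) sS)).
  rewrite pd_dens (pd_sum oN Np dp _ _ a (f := fun b q => Gi q a b * h b q) sS).
  rewrite -/(C a); move: (\tr (C a)) => tr.
  rewrite [X in _ + X]mulr_suml !mulr_sumr -big_split /=; apply: eq_bigr => b _.
  rewrite (pdM oN Np dp a (sGi a b) (sh b)) dh dGi; ring.
rewrite (eq_bigr _ (fun a _ => termE a)) -mulr_sumr; congr (_ * _); rewrite starE opprK.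
(* The two sums agree after exchanging the names of the contracted indices, once the lower indices
   of the Christoffel symbol are swapped by [chr_sym]. *)
have cancel : \sum_a \sum_b (\tr (C a) * Gi p a b * h b p - ((C a)^T *m Gi p) a b * h b p) = 0.
  under eq_bigr do rewrite sumrB; rewrite sumrB; apply/eqP; rewrite subr_eq0; apply/eqP.
  transitivity (\sum_a \sum_b \sum_c C c a c * Gi p a b * h b p).
    apply: eq_bigr => a _; apply: eq_bigr => b _; rewrite !big_distrl /=.
    apply: eq_bigr => c _; congr (_ * _ * _).
    by rewrite !mxE; exact: (chr_sym gm oN Ni Np).
  transitivity (\sum_a \sum_b \sum_c C a c a * Gi p c b * h b p); last first.
    apply: eq_bigr => a _; apply: eq_bigr => b _; rewrite [((C a)^T *m _) a b]mxE big_distrl /=.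
    by apply: eq_bigr => c _; rewrite [(C a)^T a c]mxE.
  rewrite exchange_big [RHS]exchange_big /=; apply: eq_bigr => b _.
  by rewrite exchange_big.
transitivity (\sum_a \sum_b (\tr (C a) * Gi p a b * h b p - ((C a)^T *m Gi p) a b * h b p)
   + (\sum_a \sum_b Gi p a b * F a b + \sum_a \sum_b (Gi p a b * E a b - (Gi p *m C a) a b * h b p))).
  rewrite -!big_split /=; apply: eq_bigr => a _; rewrite -!big_split /=; apply: eq_bigr => b _.
  by move: (\tr _) => tr; ring.
rewrite cancel add0r; congr (_ + _).
  rewrite exchange_big; apply: eq_bigr => a _; apply: eq_bigr => b _; congr (_ * _).
  by have := congr1 (fun X : 'M[R]_7 => X a b) (invgram_sym (geom_sym gm dp)); rewrite mxE.
apply: eq_bigr => a _; under [RHS]eq_bigr do rewrite mulrBr.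
rewrite !sumrB; congr (_ - _).
transitivity (\sum_b \sum_c Gi p a c * C a c b * h b p).
  by apply: eq_bigr => b _; rewrite mxE big_distrl.
rewrite exchange_big; apply: eq_bigr => b _ /=; rewrite mulr_sumr.
by apply: eq_bigr => c _; rewrite mulrA.
Qed.

(** The functions <D_b V, V> vanish on all of [N], so their derivatives vanish too: <D_a D_b V, V> =
    - <D_b V, D_a V>. The Christoffel terms of [octDform] pair with [V] to multiples of those same
    functions, and the sign in D* turns the result into |DV|^2. *)
Lemma octDstar_unit (V : ofield M) : smO N (fun _ q => V i q) ->
  (forall q, N q -> oip (g i q) (V i q) (V i q) = 1) ->
  oip (g i p) (octDstar phi g T (octD phi g T V) i p) (V i p) =
  oform_normsq g (octD phi g T V) i p.
Proof.
move=> sV uV.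
pose h b q := oip (g i q) (octD phi g T V i q b) (V i q).
have sD b : smO N (fun _ q => octD phi g T V i q b) := sm_octD gm oN Ni b sV.
have h0 b q : N q -> h b q = 0.
  move=> Nq; have := pd_oip gm oN Ni Nq b sV sV.
  rewrite (pd_eq oN Nq (Ni Nq) b uV) pd_cst (oipC (V i q) _ (geom_sym gm (Ni Nq))) -/(h b q) => e.
  by apply: (mulfI (_ : 2%:R != 0)); rewrite ?pnatr_eq0 // mulr0 mulr_natl mulr2n -e.
have dh a b : oip (g i p) (octD phi g T (fun j q => octD phi g T V j q b) i p a) (V i p) =
    - oip (g i p) (octD phi g T V i p b) (octD phi g T V i p a).
  have := pd_oip gm oN Ni Np a (A := fun j q => octD phi g T V j q b) (sD b) sV.
  rewrite (pd_eq oN Np dp a (h0 b)) pd_cst => /esym/eqP; rewrite addr_eq0 => /eqP.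
  exact.
rewrite oipNl oip_suml -sumrN; apply: eq_bigr => a _; rewrite oip_suml -sumrN.
apply: eq_bigr => b _; rewrite oipZl -mulrN; congr (_ * _).
rewrite /octDform !(oipDl, oipNl) oip_suml addrAC -oipNl -oipDl.
rewrite [X in - (_ - X)]big1 => [|c _]; last by rewrite oipZl -/(h c p) h0 ?mulr0.
rewrite subr0 [X in - X](dh a b) opprK.
rewrite -oipNl -oipDl; exact: (oipC _ _ (geom_sym gm dp)).
Qed.

End At.
End Divergence.

(** * Change of charts *)

Section Invariance.
Context {R : realType}.

Section OmulLinear.
Variables (g : tensor R 2) (w : tensor R 3) (A : oct R).

Lemma phi3Dr u v x : phi3 w u (v + x) = phi3 w u v + phi3 w u x.
Proof. by apply/rowP => d; rewrite [RHS]mxE !phi3E linearD mulmxDr mxE. Qed.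

Lemma phi3Zr u c v : phi3 w u (c *: v) = c *: phi3 w u v.
Proof. by apply/rowP => d; rewrite [RHS]mxE !phi3E linearZ /= -scalemxAr mxE. Qed.

Lemma omulDr B C : omul g w A (B + C) = omul g w A B + omul g w A C.
Proof.
rewrite /omul; congr pair => /=; first by rewrite ipDr mulrDr opprD addrACA.
rewrite !crossE phi3Dr mulmxDl scalerDr scalerDl.
by rewrite [X in X + _ = _]addrACA [LHS]addrACA.
Qed.

Lemma omulZr c B : omul g w A (c *: B) = c *: omul g w A B.
Proof.
rewrite /omul; congr pair => /=; first rewrite -[RHS]/(c * (A.1 * B.1 - ip g A.2 B.2)) -[LHS]/(A.1 * (c * B.1) - _).
  by rewrite ipZr mulrBr mulrCA.
rewrite !crossE phi3Zr -scalemxAl !scalerDr !scalerA; congr (_ + _).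
by rewrite [c * A.1]mulrC.
Qed.

Lemma omul_sumr (K : Type) (r : seq K) (c : K -> R) (B : K -> oct R) :
  omul g w A (\sum_(k <- r) c k *: B k) = \sum_(k <- r) c k *: omul g w A (B k).
Proof.
elim: r => [|k r ih]; last by rewrite !big_cons omulDr omulZr ih.
by rewrite !big_nil -[0 in LHS](scale0r 0) omulZr scale0r.
Qed.
End OmulLinear.

Variable M : manifold R 7.
Notation I := (chart_index M).
Variables (phi : tfield M 3) (g T : tfield M 2).
Hypothesis gm : geometry phi g T.
Variables (i j : I) (p : M).
Hypotheses (di : chart_dom i p) (dj : chart_dom j p).

Let N := chart_dom i `&` chart_dom j.
Let oN : open N. Proof. by apply: openI; exact: dom_open. Qed.
Let Np : N p. Proof. by []. Qed.
Let Ni : N `<=` chart_dom i. Proof. by move=> q []. Qed.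
Let Nj : N `<=` chart_dom j. Proof. by move=> q []. Qed.

Let J := jac i j p.
Let Gj := gram (g j p).

Lemma gram_jac q : N q -> gram (g i q) = jac i j q *m gram (g j q) *m (jac i j q)^T.
Proof. by move=> [qi qj]; have [_ /(_ i j q qi qj) ->] := geom_metric gm; rewrite gram_pullback. Qed.

Lemma mulmx_gram_jac (X : 'M[R]_7) : X *m J *m Gj *m J^T = X *m gram (g i p).
Proof. by rewrite (gram_jac Np) !mulmxA. Qed.

(** The invertible Gram matrix of chart [i] factors through the Jacobian. *)
Lemma jac_unit : J \in unitmx.
Proof.
have := geom_unit gm di; rewrite (gram_jac Np) !unitmx_mul.
by case/andP => /andP[].
Qed.

Definition djac a : 'M[R]_7 := \matrix_(c, e) pd i a (fun q => jac i j q c e) p.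

Lemma djac_sym a c e : djac a c e = djac c a e.
Proof.
have h a' c' : djac a' c' e = pd i a' (pd i c' (fun q => chart j q 0 e)) p.
  rewrite mxE; apply: (@pd_eq _ _ N i p oN Np di a' (fun q => jac i j q c' e) (pd i c' (fun q => chart j q 0 e))) => q _.
  by rewrite mxE.
apply: (eq_trans (h a c)); apply: (eq_trans _ (esym (h c a))).
exact: (@pd_comm R M N i p a c (fun q => chart j q 0 e) oN Np di (smFS Nj (smM_chart j e))).
Qed.

Let sJ c e : smM N (fun q => jac i j q c e) := smM_jac i j c e.

(** Product rule for the congruence [gram_jac]; in the middle factor the derivative along chart [i]
    is converted to chart [j] by [pd_chain]. *)
Lemma dgram_jac a : dgram g i p a = djac a *m Gj *m J^T +
  J *m (\sum_h J a h *: dgram g j p h) *m J^T + J *m Gj *m (djac a)^T.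
Proof.
apply/matrixP => c d; rewrite mxE.
have sG e f : smM N (fun q => g j q [tuple e; f]) := smN Nj [tuple e; f] (geom_metric gm).
pose F f e q := jac i j q c e * g j q [tuple e; f] * jac i j q d f.
have sF f e : smM N (F f e) := smF_mul oN (smF_mul oN (sJ c e) (sG e f)) (sJ d f).
rewrite (pd_eq oN Np di a (g := fun q => \sum_f \sum_e F f e q)); last first.
  move=> q Nq; have /matrixP /(_ c d) := gram_jac Nq; rewrite mxE => ->.
  rewrite mxE; apply: eq_bigr => f _; rewrite !mxE big_distrl /=; apply: eq_bigr => e _.
  by rewrite /F !mxE.
rewrite (pd_sum oN Np di _ _ a (f := fun f q => \sum_e F f e q)); last first.
  move=> f; exact: (smF_sum oN _ _ (F := fun e _ q => F f e q) (sF f)).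
rewrite mxE mxE [X in X + _ + _]mxE [X in _ + X + _]mxE [X in _ + _ + X]mxE -!big_split /=.
apply: eq_bigr => f _; rewrite (pd_sum oN Np di _ _ a (f := F f) (sF f)).
rewrite [(djac a *m Gj) c f]mxE [(J *m _) c f]mxE [(J *m Gj) c f]mxE !big_distrl -!big_split /=.
apply: eq_bigr => e _.
rewrite (pdM oN Np di a (smF_mul oN (sJ c e) (sG e f)) (sJ d f)) (pdM oN Np di a (sJ c e) (sG e f)).
rewrite (pd_chain a oN Np di dj (sG e f)).
rewrite [(djac a)^T f d]mxE [J^T f d]mxE [Gj e f]mxE [djac a c e]mxE [djac a d f]mxE summxE.
have -> : \sum_h (J a h *: dgram g j p h) e f = \sum_b jac i j p a b * pd j b (fun q => g j q [tuple e; f]) p.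
  by apply: eq_bigr => h _; rewrite !mxE.
rewrite -/J; ring.
Qed.

(** Multiplying on the right by [Gj *m J^T] lowers the index and reduces the law to
    [lowchr_transf]. *)
Lemma chrmx_jac a : chrmx g i p a *m J = djac a + J *m (\sum_h J a h *: chrmx g j p h).
Proof.
have uJT : J^T \in unitmx by rewrite unitmx_tr jac_unit.
have uG : Gj \in unitmx := geom_unit gm dj.
apply: (can_inj (mulmxK uG)); apply: (can_inj (mulmxK uJT)).
transitivity (chrmx g i p a *m gram (g i p)); first by rewrite (gram_jac Np) !mulmxA.
rewrite (chrmx_lower gm Ni Np).
have GjS : Gj^T = Gj := geom_sym gm dj.
rewrite (lowchr_transf _ GjS djac_sym dgram_jac) !mulmxDl; congr (_ + _).
rewrite -[J *m _ *m Gj]mulmxA; congr (_ *m _ *m _).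
rewrite mulmx_suml; apply: eq_bigr => h _; rewrite -scalemxAl.
by rewrite (chrmx_lower gm Nj Np).
Qed.

Lemma torsion_jac a : octmap J (torsion_oct g T i p a) =
  \sum_h J a h *: torsion_oct g T j p h.
Proof.
have uJ := jac_unit; have uJT : J^T \in unitmx by rewrite unitmx_tr.
have uG : Gj \in unitmx := geom_unit gm dj.
have uGi : gram (g i p) \in unitmx := geom_unit gm di.
have tE k : (torsion_oct g T k p) =1 (fun a => (0, row a (gram (T k p) *m invmx (gram (g k p))))).
  move=> a'; congr pair; apply/rowP => b; rewrite !mxE; apply: eq_bigr => c _.
  by rewrite !mxE.
have TE : gram (T i p) *m invmx (gram (g i p)) *m J = J *m (gram (T j p) *m invmx Gj).
  apply: (can_inj (mulmxK uG)); apply: (can_inj (mulmxK uJT)).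
  have [_ /(_ i j p di dj) ->] := geom_torsion gm; rewrite gram_pullback.
  by rewrite [LHS]mulmx_gram_jac mulmxKV // !mulmxA mulmxKV.
rewrite tE /octmap /= -row_mul TE.
under eq_bigr do rewrite tE.
have -> : \sum_h J a h *: ((0, row h (gram (T j p) *m invmx (gram (g j p)))) : oct R) =
  (0, \sum_h J a h *: row h (gram (T j p) *m invmx (gram (g j p)))).
  elim/big_ind2 : _ => [//|x1 x2 y1 y2 -> ->|h _]; first by congr pair; rewrite /= addr0.
  by congr pair; rewrite /= scaler0.
congr pair; apply/rowP => b; rewrite !mxE summxE; apply: eq_bigr => h _.
by rewrite !mxE.
Qed.

Variable A : ofield M.
Hypothesis cA : oct_compatible A.
Hypothesis sAi : smO N (fun _ q => A i q).
Hypothesis sAj : smO N (fun _ q => A j q).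

(** The inhomogeneous term [djac] in the law of the Christoffel symbols is exactly the extra term
    that arises when the relation between [A j] and [A i] is differentiated. *)
Lemma nablaO_jac a : octmap J (nablaO g A i p a) = \sum_h J a h *: nablaO g A j p h.
Proof.
have [a1 a2] := sAi; have [b1 b2] := sAj.
have AE q : N q -> A j q = octmap (jac i j q) (A i q) by move=> [qi qj]; exact: cA.
have d2 : drow i p a (fun q => (A j q).2) = drow i p a (fun q => (A i q).2) *m J + (A i p).2 *m djac a.
  apply/rowP => e; rewrite [LHS]mxE.
  rewrite (pd_eq oN Np di a (g := fun q => \sum_c (A i q).2 0 c * jac i j q c e)); last first.
    by move=> q Nq; rewrite AE //= mxE.
  rewrite (pd_sum oN Np di _ _ a (f := fun c q => (A i q).2 0 c * jac i j q c e)); last first.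
    by move=> c; exact: (smF_mul oN (a2 c) (sJ c e)).
  rewrite mxE [X in X + _]mxE [X in _ + X]mxE -big_split /=; apply: eq_bigr => c _.
  rewrite (pdM oN Np di a (a2 c) (sJ c e)) [djac a c e]mxE [drow _ _ _ _ _ _]mxE addrC.
  by congr (_ + _); exact: mulrC.
have d3 : drow i p a (fun q => (A j q).2) = \sum_h J a h *: drow j p h (fun q => (A j q).2).
  apply/rowP => e; rewrite mxE summxE (pd_chain a oN Np di dj (b2 e)).
  by apply: eq_bigr => h _; rewrite !mxE.
have d1 : pd i a (fun q => (A i q).1) p = \sum_h J a h * pd j h (fun q => (A j q).1) p.
  rewrite -(pd_chain a oN Np di dj b1); apply: (pd_eq oN Np di) => q Nq.
  by rewrite AE.
have -> : \sum_h J a h *: nablaO g A j p h =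
   (\sum_h J a h * (nablaO g A j p h).1, \sum_h J a h *: (nablaO g A j p h).2).
  by elim/big_ind3 : _ => [//|x1 x2 x3 y1 y2 y3 -> ->|h _].
congr pair; first exact: d1.
rewrite -[LHS]/((nablaO g A i p a).2 *m J) nablaO2E mulmxDl -mulmxA chrmx_jac mulmxDr addrA -d2 d3 mulmxA.
under [RHS]eq_bigr do rewrite nablaO2E scalerDr.
rewrite big_split /=; congr (_ + _).
rewrite mulmx_sumr; apply: eq_bigr => h _; rewrite -scalemxAr; congr (_ *: (_ *m _)).
by rewrite AE.
Qed.

Lemma octD_jac a : octmap J (octD phi g T A i p a) = \sum_h J a h *: octD phi g T A j p h.
Proof.
rewrite octmapD octmapN nablaO_jac.
have [_ /(_ i j p di dj) gE] := geom_metric gm.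
have [_ /(_ i j p di dj) pE] := geom_phi gm.
rewrite gE pE (omul_pullback _ _ _ jac_unit (geom_unit gm dj)) -/J torsion_jac omul_sumr.
have -> : octmap J (A i p) = A j p by rewrite (cA di dj).
rewrite -sumrB; apply: eq_bigr => h _.
by rewrite -scalerBr.
Qed.

(* The energy density does not depend on the chart; [energy] evaluates it in [chart_at p]. *)
Lemma normsq_jac : oform_normsq g (octD phi g T A) i p = oform_normsq g (octD phi g T A) j p.
Proof.
have [_ /(_ i j p di dj) gE] := geom_metric gm.
have uJ := jac_unit; have uJT : J^T \in unitmx by rewrite unitmx_tr.
have uG : Gj \in unitmx := geom_unit gm dj.
have uGi : gram (g i p) \in unitmx := geom_unit gm di.
pose Gi := invmx (gram (g i p)).
have GE : J^T *m Gi *m J = invmx Gj.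
  apply: (can_inj (mulmxK uG)); apply: (can_inj (mulmxK uJT)).
  by rewrite mulVmx // mul1mx [LHS]mulmx_gram_jac mulmxKV.
transitivity (\sum_a \sum_b \sum_h \sum_k (Gi a b * J a h * J b k) * oip (g j p) (octD phi g T A j p h) (octD phi g T A j p k)).
  apply: eq_bigr => a _; apply: eq_bigr => b _.
  rewrite [X in oip X]gE oip_pullback !octD_jac oip_suml mulr_sumr; apply: eq_bigr => h _.
  rewrite oipZl (oipC _ _ (geom_sym gm dj)) oip_suml !mulr_sumr; apply: eq_bigr => k _.
  rewrite oipZl (oipC _ _ (geom_sym gm dj)) /Gi; ring.
rewrite /oform_normsq -/Gj -GE.
transitivity (\sum_h \sum_k \sum_a \sum_b (Gi a b * J a h * J b k) * oip (g j p) (octD phi g T A j p h) (octD phi g T A j p k)).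
  under eq_bigr do rewrite exchange_big /=.
  rewrite exchange_big /=; apply: eq_bigr => h _.
  under eq_bigr do rewrite exchange_big /=.
  by rewrite exchange_big.
apply: eq_bigr => h _; apply: eq_bigr => k _.
rewrite [(_ *m J) h k]mxE big_distrl exchange_big /=; apply: eq_bigr => b _.
rewrite [(_ *m Gi) h b]mxE !big_distrl /=; apply: eq_bigr => a _.
rewrite [J^T h a]mxE; ring.
Qed.

End Invariance.

(** * Bump functions and the volume measure *)

Section Bump.
Context {R : realType} (M : manifold R 7).
Notation I := (chart_index M).

Lemma smF_zero_ext (K N : set M) i (F : R -> M -> R) : open N -> closed K -> K `<=` chart_dom i ->
  smF (chart_dom i `&` N) F -> (forall t q, chart_dom i q -> N q -> ~ K q -> F t q = 0) ->
  smF N (fun t q => if `[< chart_dom i q >] then F t q else 0).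
Proof.
move=> oN cK Ki sF F0; apply: smF_local => q Nq.
have [Kq|nKq] := pselect (K q).
  exists (chart_dom i `&` N); first by split=> //; exact: Ki.
  have o1 : open (chart_dom i `&` N) by apply: openI => //; exact: dom_open.
  by apply: (smF_eq o1 sF) => t q' [di _]; rewrite asboolT.
have oK : open (~` K `&` N) by apply: openI => //; rewrite openC.
exists (~` K `&` N) => //.
apply: (smF_eq oK (smF_cst oK 0)) => t q' [nK' Nq'].
by case: asboolP => // di; rewrite F0.
Qed.

(** The squared Euclidean distance is used for its smoothness; positivity forces every coordinate of
    the difference to be at most [r], so the support fits in the maximum-norm ball [chart_ball]. *)
Definition bump_arg (i : I) (c : 'rV[R]_7) (r : R) (q : M) : R :=
  r ^+ 2 - \sum_k (chart i q 0 k - c 0 k) ^+ 2.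

Definition bump (i : I) (c : 'rV[R]_7) (r : R) (q : M) : R :=
  if `[< chart_dom i q >] then bumpE 0 (bump_arg i c r q) else 0.

Lemma bumpE0_ge0 (s : R) : 0 <= bumpE 0 s.
Proof. by rewrite /bumpE; case: ifP => // _; rewrite mulr_ge0 ?expR_ge0 // invr_ge0 expr0. Qed.

Lemma bumpE0_gt0 (s : R) : 0 < s -> 0 < bumpE 0 s.
Proof. by move=> s0; rewrite /bumpE s0 mulr_gt0 ?expR_gt0 // invr_gt0 expr0. Qed.

Section At.
Variables (i : I) (c : 'rV[R]_7) (r : R).
Hypothesis r0 : 0 < r.
Hypothesis rU : forall x : 'rV[R]_7, `|x - c| <= r -> (chart i @` chart_dom i) x.

Definition chart_ball : set M := chart_inv i @` [set x | `|x - c| <= r].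

Lemma ball_cim x : `|x - c| <= r -> cim i setT x.
Proof. by move=> /rU; rewrite /cim setIT. Qed.

Lemma chart_ball_dom : chart_ball `<=` chart_dom i.
Proof. by move=> q [x /= xr <-]; have [] := cim_dom (ball_cim xr). Qed.

Lemma closed_cball : closed [set x : 'rV[R]_7 | `|x - c| <= r].
Proof.
have -> : [set x : 'rV[R]_7 | `|x - c| <= r] = (fun y : 'rV[R]_7 => `|y - c|) @^-1` [set x | x <= r] by [].
apply: closed_comp; last exact: closed_le.
move=> x _; apply: (@cvg_comp _ _ _ (fun y : 'rV[R]_7 => y - c) (fun y => `|y|) _ (nbhs (x - c))).
  exact: (cvgB cvg_id (cvg_cst c)).
exact: norm_continuous.
Qed.

Lemma chart_ball_compact : compact chart_ball.
Proof.
apply: continuous_compact.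
  apply: continuous_in_subspaceT => x /set_mem /= xr.
  by apply: chart_inv_continuous; exact: rU.
apply: bounded_closed_compact closed_cball.
exists (r + `|c|); split; first exact: num_real.
move=> m rm x /= xr; rewrite -(subrK c x) (le_trans (ler_normD _ _)) //.
by apply/ltW/le_lt_trans/rm; rewrite lerD2r.
Qed.

(** The Hausdorff axiom makes the compact ball closed in the whole manifold and not only in the
    chart, as extension by zero requires. *)
Lemma chart_ball_closed : closed chart_ball.
Proof. exact: (compact_closed (@manifold_hausdorff _ _ M) chart_ball_compact). Qed.

Lemma bump_out q : chart_dom i q -> ~ chart_ball q -> bumpE 0 (bump_arg i c r q) = 0.
Proof.
move=> di nB; rewrite /bumpE; case: ifPn => // a0; exfalso; apply: nB.
exists (chart i q); last by rewrite chartK.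
apply: norm_row_le => [|k]; first exact: ltW.
rewrite !mxE leNgt; apply/negP => rk.
move: a0; rewrite /bump_arg subr_gt0 ltNge => /negP; apply.
rewrite (bigD1 k) //= -[leLHS]addr0 lerD ?sumr_ge0 //; last by move=> l _; exact: sqr_ge0.
by rewrite -[leRHS]real_normK ?num_real // lerXn2r ?nnegrE ?normr_ge0 ?ltW.
Qed.

Lemma sm_bump_arg : smM (chart_dom i) (fun q => bumpE 0 (bump_arg i c r q)).
Proof.
have o := @dom_open _ _ M i.
apply: (smF_bump o 0); apply: (smF_sub o (smF_cst o _)).
apply: (smF_sum o) => k; apply: (smF_exp o 2); apply: (smF_sub o) (smF_cst o _).
exact: smM_chart.
Qed.

Lemma bump_smooth : smM setT (bump i c r).
Proof.
apply: (@smF_zero_ext chart_ball setT i (fun _ q => bumpE 0 (bump_arg i c r q)) openT chart_ball_closed chart_ball_dom).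
  by rewrite setIT; exact: sm_bump_arg.
by move=> t q di _; exact: bump_out.
Qed.

Lemma bump_ge0 q : 0 <= bump i c r q.
Proof. by rewrite /bump; case: ifP => // _; exact: bumpE0_ge0. Qed.

Lemma bump_supp q : bump i c r q != 0 -> chart_ball q.
Proof.
rewrite /bump; case: asboolP => [di|]; last by rewrite eqxx.
by move=> b0; apply: contrapT => nB; rewrite (bump_out di nB) eqxx in b0.
Qed.

Lemma bump_center q : chart_dom i q -> chart i q = c -> 0 < bump i c r q.
Proof.
move=> di qc; rewrite /bump asboolT //; apply: bumpE0_gt0.
by rewrite /bump_arg big1 ?subr0 ?exprn_gt0 // => k _; rewrite qc subrr expr0n.
Qed.

End At.

Lemma chart_radius i (W : set M) p : open W -> W p -> chart_dom i p ->
  exists2 r : R, 0 < r & forall x : 'rV[R]_7, `|x - chart i p| <= r ->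
    (chart i @` chart_dom i) x /\ W (chart_inv i x).
Proof.
move=> oW Wp dp.
have := near_cim oW Wp dp => /nbhs_ballP [e /= e0 be].
exists (e / 2); first by rewrite divr_gt0.
move=> x xr; have /be : ball (chart i p) e x.
  rewrite -ball_normE /= distrC (le_lt_trans xr) //.
  by rewrite ltr_pdivrMr // ltr_pMr // ltr1n.
move=> /cim_dom [dx Wx xE]; split=> //.
by exists (chart_inv i x).
Qed.
End Bump.

Section Measure.
Context {R : realType} (M : manifold R 7).
Hypothesis compactM : compact [set: M].
Variables (vol : tfield M 7) (mu : {measure set (borel M) -> \bar R}).
Hypothesis vol_mu : volume_measure vol mu.

Lemma borel_open (A : set M) : open A -> measurable (A : set (borel M)).
Proof. by move=> oA; exact: sub_sigma_algebra. Qed.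

Lemma borel_continuous (f : M -> R) : continuous f ->
  measurable_fun [set: borel M] (f : borel M -> R).
Proof.
move=> /continuousP cf; apply: (measurability _ (measurable_realfun.RGenOpens.measurableE R)).
move=> _ [_ [a [b ->] <-]]; rewrite setTI.
by apply: borel_open; apply/cf/interval_open.
Qed.

(** Markov's inequality: [volume_measure] equates the integral of [f] with a real number, so a
    superlevel set at a positive level cannot have infinite measure. *)
Lemma superlevel_finite (f : M -> R) (e : R) i (K : set M) : 0 < e -> continuous f -> (forall q, 0 <= f q) ->
  closed K -> K `<=` chart_dom i -> (forall q, f q != 0 -> K q) ->
  (mu ([set q | (e < f q)%R] : set (borel M)) < +oo)%E.
Proof.
move=> e0 cf f0 cK Ki fK.
have supp : closure [set p | f p != 0] `<=` chart_dom i.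
  apply: subset_trans Ki; rewrite [K](closure_id _).1 //; apply: closureS => q; exact: fK.
have If := vol_mu cf supp.
have mf := (measurable_EFinP _ _).2 (borel_continuous cf).
have mS : measurable ([set q | (e < f q)%R] : set (borel M)).
  apply: borel_open.
  have -> : [set q : M | e < f q] = f @^-1` [set x | e < x] by [].
  by apply: open_comp => [q _|]; [exact: cf|exact: open_gt].
have : (e%:E * mu ([set q | (e < f q)%R] : set (borel M)) <= \int[mu]_p (f p)%:E)%E.
  rewrite -(integral_cst mu mS).
  apply: (@le_trans _ _ (\int[mu]_(p in [set q | (e < f q)%R]) (f p)%:E)%E).
    apply: ge0_le_integral => //.
    - by move=> q _; rewrite lee_fin ltW.
    - exact: measurable_funS mf.
    - by move=> q /= /ltW; rewrite lee_fin.
  apply: ge0_subset_integral => //.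
  by move=> q _; rewrite lee_fin.
rewrite If => h; rewrite ltNge leye_eq; apply/negP => /eqP moo.
by move: h; rewrite moo mulry gtr0_sg // mul1e leye_eq.
Qed.

(** Every point lies in an open superlevel set of a bump function in a chart, of finite measure by
    [superlevel_finite]; compactness extracts a finite cover. *)
Lemma measure_finite : (mu [set: borel M] < +oo)%E.
Proof.
have h (p : M) : exists A : set M, [/\ open A, A p & (mu (A : set (borel M)) < +oo)%E].
  pose i := chart_at p; have dp : chart_dom i p by exact: chart_atP.
  have [r r0 rW] := @chart_radius R M i setT p openT Logic.I dp.
  have rU x : `|x - chart i p| <= r -> (chart i @` chart_dom i) x by move=> /rW [].
  pose f := bump i (chart i p) r.
  have cf : continuous f.
    move=> q; exact: (@smM_continuous _ _ _ (chart_at q) q openT Logic.I (chart_atP q) _ (bump_smooth r0 rU)).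
  have fp : 0 < f p by exact: bump_center.
  exists [set q | f p / 2 < f q]; split.
  - have -> : [set q : M | f p / 2 < f q] = f @^-1` [set x | f p / 2 < x] by [].
    by apply: open_comp => [q _|]; [exact: cf|exact: open_gt].
  - by rewrite /= ltr_pdivrMr // ltr_pMr // ltr1n.
  - apply: (superlevel_finite _ cf (bump_ge0 _ _ _) (chart_ball_closed rU) (chart_ball_dom rU) (@bump_supp _ _ _ _ _ r0)).
    by rewrite divr_gt0.
pose A p := projT1 (cid (h p)).
have AP p : [/\ open (A p), A p p & (mu (A p : set (borel M)) < +oo)%E] := projT2 (cid (h p)).
have := compactM; rewrite compact_cover => /(_ M setT A) [].
- by move=> p _; have [] := AP p.
- by move=> p _; exists p => //; have [] := AP p.
move=> D _ cov.
have mA p : measurable (A p : set (borel M)) by apply: borel_open; have [] := AP p.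
have fin (s : seq M) : measurable (\big[setU/set0]_(q <- s) (A q : set (borel M))) /\
    (mu (\big[setU/set0]_(q <- s) (A q : set (borel M))) < +oo)%E.
  elim: s => [|q s [m1 m2]]; first by rewrite big_nil measure0.
  rewrite big_cons; split; first exact: measurableU.
  apply: (le_lt_trans (measureU2 mu (mA q) m1)).
  by apply: lte_add_pinfty => //; have [] := AP q.
have [m1 m2] := fin (finmap.enum_fset D).
apply: le_lt_trans m2; apply: le_measure; rewrite ?inE //.
move=> q _; have [p pD Apq] := cov q Logic.I.
by rewrite -bigcup_seq; exists p.
Qed.

Lemma continuous_integrable (f : M -> R) : continuous f ->
  mu.-integrable [set: borel M] (EFin \o (f : borel M -> R)).
Proof.
move=> cf; apply: measurable_bounded_integrable => //; first exact: measure_finite.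
  exact: borel_continuous.
have cfc : compact (f @` [set: M]).
  by apply: continuous_compact => //; exact: continuous_subspaceT.
have [m [mr hm]] := compact_bounded cfc.
exists m; split=> // x mx q _; exact: hm.
Qed.

End Measure.

(** * First variation *)

Section DeriveRules.
Context {R : realType}.
Implicit Types (f g : R -> R) (t k : R).

Lemma isD_add f g t df dg : is_derive t 1 f df -> is_derive t 1 g dg ->
  is_derive t (1 : R) (fun s => f s + g s) (df + dg).
Proof. by move=> hf hg; exact: is_deriveD. Qed.

Lemma isD_cst t k : is_derive t (1 : R) (fun _ => k) (0 : R).
Proof. exact: is_derive_cst. Qed.

Lemma isD_mul f g t df dg : is_derive t 1 f df -> is_derive t 1 g dg ->
  is_derive t (1 : R) (fun s => f s * g s) (f t * dg + g t * df).
Proof. by move=> hf hg; exact: is_deriveM. Qed.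

Lemma isD_cmul k f t df : is_derive t 1 f df -> is_derive t (1 : R) (fun s => k * f s) (k * df).
Proof.
move=> hf; have := isD_mul (isD_cst t k) hf.
by rewrite mulr0 addr0.
Qed.

Lemma isD_mulc k f t df : is_derive t 1 f df -> is_derive t (1 : R) (fun s => f s * k) (df * k).
Proof.
move=> hf; have := isD_mul hf (isD_cst t k).
by rewrite mulr0 add0r [k * _]mulrC.
Qed.

Lemma isD_opp f t df : is_derive t 1 f df -> is_derive t (1 : R) (fun s => - f s) (- df).
Proof. by move=> hf; exact: is_deriveN. Qed.

Lemma isD_sub f g t df dg : is_derive t 1 f df -> is_derive t 1 g dg ->
  is_derive t (1 : R) (fun s => f s - g s) (df - dg).
Proof. by move=> hf hg; exact: (isD_add hf (isD_opp hg)). Qed.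

Lemma isD_sum (J : Type) (r : seq J) (f : J -> R -> R) t (df : J -> R) :
  (forall j, is_derive t 1 (f j) (df j)) ->
  is_derive t (1 : R) (fun s => \sum_(j <- r) f j s) (\sum_(j <- r) df j).
Proof.
move=> hf; elim: r => [|j r ih].
  by rewrite big_nil; under eq_fun do rewrite big_nil; exact: isD_cst.
rewrite big_cons; under eq_fun do rewrite big_cons; exact: (isD_add (hf j) ih).
Qed.

(** For [h] different from 0 the difference quotient is the function [G], which is continuous at 0
    since its denominator never vanishes, with value [w] there. *)
Lemma isD_rational (f v w : R) : 0 <= f ->
  is_derive (0 : R) (1 : R) (fun s => (1 + s ^+ 2 * f)^-1 * ((1 - s ^+ 2 * f) * v + s * w)) w.
Proof.
move=> f0; apply: cvg_is_derive1.
have p0 (h : R) : 1 + h ^+ 2 * f != 0.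
  by rewrite gt_eqF // ltr_wpDr // mulr_ge0 // sqr_ge0.
pose G (h : R) := (1 + h ^+ 2 * f)^-1 * (w - 2%:R * h * f * v).
have cG : G h @[h --> (0 : R)^'] --> w.
  have cs : sm setT G.
    have sI : sm [set: R] (fun x : R => x).
      by apply: (@sm_lin _ _ _ _ (fun v : R => v)) => x; exact: cvg_id.
    apply: sm_mul; first apply: sm_inv.
    - by apply: sm_add (sm_cst _ _) (sm_mul (sm_exp 2 sI) (sm_cst _ _)).
    - by move=> x _; exact: p0.
    - apply: (sm_sub (sm_cst _ _)).
      exact: (sm_mul (sm_mul (sm_mul (sm_cst _ _) sI) (sm_cst _ _)) (sm_cst _ _)).
  have [c _] := sm_derive openT cs.
  have := c 0 Logic.I; rewrite /prop_for /continuous_at.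
  have -> : G 0 = w by rewrite /G expr0n mul0r addr0 invr1 mul1r mulr0 !mul0r subr0.
  by move=> h; apply: cvg_trans h; apply: cvg_app; exact: cvg_within.
apply: cvg_trans cG; apply: near_eq_cvg; near=> h.
have hn0 : h != 0 by near: h; exact: nbhs_dnbhs_neq.
have p0' := p0 h.
by rewrite /G addr0; field; rewrite hn0 /= ?p0' //; lra.
Unshelve. all: by end_near. Qed.
End DeriveRules.

Section FamilyDerivative.
Context {R : realType} (M : manifold R 7).
Variables (phi : tfield M 3) (g T : tfield M 2).
Hypothesis gm : geometry phi g T.

Lemma octD_local (N : set M) i p (A B : ofield M) a : open N -> N p -> chart_dom i p ->
  (forall q, N q -> A i q = B i q) -> octD phi g T A i p a = octD phi g T B i p a.
Proof.
move=> oN Np dp AB; rewrite /octD AB //; congr (_ - _).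
have p1 : pd i a (fun q => (A i q).1) p = pd i a (fun q => (B i q).1) p.
  by apply: (pd_eq oN Np dp) => q Nq; rewrite AB.
have p2 b : pd i a (fun q => (A i q).2 0 b) p = pd i a (fun q => (B i q).2 0 b) p.
  by apply: (pd_eq oN Np dp) => q Nq; rewrite AB.
rewrite /nablaO p1; congr pair; apply/rowP => b; rewrite mxE [RHS]mxE p2.
by rewrite AB.
Qed.

Definition isDO (t : R) (X : R -> oct R) (dX : oct R) : Prop :=
  is_derive t 1 (fun s => (X s).1) dX.1 /\ forall b, is_derive t 1 (fun s => (X s).2 0 b) (dX.2 0 b).

Section At.
Variables (N : set M) (i : chart_index M) (p : M).
Hypotheses (oN : open N) (Ni : N `<=` chart_dom i) (Np : N p).
Let dp : chart_dom i p := Ni Np.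
Variables (A : R -> ofield M) (B : ofield M) (t : R).
Hypothesis sA : smO N (fun s q => A s i q).
Hypothesis dA : forall q, N q -> isDO t (fun s => A s i q) (B i q).

(** D is linear in the section, with coefficients independent of time, and coordinate derivatives
    commute with the time derivative by [pd_dt]. *)
Lemma isDO_octD a : isDO t (fun s => octD phi g T (A s) i p a) (octD phi g T B i p a).
Proof.
have [a1 a2] := sA; have [d1 d2] := dA Np.
have p1 : is_derive t 1 (fun s => pd i a (fun q => (A s i q).1) p) (pd i a (fun q => (B i q).1) p).
  have := smF_is_derive t (@sm_pd _ _ _ _ oN Ni (fun s q => (A s i q).1) a a1) Np.
  rewrite (@pd_dt _ _ _ oN i a (fun s q => (A s i q).1) t p a1 Np dp).
  rewrite (@pd_eq _ _ N i p oN Np dp a _ (fun q => (B i q).1)) // => q Nq.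
  by have [[_ ->] _] := dA Nq.
have p2 b : is_derive t 1 (fun s => pd i a (fun q => (A s i q).2 0 b) p) (pd i a (fun q => (B i q).2 0 b) p).
  have := smF_is_derive t (@sm_pd _ _ _ _ oN Ni (fun s q => (A s i q).2 0 b) a (a2 b)) Np.
  rewrite (@pd_dt _ _ _ oN i a (fun s q => (A s i q).2 0 b) t p (a2 b) Np dp).
  rewrite (@pd_eq _ _ N i p oN Np dp a _ (fun q => (B i q).2 0 b)) // => q Nq.
  by have [_ /(_ b) [_ ->]] := dA Nq.
split=> [|b].
  apply: (isD_sub p1); apply: isD_sub; first exact: isD_mulc.
  by apply: isD_sum => c; apply: isD_sum => d; apply: isD_mulc; apply: isD_cmul.
(* The vector part is unfolded so that its linearity in [X] is visible. The summand with factor 0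
   comes from the scalar part of the torsion octonion. *)
have E (X : ofield M) : (octD phi g T X i p a).2 0 b =
    (pd i a (fun q => (X i q).2 0 b) p + \sum_c christoffel g i p b a c * (X i p).2 0 c)
    - ((X i p).1 * (torsion_oct g T i p a).2 0 b + 0 * (X i p).2 0 b +
       \sum_k \sum_l \sum_d invmx (gram (g i p)) b d * phi i p [tuple k; l; d] * (X i p).2 0 k * (torsion_oct g T i p a).2 0 l).
  by rewrite [LHS]mxE [X in X + _]mxE [X in _ + X]mxE [X in - X]mxE [X in - (X + _)]mxE [X in - (X + _ + _)]mxE [X in - (_ + X + _)]mxE [X in - (_ + X)]mxE.
rewrite E; under eq_fun do rewrite E.
apply: isD_sub.
  by apply: (isD_add (p2 b)); apply: isD_sum => c; apply: isD_cmul.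
apply: (isD_add (isD_add (isD_mulc _ d1) (isD_cmul _ (d2 b)))).
apply: isD_sum => k; apply: isD_sum => l; apply: isD_sum => d.
by apply: isD_mulc; apply: isD_cmul.
Qed.

Lemma isD_oip (G : tensor R 2) X Y dX dY : isDO t X dX -> isDO t Y dY ->
  is_derive t 1 (fun s => oip G (X s) (Y s)) (oip G (X t) dY + oip G dX (Y t)).
Proof.
move=> [x1 x2] [y1 y2].
have h : is_derive t 1 (fun s => oip G (X s) (Y s)) ((X t).1 * dY.1 + (Y t).1 * dX.1 +
   \sum_a \sum_b (G [tuple a; b] * (X t).2 0 a * dY.2 0 b + (Y t).2 0 b * (G [tuple a; b] * dX.2 0 a))).
  apply: (isD_add (isD_mul x1 y1)); apply: isD_sum => a; apply: isD_sum => b.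
  by apply: isD_mul => //; apply: isD_cmul.
apply: (is_derive_eq h); rewrite /oip [dX.1 * _]mulrC addrACA; congr (_ + _).
rewrite -big_split; apply: eq_bigr => a _; rewrite -big_split; apply: eq_bigr => b _ /=.
by congr (_ + _); rewrite mulrC.
Qed.

Lemma isD_normsq :
  is_derive t 1 (fun s => oform_normsq g (octD phi g T (A s)) i p)
    (2%:R * \sum_a \sum_b invmx (gram (g i p)) a b *
      oip (g i p) (octD phi g T (A t) i p a) (octD phi g T B i p b)).
Proof.
have h : is_derive t 1 (fun s => oform_normsq g (octD phi g T (A s)) i p)
   (\sum_a \sum_b invmx (gram (g i p)) a b *
      (oip (g i p) (octD phi g T (A t) i p a) (octD phi g T B i p b) +
       oip (g i p) (octD phi g T B i p a) (octD phi g T (A t) i p b))).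
  apply: isD_sum => a; apply: isD_sum => b; apply: isD_cmul.
  exact: (isD_oip (g i p) (isDO_octD a) (isDO_octD b)).
apply: (is_derive_eq h).
under eq_bigr => a _ do under eq_bigr => b _ do rewrite mulrDr.
under eq_bigr do rewrite big_split; rewrite big_split /= mulr_natl mulr2n; congr (_ + _).
rewrite exchange_big; apply: eq_bigr => a _; apply: eq_bigr => b _.
rewrite (oipC _ _ (geom_sym gm dp)); congr (_ * _).
by have := congr1 (fun X : 'M[R]_7 => X a b) (invgram_sym (geom_sym gm dp)); rewrite mxE.
Qed.
End At.
End FamilyDerivative.

(** * Transfer of functions supported in a coordinate ball to R^7 *)

Section Extension.
Context {R : realType} (M : manifold R 7).
Variables (i : chart_index M) (c : 'rV[R]_7) (r : R).
Hypothesis r0 : 0 < r.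
Hypothesis rU : forall x : 'rV[R]_7, `|x - c| <= r -> (chart i @` chart_dom i) x.

Notation K := (@chart_ball R M i c r).

(** Extension by zero off the chart image, as in the restricted integrand of [volume_measure];
    keeping time as an argument gives joint smoothness on R x R^7. *)
Definition ext (F : R -> M -> R) (tx : R * 'rV[R]_7) : R :=
  if `[< (chart i @` chart_dom i) tx.2 >] then F tx.1 (chart_inv i tx.2) else 0.

Lemma ext_in F t q : chart_dom i q -> ext F (t, chart i q) = F t q.
Proof. by move=> dq; rewrite /ext asboolT /= ?chartK //; exists q. Qed.

Lemma ext_out F tx : ~ (chart i @` chart_dom i) tx.2 -> ext F tx = 0.
Proof. by move=> n; rewrite /ext asboolF. Qed.

Section Supported.
Variable F : R -> M -> R.
Hypothesis sF : smF (chart_dom i) F.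
Hypothesis F0 : forall t q, chart_dom i q -> ~ K q -> F t q = 0.

Lemma ext_supp t x : r < `|x - c| -> ext F (t, x) = 0.
Proof.
move=> rx; rewrite /ext; case: asboolP => // -[q dq /= qE].
rewrite -qE chartK // F0 // => -[y /= yr yE].
have := rU yr => -[q' dq' q'E].
by move: rx; rewrite -qE -yE -q'E chartK // q'E ltNge yr.
Qed.

Lemma ext_smooth : smooth_on setT (ext F).
Proof.
have cimE : cim i (chart_dom i) = chart i @` chart_dom i by rewrite /cim setIid.
have oU : open ([set: R] `*` (chart i @` chart_dom i)).
  by apply: open_setTX; exact: codom_open.
have cB : closed ([set: R] `*` [set x : 'rV[R]_7 | `|x - c| <= r]).
  have -> : [set: R] `*` [set x : 'rV[R]_7 | `|x - c| <= r] = snd @^-1` [set x : 'rV[R]_7 | `|x - c| <= r].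
    by apply/seteqP; split => [x []|x].
  by apply: closed_comp; [move=> x _; exact: cvg_snd|exact: closed_cball].
have sub : [set: R] `*` [set x : 'rV[R]_7 | `|x - c| <= r] `<=` [set: R] `*` (chart i @` chart_dom i).
  by move=> [t x] [_ /= xr]; split=> //; exact: rU.
have := @sF i; rewrite cimE => sFi.
have z0 (tx : R * 'rV[R]_7) : ([set: R] `*` (chart i @` chart_dom i)) tx ->
    ~ ([set: R] `*` [set x : 'rV[R]_7 | `|x - c| <= r]) tx -> F tx.1 (chart_inv i tx.2) = 0.
  case: tx => t x [_ /= Ux] nB.
  have := @ext_supp t x; rewrite /ext asboolT //=; apply.
  by rewrite ltNge; apply/negP => xr; apply: nB.
have h := smooth_on_zero_ext oU cB sub z0 sFi.
have -> // : ext F = (fun tx => if `[< ([set: R] `*` (chart i @` chart_dom i)) tx >] then F tx.1 (chart_inv i tx.2) else 0).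
apply/funext => tx; rewrite /ext; congr (if _ then _ else _).
by apply/asbool_equiv_eq; split=> [|[]].
Qed.

(** [Cc] measures supports from the origin, hence the radius |c| + r for a ball of radius [r]
    centred at [c]. *)
Lemma ext_Cc t : Cc (`|c| + r) (fun x => ext F (t, x)).
Proof.
split=> [x|x rx].
  have s := @smooth_on_slice R _ setT (ext F) t.
  apply: (smooth_on_continuous (U := setT)) => //; apply: s.
  by rewrite setXTT; exact: ext_smooth.
apply: ext_supp; rewrite -ltrBrDl in rx; apply: lt_le_trans rx _.
exact: lerB_dist.
Qed.

Lemma radius_ge0 : 0 <= `|c| + r.
Proof. by rewrite addr_ge0 // ltW. Qed.

(** The divergence theorem for one component: [rV_integral_deriv] applies because extension by zero
    commutes with the coordinate derivative. *)
Lemma integral_ext_pd a : Cc (`|c| + r) (fun x => ext (fun t => pd i a (F t)) (0, x)) /\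
  rV_integral (fun x => ext (fun t => pd i a (F t)) (0, x)) = 0.
Proof.
have ss : smooth_on setT (fun x => ext F (0, x)).
  by apply: smooth_on_slice; rewrite setXTT; exact: ext_smooth.
have dE : 'D_(delta_mx 0 a) (fun x => ext F (0, x)) = (fun x => ext (fun t => pd i a (F t)) (0, x)).
  apply/funext => x; rewrite /ext /=; case: asboolP => [Ux|nUx].
    have [q dq qE] := Ux; rewrite /pd -qE chartK //; apply: near_eq_derive.
    have : \forall y \near chart i q, (chart i @` chart_dom i) y.
      by apply: open_nbhs_nbhs; split; [exact: codom_open|exists q].
    by apply: filterS => y Uy; rewrite /ext asboolT.
  (* Off the chart image the distance to [c] exceeds [r], and still does so in a neighbourhood,
     where the extension is 0. *)
  rewrite -[RHS](derive_cst (0 : R) x (delta_mx 0 a)); apply: near_eq_derive.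
  have : \forall y \near x, r < `|y - c|.
    have cc : `|y - c| @[y --> x] --> `|x - c|.
      apply: (@cvg_comp _ _ _ (fun y : 'rV[R]_7 => y - c) (fun y => `|y|) _ (nbhs (x - c))).
        exact: (cvgB cvg_id (cvg_cst c)).
      exact: norm_continuous.
    apply: (@cvgr_gt R _ _ _ (fun y : 'rV[R]_7 => `|y - c|) `|x - c| cc r).
    by rewrite ltNge; apply/negP => /rU.
  by apply: filterS => y ry; exact: (@ext_supp 0 y ry).
have cD : continuous ('D_(delta_mx 0 a) (fun x => ext F (0, x))).
  by move=> x; exact: (smooth_on_continuous (smooth_onD _ ss) Logic.I).
rewrite -dE; split; first exact: (CcDeriv (ext_Cc 0) cD).
apply: (rV_integral_deriv radius_ge0 (ext_Cc 0) _ cD) => x.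
exact: (smooth_on_derivable _ ss Logic.I).
Qed.

Lemma integral_ext_dt (dF : M -> R) :
  (forall q, chart_dom i q -> is_derive (0 : R) (1 : R) (fun s => F s q) (dF q)) ->
  is_derive (0 : R) (1 : R) (fun t => rV_integral (fun x => ext F (t, x)))
    (rV_integral (fun x => ext (fun _ => dF) (0, x))).
Proof.
move=> hdF.
have sE := ext_smooth.
have d1 (t : R) x : is_derive t 1 (fun s => ext F (s, x)) ('D_((1 : R), (0 : 'rV[R]_7)) (ext F) (t, x)).
  exact: (is_derive_fst sE Logic.I).
have cF' x : {for ((0 : R), x), continuous ('D_((1 : R), (0 : 'rV[R]_7)) (ext F))}.
  exact: (smooth_on_continuous (smooth_onD _ sE) Logic.I).
have := derive_rV_integral radius_ge0 ext_Cc d1 cF'.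
have -> // : (fun x => 'D_((1 : R), (0 : 'rV[R]_7)) (ext F) (0, x)) = (fun x => ext (fun _ => dF) (0, x)).
apply/funext => x; have [_ <-] := d1 0 x; rewrite {2}/ext /=.
case: asboolP => [[q dq <-]|nUx].
  have -> : (fun s => ext F (s, chart i q)) = (fun s => F s q) by apply/funext => s; exact: ext_in.
  by rewrite chartK //; have [_ ->] := hdF q dq.
have -> : (fun s => ext F (s, x)) = cst 0 by apply/funext => s; rewrite ext_out.
exact: derive_cst.
Qed.
End Supported.
End Extension.

Section FirstVariation.
Context {R : realType} (M : manifold R 7).
Hypothesis compactM : compact [set: M].
Variables (phi : tfield M 3) (g T : tfield M 2) (vol : tfield M 7).
Hypothesis gm : geometry phi g T.
Hypothesis gv : volume_form g vol.
Variable mu : {measure set (borel M) -> \bar R}.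
Hypothesis vol_mu : volume_measure vol mu.

Lemma oip_jac j k q (X Y : oct R) : chart_dom j q -> chart_dom k q ->
  oip (g k q) (octmap (jac j k q) X) (octmap (jac j k q) Y) = oip (g j q) X Y.
Proof.
by move=> dj dk; have [_ /(_ j k q dj dk) ->] := geom_metric gm; rewrite oip_pullback.
Qed.

Lemma oip_ge0 j q (X : oct R) : chart_dom j q -> 0 <= oip (g j q) X X.
Proof.
move=> dj; rewrite /oip addr_ge0 // -?expr2 ?sqr_ge0 //.
have [->|x0] := eqVneq X.2 0; last exact/ltW/(geom_pos gm dj).
by rewrite ipE mul0mx mul0mx mxE.
Qed.

Lemma octD0 j q a : octD phi g T (fun _ _ => 0) j q a = 0.
Proof.
have om : omul (g j q) (phi j q) 0 (torsion_oct g T j q a) = 0.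
  rewrite /omul /= ipE mul0mx mul0mx mxE mul0r subr0 crossE.
  have -> : phi3 (phi j q) 0 (torsion_oct g T j q a).2 = 0.
    by apply/rowP => d; rewrite phi3E mul0mx mul0mx !mxE.
  by rewrite mul0mx !scale0r !addr0.
rewrite /octD om subr0 /nablaO; congr pair; first exact: pd_cst.
apply/rowP => b; rewrite mxE [RHS]mxE big1 ?addr0 => [|d _]; last by rewrite mxE mulr0.
exact: pd_cst.
Qed.

Lemma oct_section_smO (A : ofield M) j : oct_section A -> smO (chart_dom j) (fun _ q => A j q).
Proof.
move=> [_ s1 s2]; split=> [|b]; first exact: (smooth_in_smM (s1 j)).
exact: (smooth_in_smM (s2 j b)).
Qed.

Lemma smO_oct_family (A : R -> ofield M) : (forall t, oct_compatible (A t)) ->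
  (forall j, smO (chart_dom j) (fun t q => A t j q)) -> oct_family A.
Proof.
move=> cA sA; split=> // j => [|b]; have [s1 s2] := sA j.
  by have := @s1 j; rewrite /cim setIid.
by have := @s2 b j; rewrite /cim setIid.
Qed.

Variable V : ofield M.
Hypothesis critV : critical_point phi g T mu V.

Let usV : unit_section g V := critV.1.
Let cV : oct_compatible V. Proof. by have [[]] := usV. Qed.
Let sV j : smO (chart_dom j) (fun _ q => V j q). Proof. by have [s _] := usV; exact: oct_section_smO. Qed.
Let uV j q : chart_dom j q -> oip (g j q) (V j q) (V j q) = 1. Proof. by have [_] := usV; exact. Qed.

Variables (i : chart_index M) (c : 'rV[R]_7) (r : R).
Hypothesis r0 : 0 < r.
Hypothesis rU : forall x : 'rV[R]_7, `|x - c| <= r -> (chart i @` chart_dom i) x.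
Notation K := (@chart_ball R M i c r).

(* [eps] is the sign of the density, which is constant on small balls. *)
Variable eps : R.
Hypothesis epsP : forall q, K q -> `|dens vol i q| = eps * dens vol i q.

Variable W : ofield M.
Hypothesis cW : oct_compatible W.
Hypothesis sW : forall j, smO (chart_dom j) (fun _ q => W j q).
Hypothesis oW : forall j q, chart_dom j q -> oip (g j q) (V j q) (W j q) = 0.
Hypothesis W0 : forall j q, chart_dom j q -> ~ K q -> W j q = 0.

Let od j : open (chart_dom j) := @dom_open _ _ M j.
Let Ki : K `<=` chart_dom i := @chart_ball_dom _ _ _ _ _ rU.
Let oKC : open (~` K). Proof. by rewrite openC; exact: chart_ball_closed. Qed.

Let f (j : chart_index M) (q : M) : R := 4%:R^-1 * oip (g j q) (W j q) (W j q).

Let f_ge0 j q : chart_dom j q -> 0 <= f j q.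
Proof. by move=> dj; rewrite mulr_ge0 ?oip_ge0 // invr_ge0. Qed.

Let den_gt0 j q (t : R) : chart_dom j q -> 0 < 1 + t ^+ 2 * f j q.
Proof. by move=> dj; rewrite ltr_wpDr // mulr_ge0 ?sqr_ge0 ?f_ge0. Qed.

(* [(1 - s^2) / (1 + s^2)] and [2 s / (1 + s^2)], with [s = t |W| / 2], parametrize the circle
   rationally, so that no trigonometric function is needed. *)
Definition variation (t : R) : ofield M := fun j q =>
  (1 + t ^+ 2 * f j q)^-1 *: ((1 - t ^+ 2 * f j q) *: V j q + t *: W j q).

Let A := variation.

Lemma variation0 : A 0 = V.
Proof.
apply/funext => j; apply/funext => q; rewrite /A /variation expr0n mul0r addr0 subr0 invr1.
by rewrite !scale1r scale0r addr0.
Qed.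

Lemma variation_out t j q : chart_dom j q -> ~ K q -> A t j q = V j q.
Proof.
move=> dj nK; rewrite /A /variation /f W0 // oip0l !mulr0 addr0 subr0 invr1.
by rewrite !scale1r scaler0 addr0.
Qed.

Lemma variation_compat t : oct_compatible (A t).
Proof.
move=> j k q dj dk; rewrite -[RHS]/(octmap (jac j k q) (A t j q)).
have VE : V k q = octmap (jac j k q) (V j q) := cV dj dk.
have WE : W k q = octmap (jac j k q) (W j q) := cW dj dk.
have fE : f k q = f j q by rewrite /f WE oip_jac.
by rewrite /A /variation fE VE WE !octmapZ octmapD !octmapZ.
Qed.

Lemma variation_smooth j : smO (chart_dom j) (fun t q => A t j q).
Proof.
have sf : smF (chart_dom j) (fun _ q => f j q).
  exact: (smF_mul (od j) (smF_cst (od j) _) (sm_oip gm (od j) (@subset_refl _ _) (sW j) (sW j))).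
have st := smF_mul (od j) (smF_exp (od j) 2 (smF_time (od j))) sf.
apply: (smO_scale (od j)).
  apply: (smF_inv (od j)) => [|t q dj]; last by rewrite gt_eqF // den_gt0.
  exact: (smF_add (od j) (smF_cst (od j) 1) st).
apply: (smO_add (od j)).
  exact: (smO_scale (od j) (smF_sub (od j) (smF_cst (od j) 1) st) (sV j)).
exact: (smO_scale (od j) (smF_time (od j)) (sW j)).
Qed.

(** With <V, V> = 1, <V, W> = 0 and |W|^2 = 4 f, this is the identity (1 - t^2 f)^2 + 4 t^2 f = (1 +
    t^2 f)^2. *)
Lemma variation_unit t : unit_norm g (A t).
Proof.
move=> j q dj; rewrite /A /variation oipZl oipZr !(oipDl, oipDr, oipZl, oipZr) uV // oW //.
rewrite (oipC (W j q) _ (geom_sym gm dj)) oW //.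
have WW : oip (g j q) (W j q) (W j q) = 4%:R * f j q by rewrite /f mulrA divff ?mul1r // pnatr_eq0.
rewrite WW; have d0 : 1 + t ^+ 2 * f j q != 0 by rewrite gt_eqF // den_gt0.
by move: d0; move: (f j q) => y d0; field.
Qed.

Lemma variation_family : unit_family g A.
Proof.
split; last exact: variation_unit.
by apply: smO_oct_family; [exact: variation_compat|exact: variation_smooth].
Qed.

Let E t j q := oform_normsq g (octD phi g T (A t)) j q.
Let e t q := E t (chart_at q) q.

Lemma density_chart t j q : chart_dom j q -> e t q = E t j q.
Proof.
move=> dj; apply: (normsq_jac gm (chart_atP q) dj (variation_compat t)).
  exact: (smOS (@subIsetl _ _ _) (smO_slice t (od _) (variation_smooth _))).
exact: (smOS (@subIsetr _ _ _) (smO_slice t (od _) (variation_smooth _))).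
Qed.

Lemma density_smooth j : smF (chart_dom j) (fun t q => E t j q).
Proof. exact: (sm_normsq gm (od j) (@subset_refl _ _) (variation_smooth j)). Qed.

(** Near a point the varying chart [chart_at] can be replaced by a fixed one, by [density_chart],
    and in a fixed chart the density is smooth. *)
Lemma density_continuous t : continuous (e t).
Proof.
move=> q; set j := chart_at q; have dj : chart_dom j q by exact: chart_atP.
have ct : {for q, continuous (E t j)}.
  have s : smM (chart_dom j) (E t j) := @smF_slice _ _ _ (od j) (fun t q => E t j q) t (@density_smooth j).
  exact: (smM_continuous (od j) dj dj s).
rewrite /prop_for /continuous_at (density_chart t dj).
apply: cvg_trans ct; apply: near_eq_cvg.
have : \forall q' \near q, chart_dom j q' by apply: open_nbhs_nbhs; split; [exact: od|].
by apply: filterS => q' dj'; rewrite (density_chart t dj').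
Qed.

Lemma density_out t j q : chart_dom j q -> ~ K q -> E t j q = E 0 j q.
Proof.
move=> dj nK; apply: eq_bigr => a _; apply: eq_bigr => b _.
have oN : open (chart_dom j `&` ~` K) by apply: openI.
have h a' : octD phi g T (A t) j q a' = octD phi g T (A 0) j q a'.
  apply: (@octD_local _ _ phi g T _ j q (A t) (A 0) a' oN (conj dj nK) dj) => q' [dj' nK'].
  by rewrite variation0 variation_out.
by rewrite !h.
Qed.

(** The coordinate integrand of the energy difference. Subtracting the density at time 0 confines it
    to [K], where [eps * dens vol i q] is the absolute value of the density. *)
Let H t q := eps * dens vol i q * (E t i q - E 0 i q).

(** [volume_measure] does not apply to one energy density, which need not have support in a chart.
    The difference does, since the variation equals [V] off [K]; integrability of both densities
    allows the subtraction under the integral. *)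
Lemma energy_variation t : energy phi g T mu (A t) - energy phi g T mu (A 0) =
  2%:R^-1 * rV_integral (fun x => ext i H (t, x)).
Proof.
rewrite -mulrBr; congr (_ * _).
have ie s := continuous_integrable compactM vol_mu (density_continuous (t := s)).
transitivity (\int[mu]_q (e t q - e 0 q)).
  by rewrite (RintegralB _ (ie t) (ie 0)).
have cd : continuous (fun q => e t q - e 0 q).
  by move=> q; exact: (cvgB (@density_continuous t q) (@density_continuous 0 q)).
have out q : ~ K q -> e t q - e 0 q = 0.
  by move=> nK; rewrite /e density_out ?subrr //; exact: chart_atP.
have supp : closure [set q | e t q - e 0 q != 0] `<=` chart_dom i.
  apply: subset_trans Ki; rewrite [K](closure_id _).1; last exact: chart_ball_closed.
  by apply: closureS => q /eqP q0; apply: contrapT => /out.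
apply: (eq_trans (congr1 fine (vol_mu cd supp))).
apply: (congr1 (@rV_integral R 7)); apply/funext => x.
rewrite patchE /ext /=; case: asboolP => Ux; last first.
  by rewrite memNset.
rewrite mem_set // /H; have [q dq qE] := Ux.
have -> : chart_inv i x = q by rewrite -qE chartK.
rewrite !(density_chart _ dq) mulrC.
(* The sign relation [epsP] is known on [K] only; elsewhere the difference of densities vanishes, so
   the sign does not matter. *)
have [Kq|nKq] := pselect (K q); first by rewrite -/(dens vol i q) epsP.
by rewrite (density_out t dq nKq) subrr !mulr0.
Qed.

Let L q := \sum_a \sum_b invmx (gram (g i q)) a b *
  oip (g i q) (octD phi g T V i q a) (octD phi g T W i q b).

Lemma sm_densi : smF (chart_dom i) (fun _ q => eps * dens vol i q).
Proof. exact: (smF_mul (od i) (smF_cst (od i) eps) (sm_dens gv (@subset_refl _ _))). Qed.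

Lemma H_smooth : smF (chart_dom i) H.
Proof.
apply: (smF_mul (od i) sm_densi); apply: (smF_sub (od i) (@density_smooth i)).
exact: (@smF_slice _ _ _ (od i) (fun t q => E t i q) 0 (@density_smooth i)).
Qed.

(** The derivative of the energy at 0 is computed twice: it is 0 by criticality, and half of this
    integral by differentiation under the integral sign. The inner factor 2 comes from
    differentiating a quadratic expression. *)
Lemma first_variation_L :
  rV_integral (fun x => ext i (fun _ q => eps * dens vol i q * (2%:R * L q)) ((0 : R), x)) = 0.
Proof.
have dH q : chart_dom i q -> is_derive (0 : R) (1 : R) (fun s => H s q) (eps * dens vol i q * (2%:R * L q)).
  move=> dq; apply: isD_cmul.
  have dA q' : chart_dom i q' -> isDO 0 (fun s => A s i q') (W i q').
    by move=> dq'; split=> [|b]; [|rewrite /A /variation; under eq_fun do rewrite !mxE]; exact: (isD_rational _ _ (f_ge0 dq')).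
  have := isD_sub (isD_normsq gm (od i) (@subset_refl _ _) dq (variation_smooth i) dA) (isD_cst 0 (E 0 i q)).
  by rewrite subr0 -/A variation0.
have H0 t q : chart_dom i q -> ~ K q -> H t q = 0.
  by move=> dq nK; rewrite /H (density_out t dq nK) subrr mulr0.
have d1 := integral_ext_dt r0 rU H_smooth H0 dH.
have d2 : is_derive (0 : R) (1 : R) (fun t => energy phi g T mu (A t))
   (2%:R^-1 * rV_integral (fun x => ext i (fun _ q => eps * dens vol i q * (2%:R * L q)) ((0 : R), x))).
  have -> : (fun t => energy phi g T mu (A t)) = (fun t => energy phi g T mu (A 0) + 2%:R^-1 * rV_integral (fun x => ext i H (t, x))).
    by apply/funext => t; rewrite -energy_variation addrC subrK.
  rewrite -[X in is_derive _ _ _ X]add0r.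
  apply: (isD_add (isD_cst _ _)); exact: (isD_cmul _ d1).
have d3 := critV.2 _ variation_family (fun j q _ => congr1 (fun X : ofield M => X j q) variation0).
have := @derive_val _ _ _ _ _ _ _ d3; rewrite (@derive_val _ _ _ _ _ _ _ d2).
by move/eqP; rewrite mulf_eq0 invr_eq0 pnatr_eq0 /= => /eqP.
Qed.

(** By [divergence] this integrand differs from that of <DV, DW> by a sum of coordinate derivatives
    of functions supported in the ball, each of integral 0; [first_variation_L] disposes of the
    rest. *)
Lemma first_variation :
  rV_integral (fun x => ext i (fun _ q => eps * dens vol i q *
    oip (g i q) (octDstar phi g T (octD phi g T V) i q) (W i q)) ((0 : R), x)) = 0.
Proof.
pose X a q := eps * (dens vol i q * \sum_b invmx (gram (g i q)) a b *
      oip (g i q) (octD phi g T V i q b) (W i q)).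
have sD a : smO (chart_dom i) (fun _ q => octD phi g T V i q a) := sm_octD gm (od i) (@subset_refl _ _) a (sV i).
have sX0 a : smM (chart_dom i) (fun q => dens vol i q * \sum_b invmx (gram (g i q)) a b *
      oip (g i q) (octD phi g T V i q b) (W i q)).
  apply: (smF_mul (od i) (sm_dens gv (@subset_refl _ _))); apply: (smF_sum (od i)) => b.
  exact: (smF_mul (od i) (sm_invgram gm (od i) (@subset_refl _ _) a b) (sm_oip gm (od i) (@subset_refl _ _) (sD b) (sW i))).
have sX a : smF (chart_dom i) (fun _ => X a) := smF_mul (od i) (smF_cst (od i) eps) (sX0 a).
have oip0r q (B : oct R) : oip (g i q) B 0 = 0 by rewrite -[0](scale0r 0) oipZr mul0r.
have X0 a (t : R) q : chart_dom i q -> ~ K q -> X a q = 0.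
  by move=> dq nK; rewrite /X W0 // big1 ?mulr0 // => b _; rewrite oip0r mulr0.
have IX a := integral_ext_pd r0 rU (sX a) (X0 a) a.
have [CS IS] := rV_integral_sum0 (index_enum 'I_7) (radius_ge0 c r0) (fun a => (IX a).1) (fun a => (IX a).2).
have div q : chart_dom i q -> \sum_a pd i a (X a) q = eps * dens vol i q * (L q -
    oip (g i q) (octDstar phi g T (octD phi g T V) i q) (W i q)).
  move=> dq; rewrite -mulrA -(divergence gm gv (od i) (@subset_refl _ _) dq (sV i) (sW i)) mulr_sumr.
  by apply: eq_bigr => a _; rewrite (pdZ (od i) dq dq).
set S := (fun x => _).
(* The factor 1/2 undoes the 2 carried by the integrand of [first_variation_L]. *)
have -> : S = (fun x => 2%:R^-1 * ext i (fun _ q => eps * dens vol i q * (2%:R * L q)) ((0 : R), x) -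
   \sum_a ext i (fun _ q => pd i a (X a) q) ((0 : R), x)).
  apply/funext => x; rewrite /S /ext /=; case: asboolP => [[q dq <-]|_]; last by rewrite big1 ?mulr0 ?subr0.
  rewrite chartK // div //.
  by set o := oip _ _ _; field.
have sL : smF (chart_dom i) (fun _ q => eps * dens vol i q * (2%:R * L q)).
  apply: (smF_mul (od i) sm_densi); apply: (smF_mul (od i) (smF_cst (od i) _)).
  apply: (smF_sum (od i)) => a; apply: (smF_sum (od i)) => b.
  apply: (smF_mul (od i) (sm_invgram gm (od i) (@subset_refl _ _) a b)).
  exact: (sm_oip gm (od i) (@subset_refl _ _) (sD a) (sm_octD gm (od i) (@subset_refl _ _) b (sW i))).
have DW0 q a : chart_dom i q -> ~ K q -> octD phi g T W i q a = 0.
  move=> dq nK.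
  have oN : open (chart_dom i `&` ~` K) by apply: openI.
  rewrite (@octD_local _ _ phi g T _ i q W (fun _ _ => 0) a oN (conj dq nK) dq); last by move=> q' [dq' nK']; exact: W0.
  exact: octD0.
have L0 (t : R) q : chart_dom i q -> ~ K q -> eps * dens vol i q * (2%:R * L q) = 0.
  move=> dq nK; rewrite /L big1 ?mulr0 // => a _; rewrite big1 // => b _.
  by rewrite DW0 // oip0r mulr0.
have CL := ext_Cc rU sL L0 0.
rewrite (rV_integralB (radius_ge0 c r0)); [|exact: CcZ|exact: CS].
rewrite IS subr0 (rV_integralZ _ (radius_ge0 c r0) CL) first_variation_L.
by rewrite mulr0.
Qed.

End FirstVariation.

(** * The test field and the Euler-Lagrange equation *)

Section EulerLagrange.
Context {R : realType} (M : manifold R 7).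

Lemma smO_zero_ext (K N : set M) i (X : R -> M -> oct R) : open N -> closed K -> K `<=` chart_dom i ->
  smO (chart_dom i `&` N) X -> (forall t q, chart_dom i q -> N q -> ~ K q -> X t q = 0) ->
  smO N (fun t q => if `[< chart_dom i q >] then X t q else 0).
Proof.
move=> oN cK Ki [s1 s2] X0; split=> [|b].
  apply: (smF_eq oN (smF_zero_ext oN cK Ki s1 _)) => [t q di Nq nK|t q _]; first by rewrite X0.
  by case: asboolP.
apply: (smF_eq oN (smF_zero_ext oN cK Ki (s2 b) _)) => [t q di Nq nK|t q _].
  by rewrite X0 // mxE.
by case: asboolP => // _; rewrite mxE.
Qed.

Variables (phi : tfield M 3) (g T : tfield M 2).
Hypothesis gm : geometry phi g T.

Lemma oip_gt0 j q (X : oct R) : chart_dom j q -> X != 0 -> 0 < oip (g j q) X X.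
Proof.
move=> dj X0; rewrite /oip -expr2.
have [x20|x20] := eqVneq X.2 0; last by rewrite ltr_wpDl ?sqr_ge0 // (geom_pos gm dj).
have x10 : X.1 != 0.
  by apply: contra X0 => /eqP x10; case: X x10 x20 => x y /= -> ->.
by rewrite x20 ipE mul0mx mul0mx mxE addr0 exprn_even_gt0.
Qed.

(** By the cocycle rule this matrix is idempotent, and it is invertible. *)
Lemma jac_id (i : chart_index M) q : chart_dom i q -> jac i i q = 1%:M.
Proof.
move=> di; have uJ := jac_unit gm di di.
by rewrite -(mulmxK uJ (jac i i q)) (jac_cocycle di di di) mulmxV.
Qed.

Section TestField.
Variable V : ofield M.
Hypothesis cV : oct_compatible V.
Hypothesis sV : forall j, smO (chart_dom j) (fun _ q => V j q).
Hypothesis uV : unit_norm g V.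
Variables (i : chart_index M) (c : 'rV[R]_7) (r : R) (Z0 : oct R).
Hypothesis r0 : 0 < r.
Hypothesis rU : forall x : 'rV[R]_7, `|x - c| <= r -> (chart i @` chart_dom i) x.
Notation K := (@chart_ball R M i c r).

Let Z (j : chart_index M) (q : M) : oct R := octmap (jac i j q) Z0.

(* The constant field [Z0] of the chart [i], projected orthogonally to [V] and cut off. *)
Definition test_field : ofield M := fun j q =>
  if `[< chart_dom i q >]
  then bumpE 0 (bump_arg i c r q) *: (Z j q - oip (g j q) (Z j q) (V j q) *: V j q)
  else 0.

Lemma test_field_out j q : ~ K q -> test_field j q = 0.
Proof.
move=> nK; rewrite /test_field; case: asboolP => // di.
by rewrite (bump_out r0 di nK) scale0r.
Qed.

Lemma test_field_compat : oct_compatible test_field.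
Proof.
move=> j k q dj dk; rewrite -[RHS]/(octmap (jac j k q) (test_field j q)) /test_field.
case: asboolP => [di|_]; last by rewrite /octmap mul0mx.
have ZE : Z k q = octmap (jac j k q) (Z j q).
  by rewrite /Z /octmap /= -mulmxA (jac_cocycle di dj dk).
have VE : V k q = octmap (jac j k q) (V j q) := cV dj dk.
have oE : oip (g k q) (Z k q) (V k q) = oip (g j q) (Z j q) (V j q).
  by rewrite ZE VE (oip_jac gm _ _ dj dk).
by rewrite octmapZ octmapD octmapN octmapZ -ZE -VE oE.
Qed.

Lemma test_field_orth j q : chart_dom j q -> oip (g j q) (V j q) (test_field j q) = 0.
Proof.
move=> dj; rewrite /test_field; case: asboolP => [di|_]; last first.
  by rewrite -[0](scale0r 0) oipZr mul0r.
rewrite oipZr oipDr oipNr oipZr (uV dj) mulr1 (oipC (V j q) _ (geom_sym gm dj)).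
by rewrite subrr mulr0.
Qed.

Lemma test_field_smooth j : smO (chart_dom j) (fun _ q => test_field j q).
Proof.
have oj := @dom_open _ _ M j; have oi := @dom_open _ _ M i.
have oij : open (chart_dom i `&` chart_dom j) by exact: openI.
have Nj : chart_dom i `&` chart_dom j `<=` chart_dom j by exact: subIsetr.
have sZ : smO (chart_dom i `&` chart_dom j) (fun _ q => Z j q).
  split=> [|b]; first exact: (smF_cst oij _).
  apply: (smF_eq (F := fun _ q => \sum_k Z0.2 0 k * jac i j q k b) oij) => [|t q _]; last by rewrite mxE.
  by apply: (smF_sum oij) => k; apply: (smF_mul oij (smF_cst oij _)); exact: smM_jac.
have sVj := smOS Nj (@sV j).
apply: (smO_zero_ext (X := fun _ q => bumpE 0 (bump_arg i c r q) *: (Z j q - oip (g j q) (Z j q) (V j q) *: V j q))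
  oj (chart_ball_closed rU) (chart_ball_dom rU)).
  apply: (smO_scale oij); first exact: (@smFS _ _ _ _ (fun _ q => bumpE 0 (bump_arg i c r q)) (@subIsetl _ _ _) (@sm_bump_arg _ _ i c r)).
  apply: (smO_sub oij sZ); apply: (smO_scale oij) => //.
  exact: (sm_oip gm oij Nj sZ sVj).
by move=> t q di _ nK; rewrite (bump_out r0 di nK) scale0r.
Qed.

(** The projection orthogonal to [V] is self-adjoint, so it moves from the constant field onto [X];
    in the chart [i] itself the Jacobian is the identity. *)
Lemma oip_test_field q X : chart_dom i q -> oip (g i q) X (test_field i q) =
  bumpE 0 (bump_arg i c r q) * oip (g i q) (X - oip (g i q) X (V i q) *: V i q) Z0.
Proof.
move=> di; rewrite /test_field asboolT // /Z jac_id // /octmap mulmx1 -surjective_pairing.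
rewrite oipZr oipDr oipNr oipZr oipDl oipNl oipZl (oipC (V i q) Z0 (geom_sym gm di)).
by rewrite [oip _ Z0 _ * _]mulrC.
Qed.
End TestField.
End EulerLagrange.

Theorem proposition10p1 (R : realType) (M : manifold R 7)
    (compactM : compact [set: M])
    (phi : tfield M 3) (g : tfield M 2) (vol : tfield M 7)
    (G2phi : G2_structure phi) (metric_g : G2_metric phi g vol)
    (T : tfield M 2) (torsionT : torsion phi g vol T)
    (mu : {measure set (borel M) -> \bar R}) (vol_mu : volume_measure vol mu)
    (V : ofield M) (critV : critical_point phi g T mu V)
    (i : chart_index M) (p : M) (dom_p : chart_dom i p) :
  octDstar phi g T (octD phi g T V) i p
  - oform_normsq g (octD phi g T V) i p *: V i p = 0.
Proof.
have gv : volume_form g vol by have [] := metric_g.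
have gm : geometry phi g T.
  have [[tg gp] _ _] := metric_g; have [tphi pphi] := G2phi; have [tT _] := torsionT.
  split=> //; try by move=> j q dj; have [] := gp j q dj.
  by move=> j q dj a b d; apply: positive3_swap; exact: pphi.
have [[oV uV] _] := critV; have cV : oct_compatible V by have [] := oV.
have sV j : smO (chart_dom j) (fun _ q => V j q) by exact: oct_section_smO.
have oi := @dom_open _ _ M i.
pose Y q := octDstar phi g T (octD phi g T V) i q - oform_normsq g (octD phi g T V) i q *: V i q.
rewrite -/(Y p); apply/eqP/negP => /negP Y0.
pose eps := Num.sg (dens vol i p).
(* On [S] the density keeps the sign it has at [p], and [Y q] still has positive product with the
   constant field [Y p]. Both conditions are open at [p], so a coordinate ball fits inside. *)
pose S := [set q | 0 < eps * dens vol i q /\ 0 < oip (g i q) (Y q) (Y p)].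
have subT : chart_dom i `<=` chart_dom i by [].
have sDD := sm_octDstar gm oi subT (A := fun _ => V) (sV i).
have sY : smO (chart_dom i) (fun _ q => Y q).
  apply: (smO_sub oi sDD); apply: (smO_scale oi) (sV i).
  exact: (sm_normsq gm oi subT (A := fun _ => V) (sV i)).
have sYp : smO (chart_dom i) (fun _ _ => Y p).
  by split=> [|b]; exact: (smF_cst oi).
have ced : {for p, continuous (fun q => eps * dens vol i q)}.
  exact: (smM_continuous oi dom_p dom_p (smF_mul oi (smF_cst oi eps) (sm_dens gv subT))).
have cu : {for p, continuous (fun q => oip (g i q) (Y q) (Y p))}.
  exact: (smM_continuous oi dom_p dom_p (sm_oip gm oi subT sY sYp)).
have edp : 0 < eps * dens vol i p.
  by rewrite /eps -normrEsg normr_gt0 (dens_neq0 gm gv subT dom_p).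
have up : 0 < oip (g i p) (Y p) (Y p) by exact: (oip_gt0 gm).
have nS : nbhs p S.
  have n1 := cvgr_gt _ ced _ edp; have n2 := cvgr_gt _ cu _ up.
  have fp := @nbhs_filter M p; exact: (filterI (n1 fp) (n2 fp)).
have [r r0 rS] := chart_radius (open_interior S) nS dom_p.
have rU x : `|x - chart i p| <= r -> (chart i @` chart_dom i) x by move=> /rS [].
pose c := chart i p; pose W := test_field g V i c r (Y p).
have KS q : chart_ball i c r q -> S q.
  by move=> [x /= xr <-]; have [_ /interior_subset] := rS x xr.
have epsP q : chart_ball i c r q -> `|dens vol i q| = eps * dens vol i q.
  move=> /KS [e0 _]; have : `|eps * dens vol i q| = eps * dens vol i q by rewrite gtr0_norm.
  rewrite normrM /eps normr_sg (dens_neq0 gm gv subT dom_p) mul1r.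
  exact.
have W0 j q : chart_dom j q -> ~ chart_ball i c r q -> W j q = 0.
  by move=> _; exact: test_field_out.
have cW : oct_compatible W := test_field_compat gm cV i c r (Y p).
have sW j : smO (chart_dom j) (fun _ q => W j q) := test_field_smooth gm sV (Y p) r0 rU j.
have oW j q : chart_dom j q -> oip (g j q) (V j q) (W j q) = 0 := test_field_orth gm uV i c r (Y p) (j:=j) (q:=q).
have I0 := first_variation compactM gm gv vol_mu critV r0 rU epsP cW sW oW W0.
pose F (t : R) q := eps * dens vol i q * oip (g i q) (octDstar phi g T (octD phi g T V) i q) (W i q).
(* After the projection has moved onto D*DV, [octDstar_unit] recognises the subtracted coefficient
   as |DV|^2, so that the projected field is [Y]. *)
have FE t q : chart_dom i q -> F t q = eps * dens vol i q *
    (bumpE 0 (bump_arg i c r q) * oip (g i q) (Y q) (Y p)).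
  move=> di; rewrite /F (oip_test_field gm) //.
  by rewrite (octDstar_unit gm oi subT di (sV i) (fun q' d => uV i q' d)).
have sF : smF (chart_dom i) F.
  apply: (smF_mul oi (smF_mul oi (smF_cst oi eps) (sm_dens gv subT))).
  exact: (sm_oip gm oi subT sDD (sW i)).
have F0 t q : chart_dom i q -> ~ chart_ball i c r q -> F t q = 0.
  by move=> di nK; rewrite FE // (bump_out r0 di nK) mul0r mulr0.
(* The integral is 0 by [I0], so nonnegativity everywhere together with positivity at the centre [c]
   is contradictory. *)
have := rV_integral_gt0 (radius_ge0 c r0) (ext_Cc rU sF F0 0) (c := c) _ _.
rewrite [rV_integral _]I0 ltxx => h.
suff : false by []; apply: h => [x|].
  rewrite /ext; case: asboolP => // -[q di <-] /=; rewrite chartK //.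
  have [Kq|nK] := pselect (chart_ball i c r q); last by rewrite F0.
  have [e0 u0] := KS q Kq.
  by rewrite FE // (mulr_ge0 (ltW e0)) // (mulr_ge0 (bumpE0_ge0 _)) // ltW.
rewrite ext_in // FE // (mulr_gt0 edp) // (mulr_gt0 _ up) //.
by apply: bumpE0_gt0; rewrite /bump_arg big1 ?subr0 ?exprn_gt0 // => k _; rewrite subrr expr0n.
Qed.
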